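(* Let $(\mathcal{N}_{n,ij})_{(i,j)\in L_n}$ be a structured interaction network process that is momentarily-$m$-dependent, and let $\phi_{n,ij}:[0,T]\to\mathbb{R}$ for $n\in\mathbb{N}$, $(i,j)\in L_n$ be random functions (not necessarily predictable). Let furthermore $\tilde{\phi}^J_{n,ij}:[0,T]\to\mathbb{R}$ for $(i,j)\in J\subseteq L_n$ with $|J|\leq2$ be of leave-$m$-out type, i.e. predictable with respect to $\tilde{\mathcal{F}}^{n,J,m}_{\{(i,j)\},t}$. Then \begin{align*} &\mathbb{E}\Bigg(\Big(\sum_{(i,j)\in L_n}\int_0^T\phi_{n,ij}(t)dM_{n,ij}(t)\Big)^2\Bigg)\leq\sum_{(i,j)\in L_n}\int_0^T\mathbb{E}\Big(\tilde{\phi}_{n,ij}^{ij}(t)^2C_{n,ij}(t)\lambda_{n,ij}(t)\Big)dt\\ &+2\sum_{(i,j),(k,l)\in L_n}\mathbb{E}\Bigg(\int_0^T\tilde{\phi}^{ij,kl}_{n,ij}(t)dM_{n,ij}(t)\int_0^T\Big(\phi_{n,kl}(r)-\tilde{\phi}_{n,kl}^{ij,kl}(r)\Big)dM_{n,kl}(r)\Bigg)\\ &+\sum_{(i,j),(k,l)\in L_n}\mathbb{E}\Bigg(\int_0^T\Big(\phi_{n,ij}(t)-\tilde{\phi}_{n,ij}^{ij,kl}(t)\Big)dM_{n,ij}(t)\int_0^T\Big(\phi_{n,kl}(r)-\tilde{\phi}_{n,kl}^{ij,kl}(r)\Big)dM_{n,kl}(r)\Bigg). \end{align*}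
   Context: **Structured interaction network.** For $n\in\mathbb{N}$ let $V_n=\{1,\dots,n\}$, let $L_n$ be the set of all directed (alternatively, all undirected) pairs $(i,j)$ with $i,j\in V_n$, $i\neq j$, and $r_n=|L_n|$. Fix $T>0$. A structured interaction network process consists, for each $n$, of a filtration $(\mathcal{F}^n_t)_{t\in[0,T]}$, processes $\mathcal{N}_{n,ij}=(N_{n,ij},X_{n,ij},C_{n,ij})$, $(i,j)\in L_n$, and random functions $d_t^n:L_n\times L_n\to[0,\infty]$, $t\in[0,T]$, such that: $N_{n,ij}:[0,T]\to\mathbb{N}$ are counting processes adapted to $\mathcal{F}_t^n$; $X_{n,ij}:[0,T]\to\mathbb{R}^q$ and $C_{n,ij}:[0,T]\to\{0,1\}$ are predictable with respect to $\mathcal{F}_t^n$; the intensity function of $N_{n,ij}$ is $\lambda_{n,ij}(t)=C_{n,ij}(t)\lambda(t,X_{n,ij}(t))$ for some link function $\lambda:[0,T]\times\mathbb{R}^q\to[0,\infty)$; for every permutation $\sigma$ of $V_n$ the arrays $(\mathcal{N}_{n,ij})_{(i,j)\in L_n}$ and $(\mathcal{N}_{n,\sigma(i)\sigma(j)})_{(i,j)\in L_n}$ have the same distribution; for each $t$, $d_t^n$ is almost surely a metric; and $t\mapsto d_t^n(u,v)$ is predictable with respect to $\mathcal{F}_t^n$ for all $u,v\in L_n$. Put $M_{n,ij}(t)=N_{n,ij}(t)-\int_0^t\lambda_{n,ij}(s)ds$. For $J\subseteq L_n$ let $d_s^n(u,J)=\min_{v\in J}d_s^n(u,v)$. **Momentary-$m$-dependence.**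 For $m\in[0,\infty)$ the process is momentarily-$m$-dependent if for all $n\in\mathbb{N}$ there is $\delta_n>0$ such that for all $t_0\in[0,T]$ and all $J\subseteq L_n$: given $\mathcal{F}^n_{t_0}$, the family $(\mathcal{N}_{n,ij}(t))_{(i,j)\in J,\,t\in[t_0,t_0+6\delta_n]}$ is conditionally independent of $\sigma(\mathcal{N}_{n,ij}(r)\mathbf{1}(d_s^n((i,j),J)\geq m): s\leq t_0,\ r\leq s+6\delta_n,\ (i,j)\in L_n)$. (Times are restricted to $[0,T]$.) **Short-sighted leave-$J$-out filtration.** For $I\subseteq J\subseteq L_n$, $$\tilde{\mathcal{F}}^{n,J,m}_{I,t}=\sigma(X_{n,ij}(\tau):(i,j)\in I,\tau\leq t)\vee\sigma\big(\mathcal{N}_{n,ij}(r)\mathbf{1}(d_s^n((i,j),J)\geq m): s\leq\max(0,t-4\delta_n),\ r\leq s+6\delta_n,\ (i,j)\in L_n\big).$$ **Notation.** Superscripts $ij$ and $ij,kl$ denote $J=\{(i,j)\}$ and $J=\{(i,j),(k,l)\}$. Integrals with respect to $M_{n,ij}$ are Itô integrals for predictable integrands and otherwise are understood path-wise as Stieltjes integrals.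
   Formalization: Added assumptions: almost surely no two links jump simultaneously; λ and φ are measurable; ∫|φ|λ dt is a.s. finite; each φ~^J (|J|≤2) has E∫φ~²Cλ dt finite; the products in the last two sums are integrable. Without the no-common-jump or L² condition the bound can fail. *)

(* Defs.v *)
From HB Require Import structures.
From mathcomp Require Import all_boot all_order all_algebra all_fingroup.
From mathcomp Require Import all_classical all_reals all_analysis.
From mathcomp Require Import measurable_realfun.
Set Implicit Arguments.
Unset Strict Implicit.
Unset Printing Implicit Defensive.
Import Order.TTheory GRing.Theory Num.Theory.
Import numFieldNormedType.Exports.
Local Open Scope classical_set_scope.
Local Open Scope ring_scope.

(* [dir = true]: directed (ordered) pairs of distinct vertices;
   [dir = false]: undirected pairs, i.e. two-element sets of vertices. *)
Definition dlink (n : nat) : finType := {p : 'I_n * 'I_n | p.1 != p.2}.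
Definition ulink (n : nat) : finType := {e : {set 'I_n} | #|e| == 2%N}.
Definition link (dir : bool) (n : nat) : finType :=
  if dir then dlink n else ulink n.

Lemma dlink_perm_subproof n (s : 'S_n) (u : dlink n) :
  s (val u).1 != s (val u).2.
Proof. by rewrite (inj_eq perm_inj); exact: (valP u). Qed.

Lemma ulink_perm_subproof n (s : 'S_n) (u : ulink n) :
  #|[set s i | i in val u]%SET| == 2%N.
Proof. by rewrite card_imset; [exact: (valP u)|exact: perm_inj]. Qed.

Definition link_perm (dir : bool) (n : nat) (s : 'S_n) :
    link dir n -> link dir n :=
  if dir as b return link b n -> link b n
  then fun u : dlink n =>
         exist _ (s (val u).1, s (val u).2) (dlink_perm_subproof s u)
  else fun u : ulink n =>
         exist _ [set s i | i in val u]%SET (ulink_perm_subproof s u).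

(* Stochastic bases and processes on [0, T].  A process is a function
   [R -> Omega -> S]; only its values at times in [0, T] matter. *)
Section processes.
Context {R : realType} {d : measure_display} {Omega : measurableType d}.
Variables (P : probability Omega R) (T : R).

Definition filtration (F : R -> set (set Omega)) : Prop :=
  [/\ forall t, 0 <= t <= T -> sigma_algebra setT (F t),
      forall t, 0 <= t <= T -> F t `<=` measurable &
      forall s t, 0 <= s -> s <= t -> t <= T -> F s `<=` F t].

(* Generators of the predictable sigma-algebra on [0, T] x Omega. *)
Definition predictable_rectangle (F : R -> set (set Omega)) :
    set (set (R * Omega)) :=
  [set A | (exists2 B, F 0 B & A = [set 0] `*` B) \/
           (exists s t B, [/\ 0 <= s, s < t, t <= T, F s B &
                              A = `]s, t] `*` B])].

Definition predictable (F : R -> set (set Omega)) {d'} {S : measurableType d'}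
    (Y : R -> Omega -> S) : Prop :=
  forall B : set S, measurable B ->
    <<s `[0, T] `*` setT, predictable_rectangle F >>
      (`[0, T] `*` setT `&` [set p | B (Y p.1 p.2)]).

Definition measurable_process {d'} {S : measurableType d'}
    (Y : R -> Omega -> S) : Prop :=
  measurable_fun (`[0, T] `*` setT) (fun p : R * Omega => Y p.1 p.2).

Definition sigma_gen {I : Type} {d'} {S : measurableType d'}
    (D : set I) (Y : I -> Omega -> S) : set (set Omega) :=
  <<s [set A | exists i B, [/\ D i, measurable B & A = Y i @^-1` B]] >>.

(* [f] is a version of the conditional probability P(A | G). *)
Definition cond_prob (G : set (set Omega)) (A : set Omega) (f : Omega -> R) :
    Prop :=
  [/\ forall B : set R, measurable B -> G (f @^-1` B),
      P.-integrable setT (EFin \o f) &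
      forall E, G E -> (\int[P]_(w in E) (f w)%:E = P (A `&` E))%E].

(* P(A & B | G) = P(A | G) P(B | G) for all A in [H1], B in [H2]. *)
Definition cond_indep (G H1 H2 : set (set Omega)) : Prop :=
  forall A B, H1 A -> H2 B -> exists fA fB : Omega -> R,
    [/\ cond_prob G A fA, cond_prob G B fB &
        cond_prob G (A `&` B) (fA \* fB)].

(* [f] has a jump at [t]: it is not equal to [f t] just before [t]. *)
Definition jumps_at (f : R -> nat) (t : R) : Prop :=
  ~ (\forall s \near t^'-, f s = f t).

Definition counting_path (f : R -> nat) : Prop :=
  [/\ f 0 = 0%N,
      forall s t, 0 <= s -> s <= t -> t <= T -> (f s <= f t)%N,
      forall t, 0 <= t < T -> \forall s \near t^'+, f s = f t &
      forall t, 0 < t <= T -> \forall s \near t^'-, (f t <= (f s).+1)%N].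

(* A multivariate counting process, in the usual sense of the counting process
   literature: the components are counting processes, no two of which jump
   simultaneously.  The last clause is what makes the martingales of distinct
   components orthogonal. *)
Definition counting_process (F : R -> set (set Omega)) {I : Type}
    (N : I -> R -> Omega -> nat) : Prop :=
  [/\ forall i w, counting_path ((N i)^~ w),
      forall i t k, 0 <= t <= T -> F t [set w | N i t w = k] &
      {ae P, forall w, forall i j, i <> j -> forall t, 0 < t <= T ->
         ~ (jumps_at ((N i)^~ w) t /\ jumps_at ((N j)^~ w) t)}].

(* The Lebesgue-Stieltjes measure of [F]; zero if [F] is not a nondecreasing
   right-continuous function. *)
Definition stieltjes_measure (F : R -> R) :
    {measure set (measurableTypeR R) -> \bar R} :=
  match pselect (exists G : cumulative R R, G = F :> (R -> R)) with
  | left h => lebesgue_stieltjes_measure (projT1 (cid h))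
  | right _ => mzero
  end.

(* The measure dN of a counting path on ]0, T]; the path is extended to the
   line as a constant on both sides of [0, T]. *)
Definition counting_stieltjes (f : R -> nat) :=
  stieltjes_measure (fun t => (f (Num.max 0 (Num.min t T)))%:R).

(* [lam] is the F-intensity of [N]: it is F-predictable, nonnegative, a.s.
   integrable, and E int H dN = E int H lam ds for every nonnegative
   F-predictable H (Bremaud, Point Processes and Queues, Def. II.D7). *)
Definition intensity (F : R -> set (set Omega)) (N : R -> Omega -> nat)
    (lam : R -> Omega -> R) : Prop :=
  [/\ predictable F lam,
      forall t w, 0 <= t <= T -> 0 <= lam t w,
      {ae P, forall w, (\int[@lebesgue_measure R]_(t in `[0%R, T])
                           (lam t w)%:E < +oo)%E} &
      forall H : R -> Omega -> R, predictable F H ->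
        (forall t w, 0 <= t <= T -> 0 <= H t w) ->
        (\int[P]_w \int[counting_stieltjes (N^~ w)]_(t in `]0%R, T])
             (H t w)%:E =
         \int[P]_w \int[@lebesgue_measure R]_(t in `[0%R, T])
             (H t w * lam t w)%:E)%E].

(* int_0^T phi dM for M(t) = N(t) - int_0^t lam(s) ds, path by path: the
   Lebesgue-Stieltjes integral, with dM = dN - lam ds.  As M has paths of
   bounded variation, this is also the value of the Ito integral when [phi] is
   predictable. *)
Definition compensated_integral (N : R -> Omega -> nat)
    (lam : R -> Omega -> R) (phi : R -> Omega -> R) (w : Omega) : R :=
  \int[counting_stieltjes (N^~ w)]_(t in `]0, T]) phi t w -
  \int[@lebesgue_measure R]_(t in `[0, T]) (phi t w * lam t w).

End processes.

(* The data of an interaction network for a fixed number n of vertices.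
   R^q is [q.-tuple R], which carries the product sigma-algebra. *)
Record network (R : realType) (q : nat) (dir : bool) {d : measure_display}
    (Omega : measurableType d) (n : nat) := Network {
  net_F : R -> set (set Omega) ;
  net_N : link dir n -> R -> Omega -> nat ;
  net_X : link dir n -> R -> Omega -> q.-tuple R ;
  net_C : link dir n -> R -> Omega -> bool ;
  net_d : R -> Omega -> link dir n -> link dir n -> \bar R }.

Section networks.
Context {R : realType} {q : nat} {dir : bool} {d : measure_display}
  {Omega : measurableType d}.
Variables (P : probability Omega R) (T : R) (lambda : R -> q.-tuple R -> R).

Definition link_function : Prop :=
  (forall t x, 0 <= t <= T -> 0 <= lambda t x) /\
  measurable_fun (`[0, T] `*` setT)
    (fun p : R * q.-tuple R => lambda p.1 p.2).

(* The values of the triples (N, X, C). *)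
Local Notation mark := (nat * q.-tuple R * bool)%type.

Section fixed_size.
Context {n : nat}.
Variable net : network R q dir Omega n.
Notation L := (link dir n).

Definition net_intensity (u : L) (t : R) (w : Omega) : R :=
  (net_C net u t w)%:R * lambda t (net_X net u t w).

Definition net_mark (u : L) (t : R) (w : Omega) : mark :=
  (net_N net u t w, net_X net u t w, net_C net u t w).

(* d_s(u, J); equal to +oo if J is empty. *)
Definition net_dist (J : {set L}) (s : R) (u : L) (w : Omega) : \bar R :=
  \big[mine/+oo%E]_(v in J) net_d net s w u v.

(* (N, X, C)_u(r) 1(d_s(u, J) >= m) *)
Definition masked_mark (m : R) (J : {set L}) (u : L) (s r : R) (w : Omega) :
    mark :=
  if (m%:E <= net_dist J s u w)%E then net_mark u r w
  else (0%N, [tuple 0 | _ < q], false).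

Definition ext_metric (rho : L -> L -> \bar R) : Prop :=
  [/\ forall u v, rho u v = 0%E <-> u = v,
      forall u v, rho u v = rho v u &
      forall u v z, (rho u z <= rho u v + rho v z)%E].

(* Cylinder sigma-algebra on the space of arrays of paths. *)
Definition cylinder : set (set (L -> R -> mark)) :=
  <<s [set A | exists u t (B : set mark),
        [/\ 0 <= t <= T, measurable B & A = [set x | B (x u t)]]] >>.

Definition exchangeable : Prop :=
  forall (s : 'S_n) A, cylinder A ->
    P [set w | A (fun u t => net_mark u t w)] =
    P [set w | A (fun u t => net_mark (link_perm s u) t w)].

Definition structured_network : Prop :=
  [/\ filtration T (net_F net),
      counting_process P T (net_F net) (net_N net),
      (forall u, predictable T (net_F net) (net_X net u)) /\
      (forall u, predictable T (net_F net) (net_C net u)),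
      forall u, intensity P T (net_F net) (net_N net u) (net_intensity u) &
      [/\ exchangeable,
          forall t w u v, 0 <= t <= T -> (0 <= net_d net t w u v)%E,
          forall t, 0 <= t <= T -> {ae P, forall w, ext_metric (net_d net t w)} &
          forall u v, predictable T (net_F net)
                        (fun t w => net_d net t w u v)]].

(* sigma(N_u(t), X_u(t), C_u(t) : u in J, t in [a, b], t <= T) *)
Definition sigma_marks (J : {set L}) (a b : R) : set (set Omega) :=
  sigma_gen [set p : L * R | [/\ p.1 \in J, a <= p.2, p.2 <= b & p.2 <= T]]
            (fun p => net_mark p.1 p.2).

(* sigma((N, X, C)_u(r) 1(d_s(u, J) >= m) :
           s in [0, a], r in [0, T], r <= s + 6 delta, u in L) *)
Definition sigma_masked (m delta : R) (J : {set L}) (a : R) :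
    set (set Omega) :=
  sigma_gen [set p : L * (R * R) | [/\ 0 <= p.2.1, p.2.1 <= a, 0 <= p.2.2,
                                       p.2.2 <= T & p.2.2 <= p.2.1 + 6 * delta]]
            (fun p => masked_mark m J p.1 p.2.1 p.2.2).

(* The requirement on delta_n in momentary-m-dependence. *)
Definition momentary_dependence (m delta : R) : Prop :=
  0 < delta /\
  forall t0 (J : {set L}), 0 <= t0 <= T ->
    cond_indep P (net_F net t0)
      (sigma_marks J t0 (t0 + 6 * delta)) (sigma_masked m delta J t0).

(* The short-sighted leave-J-out filtration. *)
Definition short_sighted (m delta : R) (I J : {set L}) (t : R) :
    set (set Omega) :=
  <<s sigma_gen [set p : L * R | [/\ p.1 \in I, 0 <= p.2 & p.2 <= t]]
                (fun p => net_X net p.1 p.2)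
      `|` sigma_masked m delta J (Num.max 0 (t - 4 * delta)) >>.

(* int_0^T phi dM_u *)
Definition net_integral (u : L) (phi : R -> Omega -> R) : Omega -> R :=
  compensated_integral T (net_N net u) (net_intensity u) phi.

End fixed_size.
End networks.

(* Main.v *)
(**
  For J = {u, v}, let G_t be generated by the events of F at time
  max(0, t - 4 delta), the marks of the links of J up to time t, and the masked
  marks entering the short-sighted filtration at time t.  Momentary
  m-dependence implies that the F-intensities of N_u and N_v are also their
  G-intensities: over a short interval ]s, t] it decouples the masked marks
  from the jumps, given F at time max(0, s - 4 delta); a monotone class argument
  and a subdivision of long intervals give all G-predictable integrands.  Since
  the short-sighted filtration is contained in G, the leave-out integrands
  phit are G-predictable, and their integrals against M_u and M_v satisfy
  E (int phit_u dM_u)^2 <= E int phit_u^2 lambda_u dt and are orthogonal for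
  u <> v, as there are no common jumps.  Writing phi = phit + (phi - phit) in
  each term of the expanded square then gives the inequality.

  The second moment estimates do not use stopping times or stochastic
  integration: a counting process is the sum of its single jumps at tau_j, with
  intensity lambda on ]tau_(j-1), tau_j].  For two single jumps, Fubini's theorem
  and a case distinction on which of them comes first give the product formula;
  bounded integrands and finitely many jumps are treated by summation, and the
  general case follows by truncation and Fatou's lemma.
*)
Require Import Defs.
From HB Require Import structures.
From mathcomp Require Import all_boot all_order all_algebra all_fingroup.
From mathcomp Require Import all_classical all_reals all_analysis.
From mathcomp Require Import measurable_realfun ring lra.
Set Implicit Arguments.
Unset Strict Implicit.
Unset Printing Implicit Defensive.
Import Order.TTheory GRing.Theory Num.Theory.
Import numFieldNormedType.Exports.
Local Open Scope classical_set_scope.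
Local Open Scope ring_scope.

(** * Jump times of a counting path *)

(** The obstacle is that the short-sighted filtration looks ahead: at time [t] it contains masked
    marks up to [t + 2 delta] at least, as far as [T] allows. Hence [phit] need not be predictable
    for [F], and the martingale property of [M] under [F] says nothing about its integral. The
    lagged time [lag t = max(0, t - 4 delta)] is the instant at which the conditional independence
    is applied. It covers a window of length [6 delta], of which the delay uses up [4 delta]; the
    remaining [2 delta] bound the length of the intervals treated in one step. The marks of [J]
    enter [G] without delay because the jumps and intensities of both links have to be observable.
    The two integrands of one product must be predictable for a common filtration, so every pair of
    links gets its own [G]. No second moment of [N(T)] or of the total intensity is assumed. A
    single jump, however, has expected total intensity at most one, and the product formula, having
    only nonnegative terms on both sides, yields the square integrability of its compensator instead
    of presupposing it. *)

Section jump_times.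
Context {R : realType}.
Variables (T : R) (f : R -> nat).

(** A jump that does not occur is sent to [T + 1], so that [jump_time j <= T] is the event that it
    occurs. Index 0 is a sentinel at time 0; the jumps proper have index [j.+1]. *)
Definition jump_time (j : nat) : R :=
  if (j <= f T)%N then inf [set t | 0 <= t <= T /\ (j <= f t)%N] else T + 1.

Hypothesis T0 : 0 < T.
Hypothesis cf : counting_path T f.

Let T00 : 0 <= T <= T. Proof. by rewrite lexx ltW. Qed.

Let f0 : f 0 = 0%N. Proof. by case: cf. Qed.

Let fle s t : 0 <= s -> s <= t -> t <= T -> (f s <= f t)%N.
Proof. by case: cf => _ + _ _; exact. Qed.

(** Right-continuity makes the infimum attained: the path is constant just after it, and the set has
    points arbitrarily close to it. *)
Lemma jump_time_le t j : 0 <= t <= T -> (jump_time j <= t) = (j <= f t)%N.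
Proof.
move=> /andP[t0 tT]; rewrite /jump_time; case: ifPn => jfT; last first.
  rewrite leNgt (le_lt_trans tT) ?ltrDl//=.
  by apply/esym; apply: contraNF jfT => /leq_trans; apply; exact: fle.
set S := [set _ | _]; have ST : S T by [].
have lS : has_lbound S by exists 0 => x [/andP[]].
apply/idP/idP => [it|jft]; last by apply: ge_inf => //; split => //; apply/andP.
have i0 : 0 <= inf S by apply: lb_le_inf; [exists T|move=> x [/andP[]]].
suff : (j <= f (inf S))%N by move=> /leq_trans; apply; exact: fle.
have [iT|Ti] := ltP (inf S) T; last first.
  by have -> : inf S = T by apply/eqP; rewrite eq_le Ti ge_inf.
have [_ _ /(_ (inf S)) rc _] := cf.
have [|e /= e0 He] := rc; first by rewrite i0.
have [s Ss sie] := inf_adherent e0 (conj (ex_intro _ T ST) lS).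
have si : inf S <= s by exact: ge_inf.
case: Ss => _; move: si; rewrite le_eqVlt => /predU1P[->//|si].
by rewrite (He s)//= ltr_distlC; apply/andP; split => //; rewrite (lt_trans _ si)// ltrBlDr ltrDl.
Qed.

Lemma jump_time_leT j : (jump_time j <= T) = (j <= f T)%N.
Proof. exact: jump_time_le. Qed.

Lemma jump_time_ge0 j : 0 <= jump_time j.
Proof.
rewrite /jump_time; case: ifPn => // jfT; last by rewrite addr_ge0// ltW.
by apply: lb_le_inf; [exists T|move=> x [/andP[]]].
Qed.

Lemma jump_time_out j : T < jump_time j -> jump_time j = T + 1.
Proof. by rewrite ltNge jump_time_leT /jump_time => /negPf ->. Qed.

Lemma jump_time0 : jump_time 0 = 0.
Proof.
apply/eqP; rewrite eq_le jump_time_ge0 andbT.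
by rewrite jump_time_le// lexx ltW.
Qed.

Lemma jump_time_homo i j : (i <= j)%N -> jump_time i <= jump_time j.
Proof.
move=> ij; have [jT|Tj] := leP (jump_time j) T.
  rewrite jump_time_le ?jump_time_ge0//; apply: (leq_trans ij).
  by rewrite -jump_time_le ?jump_time_ge0 ?lexx.
rewrite (jump_time_out Tj); have [iT|Ti] := leP (jump_time i) T.
  by rewrite (le_trans iT)// lerDl.
by rewrite (jump_time_out Ti).
Qed.

(** Jumps have size one: just before jump [i.+1] the path is already at least [i], so jump [i] has
    happened strictly earlier. *)
Lemma jump_time_lt i j : (i < j)%N -> jump_time j <= T ->
  jump_time i < jump_time j.
Proof.
wlog -> : j / j = i.+1 => [H ij jT|_].
  have /H : (i < i.+1)%N by [].
  move=> /(_ erefl) H1; apply: (lt_le_trans _ (jump_time_homo ij)).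
  by apply: H1; rewrite (le_trans _ jT)// jump_time_homo.
move=> jT; rewrite ltNge; apply/negP => ji.
have j0 := jump_time_ge0 i.+1.
have : (i.+1 <= f (jump_time i.+1))%N by rewrite -jump_time_le ?lexx ?j0.
have jpos : 0 < jump_time i.+1.
  by rewrite ltNge jump_time_le ?f0// lexx ltW.
have [_ _ _ /(_ (jump_time i.+1)) H] := cf.
have [|e /= e0 He] := H; first by rewrite jpos.
(* A time before the jump and within the radius [e], cut off at 0 so as to stay in [[0, T]]. *)
pose s := Num.max (jump_time i.+1 - e / 2) 0.
have sj : s < jump_time i.+1.
  by rewrite /s gt_max jpos andbT ltrBlDr ltrDl divr_gt0.
have s0 : 0 <= s by rewrite /s le_max lexx orbT.
have := He s; rewrite sj => /(_ _ isT) H1.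
move=> /leq_trans; have /H1 H2 : ball_ (fun x => `|x|) (jump_time i.+1) e s.
  rewrite /= ger0_norm ?subr_ge0 ?(ltW sj)// ltrBlDl -ltrBlDr /s lt_max.
  by rewrite ltrD2l ltrN2 ltr_pdivrMr// ltr_pMr// ltr1n.
move=> /(_ _ H2); rewrite ltnS -jump_time_le; last first.
  by rewrite s0 (le_trans (ltW sj)).
by move=> /(le_trans ji)/le_lt_trans/(_ sj); rewrite ltxx.
Qed.

Let c t := Num.max 0 (Num.min t T).

Let F t : R := (f (c t))%:R.

Let clip t : 0 <= c t <= T.
Proof. by rewrite /c le_max lexx/= ge_max ltW//= ge_min lexx orbT. Qed.

Let F_nd : {homo F : x y / x <= y}.
Proof.
move=> x y xy; rewrite /F ler_nat.
have /andP[c1 _] := clip x; have /andP[_ c2] := clip y.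
by apply: fle => //; apply: le_max2 => //; apply: le_min2.
Qed.

Let F_rc : right_continuous F.
Proof.
move=> t; have [tT|Tt] := ltP t T; last first.
  apply: cvg_near_cst; near=> s.
  by rewrite /F /c !min_r// ltW// (le_lt_trans Tt).
have [t0|t0] := ltP t 0.
  apply: cvg_near_cst; near=> s.
  have s0 : s <= 0 by near: s; exact: nbhs_right_le.
  by rewrite /F /c !max_l// ge_min ?s0// ltW.
apply: cvg_near_cst.
have [_ _ /(_ t) rc _] := cf.
have := rc; rewrite t0 tT => /(_ isT) {}rc.
near=> s; rewrite /F /c; congr (_ %:R).
rewrite !min_l ?(ltW tT)//; last by rewrite ltW.
rewrite !max_r//.
  by near: s.
by rewrite (le_trans t0).
Unshelve. all: end_near. Qed.

(** The clipped path [F] is nondecreasing and right-continuous, so [stieltjes_measure] is not in its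
    zero branch. On []a, b]] both sides count the jumps in that interval, and a Lebesgue-Stieltjes
    measure is determined by such intervals. *)
Lemma counting_stieltjesE (A : set (measurableTypeR R)) : measurable A ->
  counting_stieltjes T f A = (\sum_(j < f T) \d_(jump_time j.+1) A)%E.
Proof.
move=> mA; rewrite /counting_stieltjes /stieltjes_measure.
case: pselect => [h|[]]; last first.
  pose H := isCumulative.Build R _ R F F_nd F_rc.
  by exists (HB.pack_for (cumulative R R) F H).
case: cid => G /= GF.
pose mu : {measure set (measurableTypeR R) -> \bar R} :=
  msum (fun j => \d_(jump_time j.+1 : measurableTypeR R)) (f T).
apply: (@lebesgue_stieltjes_measure_unique _ G mu) => // _ [[a b] _ <-] /=.
rewrite /lebesgue_stieltjes_measure/= /measure_extension measurable_mu_extE//=; last first.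
  exact: is_ocitv.
have [ab|ba] := ltP a b; last first.
  by rewrite set_itv_ge ?bnd_simp -?leNgt// !measure0.
rewrite wlength_itv_bnd ?ltW// GF /msum/=.
have le_clip k t : (k < f T)%N ->
    (jump_time k.+1 <= t) = (k < f (c t))%N.
  move=> kT; rewrite -jump_time_le ?clip//.
  have jT : jump_time k.+1 <= T by rewrite jump_time_leT.
  have j0 : 0 < jump_time k.+1.
    rewrite -jump_time0; exact: jump_time_lt.
  by rewrite /c le_max leNgt j0/= le_min jT andbT.
have sum_lt m : (m <= f T)%N -> \sum_(k < f T) ((k < m)%N%:R : R) = m%:R.
  move=> mT; transitivity (\sum_(k < m) (1 : R)); last first.
    by rewrite sumr_const card_ord.
  rewrite (big_ord_widen (f T) (fun=> 1) mT) [RHS]big_mkcond.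
  by apply: eq_bigr => k _; case: ifP.
have fc t : (f (c t) <= f T)%N.
  by have /andP[? ?] := clip t; exact: fle.
rewrite -(sum_lt _ (fc b)) -(sum_lt _ (fc a)) -sumrB -sumEFin.
apply: eq_bigr => k _; rewrite diracE -!le_clip//; congr (_%:E).
rewrite mem_setE in_itv/= ltNge.
case: (leP _ a) => [ja|_] /=; last by rewrite subr0.
by rewrite (le_trans ja (ltW ab)) subrr.
Qed.

Lemma jump_time_itv j : (j < f T)%N -> `]0, T]%classic (jump_time j.+1).
Proof.
move=> jT; rewrite /= in_itv/= jump_time_leT jT andbT.
by rewrite -[ltLHS]jump_time0 jump_time_lt// jump_time_leT.
Qed.

Lemma ge0_integral_counting (h : measurableTypeR R -> \bar R) :
  measurable_fun `]0, T] h -> (forall t, `]0, T]%classic t -> (0 <= h t)%E) ->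
  (\int[counting_stieltjes T f]_(t in `]0%R, T]) h t =
   \sum_(j < f T) h (jump_time j.+1))%E.
Proof.
move=> mh h0.
pose mu : {measure set (measurableTypeR R) -> \bar R} :=
  msum (fun j => \d_(jump_time j.+1 : measurableTypeR R)) (f T).
rewrite (eq_measure_integral mu); last first.
  by move=> A mA _; rewrite counting_stieltjesE.
rewrite ge0_integral_measure_sum//.
apply: eq_bigr => j _; rewrite integral_dirac//.
by rewrite diracE (mem_set (jump_time_itv (ltn_ord j))) mul1e.
Qed.

Lemma integral_counting (h : measurableTypeR R -> R) :
  measurable_fun `]0, T] h ->
  (\int[counting_stieltjes T f]_(t in `]0%R, T]) (h t)%:E =
   (\sum_(j < f T) h (jump_time j.+1))%:E)%E.
Proof.
move=> mh; have mEh : measurable_fun `]0, T] (EFin \o h).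
  exact/measurable_EFinP.
rewrite integralE !ge0_integral_counting//; last 2 first.
- exact: measurable_funeneg.
- exact: measurable_funepos.
rewrite funerpos funerneg !sumEFin -EFinB -sumrB.
by congr EFin; apply: eq_bigr => j _; rewrite -{3}(funrposBneg h).
Qed.

End jump_times.

(** * Predictable sigma-algebras *)

Section predictable_type.
Context {R : realType} {d : measure_display} {Omega : measurableType d}.
Variables (T : R) (G : R -> set (set Omega)).

(** The rectangles generate here a sigma-algebra on all of [R * Omega], not on [[0, T] * Omega] as
    in [predictable]. Predictability thereby becomes ordinary measurability for a second measurable
    structure; [predictableP] is the translation. *)
Definition ptype := g_sigma_algebraType (predictable_rectangle T G).

Hypothesis T0 : 0 < T.
Hypothesis hG : filtration T G.

Let Gsa t : 0 <= t <= T -> sigma_algebra setT (G t).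
Proof. by case: hG => + _ _; exact. Qed.

Lemma filtrationT t : 0 <= t <= T -> G t setT.
Proof. by move=> /Gsa[g0 gC _]; rewrite -(setD0 setT); exact: gC. Qed.

Lemma filtrationC t A : 0 <= t <= T -> G t A -> G t (~` A).
Proof. by move=> /Gsa[_ gC _]; rewrite -setTD; exact: gC. Qed.

Lemma measurable_adaptedE t : 0 <= t <= T ->
  @measurable _ (g_sigma_algebraType (G t)) = G t.
Proof. by move=> /Gsa/measurable_g_measurableTypeE. Qed.

Lemma filtrationI t A B : 0 <= t <= T -> G t A -> G t B -> G t (A `&` B).
Proof.
move=> tT; rewrite -(measurable_adaptedE tT); exact: measurableI.
Qed.

Let mG t A : 0 <= t <= T -> G t A -> measurable A.
Proof. by case: hG => _ + _ tT; exact. Qed.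

Lemma measurable_rect s t A : 0 <= s -> t <= T -> G s A ->
  measurable (`]s, t] `*` A : set ptype).
Proof.
move=> s0 tT sA; have [st|ts] := ltP s t.
  by apply: sub_sigma_algebra; right; exists s, t, A.
by rewrite set_itv_ge ?bnd_simp -?leNgt// set0X; exact: measurable0.
Qed.

Lemma measurable_dom : measurable (`[0, T] `*` setT : set ptype).
Proof.
have -> : `[0, T] `*` setT = [set 0] `*` setT `|` `]0, T] `*` setT
    :> set (R * Omega).
  apply/seteqP; split => [[t w] [/=]|[t w] [] [/=]]; rewrite ?in_itv/=.
  - move=> /andP[]; rewrite le_eqVlt => /predU1P[<-|t0 tT] _; first by left.
    by right; split => //=; rewrite ?in_itv/= t0.
  - by move=> -> _; split => //=; rewrite ?in_itv/= lexx ltW.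
  - by move=> /andP[t0 tT] _; split => //=; rewrite ?in_itv/= tT ltW.
apply: measurableU.
  apply: sub_sigma_algebra; left; exists setT => //.
  by apply: filtrationT; rewrite lexx ltW.
by apply: measurable_rect => //; apply: filtrationT; rewrite lexx ltW.
Qed.

Lemma predictable_rectangle_sub :
  predictable_rectangle T G `<=` [set A | A `<=` `[0, T] `*` setT].
Proof.
move=> _ [[B _ ->]|[s [t [B [s0 st tT _ ->]]]]] [r w] [/= + _].
  by move=> ->; split => //=; rewrite ?in_itv/= lexx ltW.
rewrite ?in_itv/= => /andP[sr rt]; split => //=.
by rewrite ?in_itv/= (ltW (le_lt_trans s0 sr)) (le_trans rt).
Qed.

(** All generators lie in [[0, T] * Omega]. Hence the measurable subsets of this domain form a
    sigma-algebra on it that contains the generators, and conversely the sets whose trace on the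
    domain is predictable form a sigma-algebra on the whole space. *)
Lemma predictableP {d'} {S : measurableType d'} (Y : R -> Omega -> S) :
  predictable T G Y <->
  measurable_fun (`[0, T] `*` setT : set ptype) (fun p => Y p.1 p.2).
Proof.
split => [pY _ B mB|mY B mB].
  move: (pY B mB); set A := (X in <<s _, _>> X -> _) => AA.
  have : sigma_algebra (`[0, T] `*` setT)
      (@measurable _ ptype `&` [set A | A `<=` `[0, T] `*` setT]).
    split.
    - by split => //; exact: measurable0.
    - move=> C [mC CD]; split; last by move=> x [].
      by apply: measurableD => //; exact: measurable_dom.
    - move=> C mC; split; last by apply: bigcup_sub => i _; exact: (mC i).2.
      by apply: bigcupT_measurable => i; exact: (mC i).1.
  move=> /smallest_sub/(_ _ A AA) H; apply: (proj1 (H _)) => C rC.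
  by split; [exact: sub_sigma_algebra|exact: predictable_rectangle_sub].
have {mY} := mY measurable_dom B mB.
set A := (X in measurable X) => mA.
have AD : A = `[0, T] `*` setT `&` A by rewrite setIA setIid.
rewrite /= -[X in <<s _, _>> X]/A AD.
have : sigma_algebra setT
   [set C : set (R * Omega) | <<s `[0, T] `*` setT, predictable_rectangle T G >>
      (`[0, T] `*` setT `&` C)].
  split => /=.
  - by rewrite setI0; exact: sigma_algebra0.
  - move=> C mC; rewrite setTD -setDE.
    rewrite (_ : _ `\` _ = (`[0, T] `*` setT) `\` ((`[0, T] `*` setT) `&` C)).
      exact: sigma_algebraCD.
    by rewrite setDIr setDv set0U.
  - by move=> C mC; rewrite setI_bigcupr; exact: sigma_algebra_bigcup.
move=> /smallest_sub H; apply: (H (predictable_rectangle T G) _ A mA) => C rC /=.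
by rewrite setIidr; [exact: sub_sigma_algebra|exact: predictable_rectangle_sub].
Qed.

Lemma predictable_rectangleI (A B : set (R * Omega)) :
  predictable_rectangle T G A -> predictable_rectangle T G B ->
  predictable_rectangle T G (A `&` B).
Proof.
have T00 : 0 <= (0 : R) <= T by rewrite lexx ltW.
have empty (X : set (R * Omega)) : X `<=` set0 -> predictable_rectangle T G X.
  move=> X0; left; exists set0; last by rewrite setX0; apply/seteqP; split.
  by case: hG => + _ _ => /(_ 0 T00)[].
move=> [[A' FA ->]|[s [t [A' [s0 st tT FA ->]]]]] [[B' FB ->]|[s' [t' [B' [s0' st' tT' FB ->]]]]].
- left; exists (A' `&` B'); first exact: (filtrationI T00 FA FB).
  by rewrite -setXI setIid.
- apply: empty => -[r w] [[/= -> _] [/=]]; rewrite in_itv/= => /andP[s'0'] _.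
  by move: s'0'; rewrite ltNge s0'.
- apply: empty => -[r w] [[/= + _] [/= r0 _]]; rewrite r0 in_itv/= => /andP[s00] _.
  by move: s00; rewrite ltNge s0.
- have [ts|st2] := leP (Num.min t t') (Num.max s s').
    apply: empty => -[r w] [[/= + _] [/= + _]]; rewrite !in_itv/= => /andP[sr rt] /andP[sr' rt'].
    have : r <= Num.min t t' by rewrite le_min rt.
    by move=> /le_trans/(_ ts); rewrite leNgt gt_max sr sr'.
  right; exists (Num.max s s'), (Num.min t t'), (A' `&` B'); split => //.
  + by rewrite le_max s0.
  + by rewrite ge_min tT.
  + have M0 : 0 <= Num.max s s' <= T.
      by rewrite le_max s0/= ge_max (le_trans (ltW st) tT) (le_trans (ltW st') tT').
    have [_ _ Gh] := hG.
    apply: (filtrationI M0); [apply: (Gh s) FA|apply: (Gh s') FB] => //.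
    * by rewrite le_max lexx.
    * by case/andP: M0.
    * by rewrite le_max lexx orbT.
    * by case/andP: M0.
  + rewrite -setXI; congr (_ `*` _); apply/seteqP; split => r /=; rewrite !in_itv/= gt_max le_min.
      by move=> [/andP[-> ->] /andP[-> ->]].
    by move=> /andP[/andP[-> ->] /andP[-> ->]].
Qed.

Lemma ptype_measurable (A : set (R * Omega)) :
  measurable (A : set ptype) -> measurable A.
Proof.
apply: smallest_sub; first exact: sigma_algebra_measurable.
move=> _ [[B FB ->]|[s [t [B [s0 st tT FB ->]]]]].
  apply: measurableX => //; apply: mG FB.
  by rewrite lexx ltW.
apply: measurableX => //; apply: mG FB.
by rewrite s0 ltW// (lt_le_trans st).
Qed.

Lemma ptype_measurable_fun {d'} {S : measurableType d'} (D : set (R * Omega))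
    (H : R * Omega -> S) :
  measurable (D : set ptype) -> measurable_fun (D : set ptype) H ->
  measurable_fun D H.
Proof. by move=> mD mH _ B mB; apply: ptype_measurable; exact: mH. Qed.

(** The section at [r] of []s, t] * B] is empty or [B]; in the second case [s < r], so that [B] lies
    in [G s] and therefore in [G r]. *)
Lemma measurable_ptype_section r : 0 <= r <= T ->
  @measurable_fun _ _ (g_sigma_algebraType (G r)) ptype setT (pair r).
Proof.
move=> rT; apply: (@measurability _ _ (g_sigma_algebraType (G r)) ptype setT
  (pair r) (predictable_rectangle T G)) => //.
move=> _ [_ [[B FB ->]|[s [t [B [s0 st tT FB ->]]]]] <-]; rewrite setTI.
  have [->|/eqP r0] := eqVneq r 0.
    rewrite [X in measurable X](_ : _ = B); last first.
      by apply/seteqP; split => w //= [].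
    exact: sub_sigma_algebra.
  rewrite [X in measurable X](_ : _ = set0)//.
  by apply/seteqP; split => w //= [].
have [rst|rst] := boolP (s < r <= t); last first.
  rewrite [X in measurable X](_ : _ = set0)//.
  by apply/seteqP; split => w //= []; rewrite ?in_itv/= (negPf rst).
rewrite [X in measurable X](_ : _ = B); last first.
  by apply/seteqP; split => [w []//|w Bw]; split => //=; rewrite ?in_itv/=.
apply: sub_sigma_algebra; case: hG => _ _ /(_ s r); apply => //.
  by case/andP: rst => /ltW.
by case/andP: rT.
Qed.

(** What is known at time [r] may be used as a predictable integrand strictly after [r]. *)
Lemma measurable_adapted_ptype {d'} {S : measurableType d'} r (Y : Omega -> S) :
  0 <= r <= T ->
  @measurable_fun _ _ (g_sigma_algebraType (G r)) S setT Y ->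
  measurable_fun (`]r, T] `*` setT : set ptype) (fun p => Y p.2).
Proof.
move=> rT mY _ B mB.
rewrite [X in measurable X](_ : _ = `]r, T] `*` (Y @^-1` B)); last first.
  by apply/seteqP; split => p //= [] // [].
case/andP: (rT) => r0 _.
apply: measurable_rect => //.
by rewrite -(measurable_adaptedE rT) -[_ @^-1` _]setTI; exact: mY.
Qed.

End predictable_type.

(** * Jump times of an adapted counting process and predictable sets *)

Section jump_times_of_process.
Context {R : realType} {d : measure_display} {Omega : measurableType d}.
Variables (T : R) (N : R -> Omega -> nat).

Definition jump_of (j : nat) (w : Omega) : R := jump_time T (N^~ w) j.

Hypothesis T0 : 0 < T.
Hypothesis cN : forall w, counting_path T (N^~ w).

Let T00 : 0 <= T <= T. Proof. by rewrite lexx ltW. Qed.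

Lemma jump_of_le t j w : 0 <= t <= T -> (jump_of j w <= t) = (j <= N t w)%N.
Proof. exact: jump_time_le. Qed.

Lemma jump_of_leT j w : (jump_of j w <= T) = (j <= N T w)%N.
Proof. exact: jump_time_leT. Qed.

Lemma jump_of_ge0 j w : 0 <= jump_of j w.
Proof. exact: jump_time_ge0. Qed.

Lemma jump_of_gt0 j w : 0 < jump_of j.+1 w.
Proof.
have [jT|Tj] := leP (jump_of j.+1 w) T; last exact: lt_trans Tj.
rewrite -[ltLHS](jump_time0 T0 (cN w)); exact: jump_time_lt.
Qed.

Variable G : R -> set (set Omega).
Hypothesis hG : filtration T G.
Hypothesis aN : forall t k, 0 <= t <= T -> G t [set w | N t w = k].

Lemma adapted_jump_le t j : 0 <= t <= T -> G t [set w | jump_of j w <= t].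
Proof.
move=> tT; rewrite -(measurable_adaptedE hG tT).
rewrite [X in measurable X](_ : _ =
  ~` \big[setU/set0]_(k < j) [set w | N t w = k]).
  apply: measurableC; apply: bigsetU_measurable => k _.
  by rewrite (measurable_adaptedE hG tT); exact: aN.
rewrite -(bigcup_mkord j (fun k => [set w | N t w = k])); apply/seteqP; split => w /=.
  by rewrite jump_of_le// => jN [k /= kj NK]; move: kj; rewrite -NK ltnNge jN.
rewrite jump_of_le// leqNgt => nN; apply/negP => Nj; apply: nN.
by exists (N t w).
Qed.

Lemma measurable_jump_of j : measurable_fun setT (jump_of j).
Proof.
have mle t : 0 <= t <= T -> measurable [set w | jump_of j w <= t].
  by move=> tT; case: hG => _ + _; apply; [exact: tT|exact: adapted_jump_le].
apply: (measurability (@RGenOInfty.G R)); first exact: RGenOInfty.measurableE.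
move=> _ [_ [x ->] <-]; rewrite setTI.
rewrite [X in measurable X](_ : _ = ~` [set w | jump_of j w <= x]); last first.
  apply/seteqP; split => w /=; rewrite in_itv/= andbT ltNge; first exact/negP.
  by move/negP.
apply: measurableC.
have [x0|x0] := ltP x 0.
  rewrite [X in measurable X](_ : _ = set0)//; apply/seteqP; split => // w /=.
  by rewrite leNgt (lt_le_trans x0)// jump_of_ge0.
have [xT|Tx] := leP x T; first by apply: mle; rewrite x0.
have [T1x|xT1] := leP (T + 1) x.
  rewrite [X in measurable X](_ : _ = setT)//; apply/seteqP; split => // w _ /=.
  apply: le_trans T1x; have [jT|] := leP (jump_of j w) T.
    by rewrite (le_trans jT)// lerDl.
  by move/(jump_time_out T0 (cN w)) => jE; rewrite /jump_of jE.
rewrite [X in measurable X](_ : _ = [set w | jump_of j w <= T]); first exact: mle.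
apply/seteqP; split => w /=; last by move=> /le_trans; apply; exact: ltW.
move=> jx; rewrite leNgt; apply/negP => /[dup] Tj.
move/(jump_time_out T0 (cN w)) => jE; move: jx.
by rewrite /jump_of jE leNgt xT1.
Qed.

(** A rational time between the jump and [p.1] writes the set as a countable union of predictable
    rectangles. *)
Lemma measurable_after_jump j :
  measurable ([set p | p.1 <= T /\ jump_of j p.2 < p.1] : set (ptype T G)).
Proof.
rewrite [X in measurable X](_ : _ = \bigcup_(q : rat)
  (if (0 <= (ratr q : R) <= T) then `]ratr q, T] `*` [set w | jump_of j w <= ratr q] else set0)).
  apply: bigcupT_measurable_rat => q; case: ifPn => // /[dup] qT /andP[q0 _].
  by apply: measurable_rect => //; exact: adapted_jump_le.
apply/seteqP; split => [[r w] /= [rT jr]|[r w] [q _]]; last first.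
  case: ifPn => // qT [] /=; rewrite in_itv/= => /andP[qr rT] jq.
  by split => //; exact: le_lt_trans qr.
have [q] := rat_in_itvoo jr.
rewrite in_itv/= => /andP[jq qr]; exists q => //.
have -> : 0 <= (ratr q : R) <= T.
  by rewrite (le_trans (jump_of_ge0 j w) (ltW jq)) (le_trans (ltW qr) rT).
by split => /=; [rewrite ?in_itv/= qr|exact: ltW].
Qed.

Lemma measurable_upto_jump j :
  measurable ([set p | 0 <= p.1 <= T /\ p.1 <= jump_of j p.2] : set (ptype T G)).
Proof.
rewrite [X in measurable X](_ : _ = (`[0, T] `*` setT) `\`
   [set p | p.1 <= T /\ jump_of j p.2 < p.1]).
  apply: measurableD; first exact: measurable_dom.
  exact: measurable_after_jump.
apply/seteqP; split => [[r w] /= [rT rj]|[r w] [[/= + _] H]].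
  by split; [split => //=; rewrite in_itv|case=> _; rewrite ltNge rj].
rewrite in_itv/= => /[dup] rT /andP[_ rT']; split => //.
by rewrite leNgt; apply/negP => jr; apply: H.
Qed.

(** The value of a predictable process at a jump time is known after the jump. The preimage of []s,
    t] * B] requires [tau > s] and [B], both known at [s], and [tau <= t], which is automatic while
    [r <= t] and known at [t] afterwards. With [j.+1] the jump time is positive, so the generators
    at time 0 have empty preimage. *)
Lemma measurable_at_jump j :
  @measurable_fun _ _ (ptype T G) (ptype T G)
    [set p | p.1 <= T /\ jump_of j.+1 p.2 < p.1]
    (fun p => (jump_of j.+1 p.2, p.2)).
Proof.
apply: (@measurability _ _ (ptype T G) (ptype T G) _ _ (predictable_rectangle T G)) => //.
move=> _ [_ [[B FB ->]|[s [t [B [s0 st tT FB ->]]]]] <-].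
  rewrite [X in measurable X](_ : _ = set0)//.
  apply/seteqP; split => // -[r w] /= [_ [/= j0 _]].
  by have := jump_of_gt0 j w; rewrite j0 ltxx.
set E := [set p | _].
have sT : 0 <= s <= T by rewrite s0/= ltW// (lt_le_trans st).
have tT' : 0 <= t <= T by rewrite tT ltW// (le_lt_trans s0).
rewrite [X in measurable X](_ : _ =
  E `&` (`]s, T] `*` (B `&` ~` [set w | jump_of j.+1 w <= s])) `&`
  ((`]0, t] `*` setT) `|` (`]t, T] `*` [set w | jump_of j.+1 w <= t]))); last first.
  apply/seteqP; split => [[r w] /= [[rT jr]]|[r w] /= [[[rT jr]]]].
    rewrite ?in_itv/= => -[/andP[sj jt] Bw].
    have sr : s < r by exact: lt_trans jr.
    do ! split => //=; rewrite ?in_itv/= ?sr//.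
      by apply/negP; rewrite -ltNge.
    have [rt|tr] := leP r t; [left|right]; split => //=; rewrite ?in_itv/= ?rt ?tr ?rT//.
    by rewrite andbT (lt_trans _ jr)// jump_of_gt0.
  rewrite ?in_itv/= => -[/andP[sr _] [Bw /negP sj]] tj.
  split => //; split => //=; rewrite ?in_itv/= ltNge sj/=.
  case: tj => [[/= + _]|[//]]; rewrite ?in_itv/= => /andP[_]; apply: le_trans.
  exact: ltW.
apply: measurableI; first apply: measurableI.
- exact: measurable_after_jump.
- apply: measurable_rect => //; apply: (filtrationI hG sT) => //.
  by apply: (filtrationC hG sT); exact: adapted_jump_le.
- apply: measurableU; apply: measurable_rect => //.
    by apply: (filtrationT hG); rewrite lexx ltW.
  by case/andP: tT'.
  exact: adapted_jump_le.
Qed.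

End jump_times_of_process.

(** * Processes with a single jump *)

Section one_jump.
Local Open Scope ereal_scope.
Context {R : realType} {d : measure_display} {Omega : measurableType d}.
Variables (P : probability Omega R) (T : R) (G : R -> set (set Omega)).
Hypothesis T0 : (0 < T)%R.
Hypothesis hG : filtration T G.

Local Notation mu := (@lebesgue_measure R).
Local Notation pt := (ptype T G).

(* [tau > T] means that no jump occurs; [l] is the intensity of the jump. *)
Record one_jump (tau : Omega -> R) (l : R * Omega -> R) : Prop := OneJump {
  oj_mtau : measurable_fun setT tau ;
  oj_after : measurable ([set p | (p.1 <= T)%R /\ (tau p.2 < p.1)%R] : set pt) ;
  oj_at : @measurable_fun _ _ pt pt
    [set p | (p.1 <= T)%R /\ (tau p.2 < p.1)%R] (fun p => (tau p.2, p.2)) ;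
  oj_ml : measurable_fun setT l ;
  oj_l0 : forall p, (0 <= l p)%R ;
  oj_lout : forall p, ~ (0 <= p.1 <= T)%R -> l p = 0%R ;
  oj_lad : forall r, (0 <= r <= T)%R ->
    @measurable_fun _ _ (g_sigma_algebraType (G r)) _ setT (fun w => l (r, w)) ;
  oj_comp : forall H : R * Omega -> \bar R,
    @measurable_fun _ _ pt _ setT H -> (forall p, 0 <= H p) ->
    \int[P]_w (if (tau w <= T)%R then H (tau w, w) else 0) =
    \int[P]_w \int[mu]_t (H (t, w) * (l (t, w))%:E) }.

Definition at_jump (tau : Omega -> R) (H : R * Omega -> \bar R) w :=
  if (tau w <= T)%R then H (tau w, w) else 0.

Definition time_int (l : R * Omega -> R) (H : R * Omega -> \bar R) w :=
  \int[mu]_t (H (t, w) * (l (t, w))%:E).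

(** The omitted point [r] is Lebesgue-null. *)
Lemma integral_split (r : R) (g : measurableTypeR R -> \bar R) :
  measurable_fun setT g -> (forall s, 0 <= g s) ->
  \int[mu]_s g s = \int[mu]_s (if (r < s)%R then g s else 0) +
                   \int[mu]_s (if (s < r)%R then g s else 0).
Proof.
move=> mg g0; rewrite -ge0_integralD//; first last.
- by apply: measurable_fun_ifT => //; exact: measurable_fun_ltr.
- by move=> s _; case: ifP.
- by apply: measurable_fun_ifT => //; exact: measurable_fun_ltr.
- by move=> s _; case: ifP.
apply: ge0_ae_eq_integral => //.
- apply: emeasurable_funD.
    by apply: measurable_fun_ifT => //; exact: measurable_fun_ltr.
  by apply: measurable_fun_ifT => //; exact: measurable_fun_ltr.
- by move=> s _; apply: adde_ge0; case: ifP.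
exists [set r]; split => //; first exact: lebesgue_measure_set1.
move=> s /= sr; apply: contrapT => nsr; apply: sr => _.
case: ltgtP => [||E]; rewrite ?adde0 ?add0e//.
by case: nsr.
Qed.

(** The square is cut along its diagonal, and Tonelli's theorem arranges each triangle so that the
    outer variable is the earlier time. This is the shape in which [at_jump_gt] produces double
    integrals. *)
Lemma mule_integral_split (f g : measurableTypeR R -> \bar R) :
  measurable_fun setT f -> measurable_fun setT g ->
  (forall s, 0 <= f s) -> (forall s, 0 <= g s) ->
  \int[mu]_r f r * \int[mu]_s g s =
  \int[mu]_r \int[mu]_s (if (r < s)%R then f r * g s else 0) +
  \int[mu]_s \int[mu]_r (if (s < r)%R then g s * f r else 0).
Proof.
move=> mf mg f0 g0.
have mF (h k : measurableTypeR R -> \bar R) : measurable_fun setT h -> measurable_fun setT k ->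
    measurable_fun setT (fun p : measurableTypeR R * measurableTypeR R =>
      if (p.1 < p.2)%R then h p.1 * k p.2 else 0).
  move=> mh mk; apply: measurable_fun_ifT => //; first exact: measurable_fun_ltr.
  by apply: emeasurable_funM; exact: measurableT_comp.
have F0 (h k : measurableTypeR R -> \bar R) : (forall s, 0 <= h s) -> (forall s, 0 <= k s) ->
    forall p : R * R, 0 <= (if (p.1 < p.2)%R then h p.1 * k p.2 else 0).
  by move=> h0 k0 p; case: ifP => // _; exact: mule_ge0.
have /= -> := @fubini_tonelli _ _ _ _ _ mu mu
  (fun p : measurableTypeR R * measurableTypeR R =>
     if (p.1 < p.2)%R then g p.1 * f p.2 else 0) (mF _ _ mg mf) (F0 _ _ g0 f0).
rewrite -ge0_integralZr//; last exact: integral_ge0.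
rewrite -ge0_integralD//; first last.
- exact: (@measurable_fun_fubini_tonelli_G _ _ _ _ _ mu _ (mF _ _ mg mf) (F0 _ _ g0 f0)).
- by move=> r _; apply: integral_ge0 => s _; exact: (F0 _ _ g0 f0 (s, r)).
- exact: (@measurable_fun_fubini_tonelli_F _ _ _ _ _ mu _ (mF _ _ mf mg) (F0 _ _ f0 g0)).
- by move=> r _; apply: integral_ge0 => s _; exact: (F0 _ _ f0 g0 (r, s)).
apply: eq_integral => r _; rewrite -ge0_integralZl//.
rewrite (integral_split r)//; last 2 first.
- exact: emeasurable_funM.
- by move=> s; exact: mule_ge0.
by congr (_ + _); apply: eq_integral => s _; rewrite muleC.
Qed.

Section two_jumps.
Variables (tau sig : Omega -> R) (l m : R * Omega -> R).
Hypotheses (Jt : one_jump tau l) (Js : one_jump sig m).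
Variables H1 H2 : R * Omega -> \bar R.
Hypotheses (mH1 : @measurable_fun _ _ pt _ setT H1)
  (mH2 : @measurable_fun _ _ pt _ setT H2).
Hypotheses (H10 : forall p, 0 <= H1 p) (H20 : forall p, 0 <= H2 p).

Let mprod : measurable_fun setT (fun p : measurableTypeR R * Omega => H2 p * (m p)%:E).
Proof.
apply: emeasurable_funM.
  apply: (@ptype_measurable_fun _ _ _ T G T0 hG) => //; exact: mH2.
apply/measurable_EFinP.
exact (oj_ml Js).
Qed.

Lemma measurable_after (r0 : R) w : measurable_fun setT
  (fun r : measurableTypeR R => if (r0 < r)%R then H2 (r, w) * (m (r, w))%:E else 0).
Proof.
apply: measurable_fun_ifT => //.
  exact: measurable_fun_ltr.
exact: (measurable_fun_pair1 w mprod).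
Qed.

(** After [tau], the value of [H1] at [tau] is predictable ([oj_at]). The compensation formula for
    [sig] therefore applies to the integrand [A * H2], where [A] carries this value and vanishes up
    to [tau]. *)
Lemma at_jump_lt :
  \int[P]_w (if (tau w < sig w)%R then at_jump tau H1 w * at_jump sig H2 w else 0) =
  \int[P]_w (at_jump tau H1 w * \int[mu]_r (if (tau w < r)%R then H2 (r, w) * (m (r, w))%:E else 0)).
Proof.
pose E := [set p : R * Omega | (p.1 <= T)%R /\ (tau p.2 < p.1)%R].
pose A := (fun p : R * Omega => H1 (tau p.2, p.2)) \_ E.
have mA : @measurable_fun _ _ pt _ setT A.
  apply: (@measurable_restrictT _ _ pt _ E (fun p => H1 (tau p.2, p.2)) (oj_after Jt)).1.
  apply: (@measurable_comp _ _ _ pt pt _ setT H1 E) => //.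
  exact: oj_at Jt.
have A0 p : 0 <= A p by rewrite /A patchE; case: ifP.
have := oj_comp Js (emeasurable_funM mA mH2).
rewrite (_ : (fun w => _) = (fun w =>
    if (tau w < sig w)%R then at_jump tau H1 w * at_jump sig H2 w else 0)); last first.
  apply/funext => w; rewrite /at_jump /A patchE.
  have [sT|Ts] := leP (sig w) T; last by rewrite mule0 if_same.
  have [ts|st] := ltP (tau w) (sig w).
    by rewrite mem_set ?(ltW (lt_le_trans ts sT)).
  by rewrite memNset ?mul0e// => -[_]; rewrite ltNge st.
move=> ->; last by move=> p; exact: mule_ge0.
apply: eq_integral => w _; rewrite -ge0_integralZl//; last 3 first.
- exact: measurable_after.
- by move=> r _; case: ifP => // _; rewrite mule_ge0// lee_fin; exact: oj_l0 Js _.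
- by rewrite /at_jump; case: ifP.
apply: eq_integral => t _; rewrite /A patchE /at_jump.
have [tT|Tt] := leP t T; last first.
  rewrite (oj_lout Js) ?mule0 ?if_same ?mule0//= => /andP[_].
  by rewrite leNgt Tt.
have [tt|tt] := ltP (tau w) t.
  by rewrite mem_set// (ltW (lt_le_trans tt tT)) muleA.
by rewrite memNset ?mul0e ?mule0// => -[_ /=]; rewrite ltNge tt.
Qed.

Let mprod1 : measurable_fun setT (fun p : measurableTypeR R * Omega => H1 p * (l p)%:E).
Proof.
apply: emeasurable_funM.
  apply: (@ptype_measurable_fun _ _ _ T G T0 hG) => //; exact: mH1.
apply/measurable_EFinP.
exact (oj_ml Jt).
Qed.

Lemma measurable_at_jump_val : measurable_fun setT (at_jump tau H1).
Proof.
apply: measurable_fun_ifT => //.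
  by apply: measurable_fun_ler => //; exact: oj_mtau Jt.
have mH : @measurable_fun _ _ (R * Omega)%type _ setT H1.
  by apply: (@ptype_measurable_fun _ _ _ T G T0 hG); first exact: measurableT.
apply: (measurableT_comp mH); apply: measurable_fun_pair => //.
exact: oj_mtau Jt.
Qed.

Let m0 r w : 0 <= H2 (r, w) * (m (r, w))%:E.
Proof. by rewrite mule_ge0// lee_fin; exact: oj_l0 Js _. Qed.

Let l0 r w : 0 <= H1 (r, w) * (l (r, w))%:E.
Proof. by rewrite mule_ge0// lee_fin; exact: oj_l0 Jt _. Qed.

Let msw : measurable_fun setT (fun p : Omega * measurableTypeR R => (p.2, p.1)).
Proof. exact: measurable_fun_pair. Qed.

Let F (q : Omega * measurableTypeR R * measurableTypeR R) :=
  if (q.1.2 < q.2)%R then H2 (q.1.2, q.1.1) * (m (q.1.2, q.1.1))%:E *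
    (H1 (q.2, q.1.1) * (l (q.2, q.1.1))%:E) else 0.

Let F0 p : 0 <= F p.
Proof. by rewrite /F; case: ifP => // _; rewrite mule_ge0. Qed.

Let mF : measurable_fun setT F.
Proof.
apply: measurable_fun_ifT => //.
  by apply: measurable_fun_ltr => //; apply: measurableT_comp.
apply: emeasurable_funM.
  have sw : measurable_fun setT (fun q : Omega * measurableTypeR R * measurableTypeR R => (q.1.2, q.1.1)).
    by apply: measurable_fun_pair; exact: measurableT_comp.
  exact: (measurableT_comp mprod sw).
have sw : measurable_fun setT (fun q : Omega * measurableTypeR R * measurableTypeR R => (q.2, q.1.1)).
  by apply: measurable_fun_pair => //; exact: measurableT_comp.
exact: (measurableT_comp mprod1 sw).
Qed.

Lemma measurable_double_int : measurable_fun setT (fun w => \int[mu]_r \int[mu]_s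
     (if (r < s)%R then H2 (r, w) * (m (r, w))%:E * (H1 (s, w) * (l (s, w))%:E) else 0)).
Proof.
have mg := @measurable_fun_fubini_tonelli_F _ _ _ _ _ mu F mF F0.
have g0 p : 0 <= fubini_F mu F p by apply: integral_ge0.
have H := @measurable_fun_fubini_tonelli_F _ _ _ _ _ mu _ mg g0.
exact H.
Qed.

Lemma measurable_time_int_if (c : Omega * measurableTypeR R -> bool) :
  measurable_fun setT c ->
  measurable_fun setT (fun w => \int[mu]_r
    (if c (w, r) then H2 (r, w) * (m (r, w))%:E else 0)).
Proof.
move=> mc; pose f (p : Omega * measurableTypeR R) :=
  if c p then H2 (p.2, p.1) * (m (p.2, p.1))%:E else 0.
have f0 p : 0 <= f p by rewrite /f; case: ifP.
have mf : measurable_fun setT f.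
  apply: measurable_fun_ifT => //; exact: (measurableT_comp mprod msw).
have H := @measurable_fun_fubini_tonelli_F _ _ _ _ _ mu f mf f0.
exact H.
Qed.

(** Here the time [r] comes before the jump at [tau]. Tonelli's theorem fixes [r]; the factor
    [H2 * m] at time [r] is then known from [r] on, and multiplying [H1] by it on []r, T]] gives a
    predictable integrand for the compensation formula of [tau]. *)
Lemma at_jump_gt :
  \int[P]_w (at_jump tau H1 w * \int[mu]_r (if (r < tau w)%R then H2 (r, w) * (m (r, w))%:E else 0)) =
  \int[P]_w \int[mu]_r \int[mu]_s
     (if (r < s)%R then H2 (r, w) * (m (r, w))%:E * (H1 (s, w) * (l (s, w))%:E) else 0).
Proof.
have a0 w : 0 <= at_jump tau H1 w by rewrite /at_jump; case: ifP.
pose f (p : Omega * measurableTypeR R) := at_jump tau H1 p.1 *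
  (if (p.2 < tau p.1)%R then H2 (p.2, p.1) * (m (p.2, p.1))%:E else 0).
have f0 p : 0 <= f p by rewrite mule_ge0//; case: ifP.
have mf : measurable_fun setT f.
  apply: emeasurable_funM.
    by apply: measurableT_comp => //; exact: measurable_at_jump_val.
  apply: measurable_fun_ifT => //.
    apply: measurable_fun_ltr => //; apply: measurableT_comp => //.
    exact: oj_mtau Jt.
  exact: (measurableT_comp mprod msw).
transitivity (\int[P]_w \int[mu]_r f (w, r)).
  apply: eq_integral => w _; rewrite -ge0_integralZl//.
  - apply: measurable_fun_ifT => //; first exact: measurable_fun_ltr.
    exact: (measurable_fun_pair1 w mprod).
  - by move=> r _; case: ifP.
rewrite (fubini_tonelli f mf f0).
have mg := @measurable_fun_fubini_tonelli_F _ _ _ _ _ mu F mF F0.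
have g0 p : 0 <= fubini_F mu F p by apply: integral_ge0.
have /= -> := @fubini_tonelli _ _ _ _ _ P mu (fubini_F mu F) mg g0.
apply: eq_integral => r _; rewrite /fubini_F/= /f/= {f mf f0}.
have [rT|rT] := boolP (0 <= r <= T)%R; last first.
  have mr w : m (r, w) = 0%R by apply: (oj_lout Js) => /=; exact/negP.
  rewrite integral0_eq; last by move=> w _; rewrite mr mule0 if_same mule0.
  rewrite integral0_eq// => w _; rewrite integral0_eq// => s _.
  by rewrite /F/= mr mule0 mul0e if_same.
pose Hr := (fun p : R * Omega => H2 (r, p.2) * (m (r, p.2))%:E * H1 p) \_
  (`]r, T] `*` setT).
have r0 : (0 <= r)%R by case/andP: rT.
have mD : measurable (`]r, T] `*` setT : set pt).
  apply: measurable_rect => //; exact: filtrationT hG _ rT.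
have mHr : @measurable_fun _ _ pt _ setT Hr.
  apply: (@measurable_restrictT _ _ pt _ _ (fun p => H2 (r, p.2) * (m (r, p.2))%:E * H1 p) mD).1.
  apply: emeasurable_funM; last exact: (@measurable_funTS _ _ pt).
  apply: (measurable_adapted_ptype hG (Y := fun w => H2 (r, w) * (m (r, w))%:E)) => //.
  apply: emeasurable_funM.
    exact: (measurableT_comp mH2 (measurable_ptype_section hG rT)).
  apply/measurable_EFinP. have mr := oj_lad Js rT; exact mr.
have Hr0 p : 0 <= Hr p by rewrite /Hr patchE; case: ifP => // _; rewrite mule_ge0.
transitivity (\int[P]_w (if (tau w <= T)%R then Hr (tau w, w) else 0)).
  apply: eq_integral => w _; rewrite /at_jump.
  have [tT|Tt] := leP (tau w) T; last by rewrite mul0e.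
  rewrite /Hr patchE; have [rt|tr] := ltP r (tau w).
    by rewrite muleC mem_set//; split => //=; rewrite in_itv/= rt.
  by rewrite mule0 memNset// => -[] /=; rewrite in_itv/= ltNge tr.
rewrite (oj_comp Jt mHr Hr0); apply: eq_integral => w _; apply: eq_integral => s _.
rewrite /F/= /Hr patchE.
have [rs|sr] := ltP r s; last first.
  by rewrite memNset ?mul0e// => -[] /=; rewrite in_itv/= ltNge sr.
have [sT|Ts] := leP s T.
  by rewrite mem_set ?muleA//; split => //=; rewrite in_itv/= rs.
by rewrite (oj_lout Jt) ?mule0//= => /andP[_]; rewrite leNgt Ts.
Qed.

End two_jumps.

(* The product formula for compensated jumps, in which no difference of possibly
   infinite terms occurs.  On [tau < sig], [H1 (tau, _)] becomes known before
   [sig], so [oj_comp] applies to the jump at [sig]; symmetrically on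
   [sig < tau]. *)
Lemma one_jump_product (tau sig : Omega -> R) (l m : R * Omega -> R)
    (H1 H2 : R * Omega -> \bar R) :
  one_jump tau l -> one_jump sig m ->
  @measurable_fun _ _ pt _ setT H1 -> @measurable_fun _ _ pt _ setT H2 ->
  (forall p, 0 <= H1 p) -> (forall p, 0 <= H2 p) ->
  \int[P]_w (at_jump tau H1 w * at_jump sig H2 w) +
  \int[P]_w (time_int l H1 w * time_int m H2 w) =
  \int[P]_w (at_jump tau H1 w * time_int m H2 w) +
  \int[P]_w (time_int l H1 w * at_jump sig H2 w) +
  \int[P]_w (if tau w == sig w then at_jump tau H1 w * at_jump sig H2 w else 0).
Proof.
move=> Jt Js mH1 mH2 H10 H20.
have a0 w : 0 <= at_jump tau H1 w by rewrite /at_jump; case: ifP.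
have b0 w : 0 <= at_jump sig H2 w by rewrite /at_jump; case: ifP.
have ma := measurable_at_jump_val Jt mH1.
have mb := measurable_at_jump_val Js mH2.
have m0 r w : 0 <= H2 (r, w) * (m (r, w))%:E.
  by rewrite mule_ge0// lee_fin; exact: oj_l0 Js _.
have l0 r w : 0 <= H1 (r, w) * (l (r, w))%:E.
  by rewrite mule_ge0// lee_fin; exact: oj_l0 Jt _.
have mtau : measurable_fun setT tau := oj_mtau Jt.
have msig : measurable_fun setT sig := oj_mtau Js.
have mcomp (t : Omega -> R) : measurable_fun setT t ->
    measurable_fun setT (fun p : Omega * measurableTypeR R => (p.2 < t p.1)%R).
  by move=> mt; apply: measurable_fun_ltr => //; exact: measurableT_comp.
have mcomp' (t : Omega -> R) : measurable_fun setT t ->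
    measurable_fun setT (fun p : Omega * measurableTypeR R => (t p.1 < p.2)%R).
  by move=> mt; apply: measurable_fun_ltr => //; exact: measurableT_comp.
have abE : \int[P]_w (at_jump tau H1 w * at_jump sig H2 w) =
    \int[P]_w (if (tau w < sig w)%R then at_jump tau H1 w * at_jump sig H2 w else 0) +
    \int[P]_w (if (sig w < tau w)%R then at_jump sig H2 w * at_jump tau H1 w else 0) +
    \int[P]_w (if tau w == sig w then at_jump tau H1 w * at_jump sig H2 w else 0).
  have mab : measurable_fun setT (fun w => at_jump tau H1 w * at_jump sig H2 w).
    exact: emeasurable_funM.
  have mba : measurable_fun setT (fun w => at_jump sig H2 w * at_jump tau H1 w).
    exact: emeasurable_funM.
  have ab0 w : 0 <= at_jump tau H1 w * at_jump sig H2 w by exact: mule_ge0.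
  have ba0 w : 0 <= at_jump sig H2 w * at_jump tau H1 w by exact: mule_ge0.
  have m1 : measurable_fun setT (fun w =>
      if (tau w < sig w)%R then at_jump tau H1 w * at_jump sig H2 w else 0).
    by apply: measurable_fun_ifT => //; exact: measurable_fun_ltr.
  have m2 : measurable_fun setT (fun w =>
      if (sig w < tau w)%R then at_jump sig H2 w * at_jump tau H1 w else 0).
    by apply: measurable_fun_ifT => //; exact: measurable_fun_ltr.
  rewrite -ge0_integralD//; [|by move=> w _; case: ifP|by move=> w _; case: ifP].
  rewrite -ge0_integralD//.
  - apply: eq_integral => w _; case: ltgtP => _; rewrite ?adde0 ?add0e//.
    exact: muleC.
  - by move=> w _; rewrite adde_ge0//; case: ifP.
  - exact: emeasurable_funD.
  - by move=> w _; case: ifP.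
  - by apply: measurable_fun_ifT => //; exact: measurable_fun_eqr.
have split_at (t s : Omega -> R) (k n : R * Omega -> R) (K1 K2 : R * Omega -> \bar R) :
    one_jump t k -> one_jump s n -> 
    @measurable_fun _ _ pt _ setT K1 -> @measurable_fun _ _ pt _ setT K2 ->
    (forall p, 0 <= K1 p) -> (forall p, 0 <= K2 p) ->
    \int[P]_w (at_jump t K1 w * time_int n K2 w) =
    \int[P]_w (at_jump t K1 w * \int[mu]_r (if (t w < r)%R then K2 (r, w) * (n (r, w))%:E else 0)) +
    \int[P]_w (at_jump t K1 w * \int[mu]_r (if (r < t w)%R then K2 (r, w) * (n (r, w))%:E else 0)).
  move=> Ot Os mK1 mK2 K10 K20.
  have n0 r w : 0 <= K2 (r, w) * (n (r, w))%:E.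
    by rewrite mule_ge0// lee_fin; exact: oj_l0 Os _.
  have mt : measurable_fun setT t := oj_mtau Ot.
  have mat := measurable_at_jump_val Ot mK1.
  have mgt := measurable_time_int_if Os mK2 K20 (mcomp' _ mt).
  have mlt := measurable_time_int_if Os mK2 K20 (mcomp _ mt).
  have i0 (c : R -> bool) w : 0 <= \int[mu]_r (if c r then K2 (r, w) * (n (r, w))%:E else 0).
    by apply: integral_ge0 => r _; case: ifP.
  have t0 w : 0 <= at_jump t K1 w by rewrite /at_jump; case: ifP.
  rewrite -ge0_integralD//.
  - apply: eq_integral => w _; rewrite /time_int (integral_split (t w))//.
      by rewrite ge0_muleDr.
    have mK : measurable_fun setT
        (fun p : measurableTypeR R * Omega => K2 p * (n p)%:E).
      apply: emeasurable_funM.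
        by apply: (@ptype_measurable_fun _ _ _ T G T0 hG) => //; exact: mK2.
      by apply/measurable_EFinP; have mn := oj_ml Os; exact mn.
    exact: (measurable_fun_pair1 w mK).
  - by move=> w _; rewrite mule_ge0.
  - apply: emeasurable_funM; first exact mat.
    exact mgt.
  - by move=> w _; rewrite mule_ge0.
  - apply: emeasurable_funM; first exact mat.
    exact mlt.
have -> : \int[P]_w (time_int l H1 w * at_jump sig H2 w) =
    \int[P]_w (at_jump sig H2 w * time_int l H1 w).
  by apply: eq_integral => w _; rewrite muleC.
rewrite (split_at _ _ _ _ _ _ Jt Js)// (split_at _ _ _ _ _ _ Js Jt)// abE.
rewrite (at_jump_lt Jt Js)// (at_jump_lt Js Jt)//.
rewrite (at_jump_gt Jt Js)// (at_jump_gt Js Jt)//.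
have mY := measurable_double_int Jt Js mH1 mH2 H10 H20.
have mY' := measurable_double_int Js Jt mH2 mH1 H20 H10.
have Y0 w : 0 <= \int[mu]_r \int[mu]_s
    (if (r < s)%R then H2 (r, w) * (m (r, w))%:E * (H1 (s, w) * (l (s, w))%:E) else 0).
  apply: integral_ge0 => r _; apply: integral_ge0 => s _; case: ifP => // _.
  exact: mule_ge0.
have Y'0 w : 0 <= \int[mu]_r \int[mu]_s
    (if (r < s)%R then H1 (r, w) * (l (r, w))%:E * (H2 (s, w) * (m (s, w))%:E) else 0).
  apply: integral_ge0 => r _; apply: integral_ge0 => s _; case: ifP => // _.
  exact: mule_ge0.
(* The contributions of [tau < sig] and [sig < tau] equal those of the time integrals after the
   respective jump and are matched on the two sides. What remains is the product of the time
   integrals against the two triangular double integrals. *)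
rewrite addeAC; congr (_ + _); rewrite [RHS]addeACA; congr (_ + _).
rewrite -ge0_integralD//; apply: eq_integral => w _.
rewrite muleC /time_int mule_integral_split//.
- have mK : measurable_fun setT (fun p : measurableTypeR R * Omega => H2 p * (m p)%:E).
    apply: emeasurable_funM.
      by apply: (@ptype_measurable_fun _ _ _ T G T0 hG) => //; exact: mH2.
    by apply/measurable_EFinP; have mn := oj_ml Js; exact mn.
  exact: (measurable_fun_pair1 w mK).
- have mK : measurable_fun setT (fun p : measurableTypeR R * Omega => H1 p * (l p)%:E).
    apply: emeasurable_funM.
      by apply: (@ptype_measurable_fun _ _ _ T G T0 hG) => //; exact: mH1.
    by apply/measurable_EFinP; have mn := oj_ml Jt; exact mn.
  exact: (measurable_fun_pair1 w mK).
Qed.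

End one_jump.

(** * Square integrable functions and measurability of path integrals *)

Section Lfun2.
Context d (T : measurableType d) {R : realType} (mu : {measure set T -> \bar R}).
Local Open Scope ereal_scope.

Lemma Lfun2P (f : T -> R) : measurable_fun setT f ->
  \int[mu]_x ((f x ^+ 2)%:E) < +oo -> f \in Lfun mu 2%:E.
Proof.
move=> mf lty; rewrite inE; apply/andP; split; first by rewrite inE.
rewrite inE /finite_norm/= unlock /= poweR_lty//.
rewrite (eq_integral (fun x => (f x ^+ 2)%:E))// => x _.
by rewrite powR_mulrn// real_normK// num_real.
Qed.

Lemma Lfun2_ae (f g : T -> R) : measurable_fun setT f ->
  ae_eq mu setT f g -> g \in Lfun mu 2%:E -> f \in Lfun mu 2%:E.
Proof.
move=> mf fg Lg; apply: Lfun2P => //.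
have mg : measurable_fun setT g by have /sub_Lfun_mfun := Lg; rewrite inE.
have /integrableP[_] := Lfun2_integrable_sqr Lg; apply: le_lt_trans.
rewrite (ge0_ae_eq_integral (g := fun x => (g x ^+ 2)%:E))//.
- apply: ge0_le_integral => //.
  + by move=> x _; rewrite lee_fin sqr_ge0.
  + by apply/measurable_EFinP; exact: measurable_funX.
  + by apply: measurableT_comp => //; apply/measurable_EFinP; exact: measurable_funX.
  + by move=> x _; rewrite lee_abs.
- by apply/measurable_EFinP; exact: measurable_funX.
- by apply/measurable_EFinP; exact: measurable_funX.
- by move=> x _; rewrite lee_fin sqr_ge0.
- by move=> x _; rewrite lee_fin sqr_ge0.
- by apply: filterS fg => x /= fg _; rewrite fg.
Qed.

End Lfun2.

Section measurable_Rintegral.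
Context {R : realType} {d : measure_display} {Omega : measurableType d}.
Local Notation mu := (@lebesgue_measure R).

Lemma measurable_fun_Rintegral (f : R * Omega -> R) : measurable_fun setT f ->
  measurable_fun setT (fun w => \int[mu]_t f (t, w)).
Proof.
move=> mf0.
have mf : measurable_fun setT (EFin \o f : measurableTypeR R * Omega -> \bar R).
  by apply/measurable_EFinP; exact mf0.
have mp := @measurable_fun_fubini_tonelli_G _ _ _ _ _ mu _
  (measurable_funepos mf) (fun p => funepos_ge0 _ p).
have mn := @measurable_fun_fubini_tonelli_G _ _ _ _ _ mu _
  (measurable_funeneg mf) (fun p => funeneg_ge0 _ p).
rewrite /Rintegral; apply: measurableT_comp => //.
rewrite (_ : (fun w => _) = (fun w => fubini_G mu (EFin \o f)^\+%E w -
    fubini_G mu (EFin \o f)^\-%E w)%E); first exact: emeasurable_funB.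
apply/funext => w; rewrite integralE /fubini_G; congr (_ - _)%E;
  by apply: eq_integral => t _; rewrite !(funeposE, funenegE).
Qed.

End measurable_Rintegral.

(** * Bounded predictable integrands against one compensated jump *)

Section one_jump_integral.
Context {R : realType} {d : measure_display} {Omega : measurableType d}.
Variables (P : probability Omega R) (T : R) (G : R -> set (set Omega)).
Hypothesis T0 : (0 < T)%R.
Hypothesis hG : filtration T G.

Local Notation mu := (@lebesgue_measure R).
Local Notation pt := (ptype T G).
Local Notation one_jump := (one_jump P T G).

Definition at_jumpr (tau : Omega -> R) (phi : R * Omega -> R) w : R :=
  if tau w <= T then phi (tau w, w) else 0.

Definition jump_int (tau : Omega -> R) (l phi : R * Omega -> R) w : R :=
  at_jumpr tau phi w - \int[mu]_t (phi (t, w) * l (t, w)).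

Definition bounded_predictable (phi : R * Omega -> R) :=
  @measurable_fun _ _ pt _ setT phi /\ exists K, forall p, `|phi p| <= K.

Lemma at_jump_EFin tau phi w :
  at_jump T tau (EFin \o phi) w = (at_jumpr tau phi w)%:E.
Proof. by rewrite /at_jump /at_jumpr; case: ifP. Qed.

Lemma measurable_at_jumpr tau l phi : one_jump tau l ->
  bounded_predictable phi -> measurable_fun setT (at_jumpr tau phi).
Proof.
move=> J [mphi _].
have mE : @measurable_fun _ _ pt _ setT (EFin \o phi) by exact/measurable_EFinP.
have mJ := measurable_at_jump_val T0 hG J mE.
apply/measurable_EFinP; rewrite (_ : EFin \o _ = at_jump T tau (EFin \o phi))//.
by apply/funext => w; rewrite at_jump_EFin.
Qed.

Section nonneg.
Variables (tau : Omega -> R) (l : R * Omega -> R) (phi : R * Omega -> R).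
Hypotheses (J : one_jump tau l) (bphi : bounded_predictable phi).
Hypothesis phi0 : forall p, 0 <= phi p.

Lemma time_int_EFin w :
  time_int l (EFin \o phi) w = (\int[mu]_t (phi (t, w) * l (t, w))%:E)%E.
Proof. by apply: eq_integral => t _; rewrite EFinM. Qed.

(** By compensation this is the expectation of [phi] at the jump, hence at most the bound [K]: one
    jump carries expected intensity at most one. *)
Lemma time_int_lty : (\int[P]_w time_int l (EFin \o phi) w < +oo)%E.
Proof.
have [mphi [K pK]] := bphi.
have mE : @measurable_fun _ _ pt _ setT (EFin \o phi) by exact/measurable_EFinP.
have := oj_comp J mE => <-; last by move=> p; rewrite lee_fin.
apply: (@le_lt_trans _ _ (\int[P]_w (cst K%:E w))%E); last first.
  rewrite integral_cst//.
  have H x : x = 1%E -> (K%:E * x < +oo)%E by move=> ->; rewrite mule1 ltry.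
  exact: (H _ (probability_setT P)).
have K0 : 0 <= K by rewrite (le_trans _ (pK (0, point))).
apply: ge0_le_integral => //.
- by move=> w _; case: ifP => // _; rewrite lee_fin.
- exact: (measurable_at_jump_val T0 hG J mE).
- move=> w _; case: ifP; rewrite lee_fin// => _.
  by rewrite (le_trans _ (pK (tau w, w)))// ler_norm.
Qed.

Lemma measurable_time_int : measurable_fun setT (time_int l (EFin \o phi)).
Proof.
have [mphi _] := bphi.
have mE : @measurable_fun _ _ pt _ setT (EFin \o phi) by exact/measurable_EFinP.
have := measurable_time_int_if T0 hG J mE _ (measurable_cst true).
by apply => p; rewrite lee_fin.
Qed.

Lemma time_int_ge0 w : (0 <= time_int l (EFin \o phi) w)%E.
Proof.
by apply: integral_ge0 => t _; rewrite mule_ge0// lee_fin//; exact: oj_l0 J _.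
Qed.

Lemma time_int_ae : {ae P, forall w, time_int l (EFin \o phi) w =
  (\int[mu]_t (phi (t, w) * l (t, w)))%:E}.
Proof.
have : P.-integrable setT (time_int l (EFin \o phi)).
  apply/integrableP; split; first exact: measurable_time_int.
  under eq_integral do rewrite gee0_abs ?time_int_ge0//.
  exact: time_int_lty.
move=> /integrable_ae => /(_ measurableT); apply: filterS => w /(_ I) fw.
by rewrite /Rintegral -time_int_EFin fineK.
Qed.

End nonneg.

Lemma at_jumpr_bounded tau phi K : (forall p, `|phi p| <= K) ->
  forall w, `|at_jumpr tau phi w| <= K.
Proof.
move=> pK w; rewrite /at_jumpr; case: ifP => // _.
by rewrite normr0 (le_trans _ (pK (0, w))).
Qed.

Lemma bounded_Lfun2 (f : Omega -> R) K : measurable_fun setT f ->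
  (forall w, `|f w| <= K) -> f \in Lfun P 2%:E.
Proof.
move=> mf fK; apply: Lfun2P => //.
apply: (@le_lt_trans _ _ (\int[P]_w (cst (K ^+ 2)%:E w))%E); last first.
  rewrite integral_cst//.
  have H x : x = 1%E -> ((K ^+ 2)%:E * x < +oo)%E by move=> ->; rewrite mule1 ltry.
  exact: (H _ (probability_setT P)).
apply: ge0_le_integral => //.
- by move=> w _; rewrite lee_fin sqr_ge0.
- by apply/measurable_EFinP; exact: measurable_funX.
- move=> w _; rewrite lee_fin -real_normK ?num_real//.
  by rewrite lerXn2r// nnegrE (le_trans _ (fK w)).
Qed.

Lemma at_jumpr_Lfun2 tau l phi : one_jump tau l -> bounded_predictable phi ->
  at_jumpr tau phi \in Lfun P 2%:E.
Proof.
move=> J bphi; have mphi := measurable_at_jumpr J bphi.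
case: bphi => _ [K /(at_jumpr_bounded tau) pK]; exact: bounded_Lfun2 mphi pK.
Qed.

(** The quadratic covariation of the two compensated jumps at time [T]. Jumps that coincide after
    [T] contribute 0, since [at_jumpr] vanishes there. *)
Definition common_jump (tau sig : Omega -> R) (phi psi : R * Omega -> R) w : R :=
  if tau w == sig w then at_jumpr tau phi w * at_jumpr sig psi w else 0.

Lemma Lfun21 f : f \in Lfun P 2%:E -> f \in Lfun P 1%:E.
Proof. by apply: Lfun_subset12; rewrite fin_num_measure. Qed.

Lemma common_jump_Lfun1 tau sig l m phi psi :
  one_jump tau l -> one_jump sig m ->
  bounded_predictable phi -> bounded_predictable psi ->
  common_jump tau sig phi psi \in Lfun P 1%:E.
Proof.
move=> J1 J2 bphi bpsi; apply: Lfun21.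
have mphi := measurable_at_jumpr J1 bphi.
have mpsi := measurable_at_jumpr J2 bpsi.
case: bphi => _ [K pK]; case: bpsi => _ [K' pK'].
have K0 : 0 <= K by rewrite (le_trans _ (pK (0, point))).
have K'0 : 0 <= K' by rewrite (le_trans _ (pK' (0, point))).
apply: (@bounded_Lfun2 _ (K * K')).
  apply: measurable_fun_ifT => //; last exact: measurable_funM.
  by apply: measurable_fun_eqr; [exact: oj_mtau J1|exact: oj_mtau J2].
move=> w; rewrite /common_jump; case: ifP => _; last by rewrite normr0 mulr_ge0.
by rewrite normrM ler_pM// at_jumpr_bounded.
Qed.

Section nonneg_product.
Variables (tau sig : Omega -> R) (l m : R * Omega -> R) (phi psi : R * Omega -> R).
Hypotheses (J1 : one_jump tau l) (J2 : one_jump sig m).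
Hypotheses (bphi : bounded_predictable phi) (bpsi : bounded_predictable psi).
Hypotheses (phi0 : forall p, 0 <= phi p) (psi0 : forall p, 0 <= psi p).

Let bounded_int (t s : Omega -> R) k n f g : one_jump t k -> one_jump s n ->
  bounded_predictable f -> bounded_predictable g ->
  (forall p, 0 <= f p) -> (forall p, 0 <= g p) ->
  (\int[P]_w ((at_jumpr t f w)%:E * time_int n (EFin \o g) w) < +oo)%E.
Proof.
move=> Jt Js bf bg f0 g0; have [mf [K fK]] := bf.
have K0 : 0 <= K by rewrite (le_trans _ (fK (0, point))).
apply: (@le_lt_trans _ _ (\int[P]_w (K%:E * time_int n (EFin \o g) w))%E).
  apply: ge0_le_integral => //.
  - move=> w _; rewrite mule_ge0 ?lee_fin//; last exact: (time_int_ge0 Js).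
    by rewrite /at_jumpr; case: ifP.
  - apply: emeasurable_funM; last exact: (measurable_time_int Js).
    by apply/measurable_EFinP; exact: (measurable_at_jumpr Jt).
  - by apply: emeasurable_funM => //; exact: (measurable_time_int Js).
  - move=> w _; apply: lee_wpmul2r; first exact: (time_int_ge0 Js).
    by rewrite lee_fin (le_trans _ (at_jumpr_bounded t fK w))// ler_norm.
rewrite ge0_integralZl//; last 2 first.
- exact: (measurable_time_int Js).
- by move=> w _; exact: (time_int_ge0 Js).
apply: lte_mul_pinfty => //; exact: (time_int_lty Js).
Qed.

Let mE f : bounded_predictable f ->
  @measurable_fun _ _ pt _ setT (EFin \o f).
Proof. by case=> mf _; exact/measurable_EFinP. Qed.

Let product := one_jump_product T0 hG J1 J2 (mE bphi) (mE bpsi) phi0 psi0.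

(** The product formula bounds this term by the other side. The mixed terms there contain only one
    time integral next to a bounded jump value, and the common jump is bounded. *)
Lemma time_int_product_lty : (\int[P]_w (time_int l (EFin \o phi) w *
  time_int m (EFin \o psi) w) < +oo)%E.
Proof.
apply: (@le_lt_trans _ _ (\int[P]_w (at_jump T tau (EFin \o phi) w * at_jump T sig (EFin \o psi) w) +
  \int[P]_w (time_int l (EFin \o phi) w * time_int m (EFin \o psi) w))%E).
  rewrite leeDr// integral_ge0// => w _; rewrite !at_jump_EFin -EFinM lee_fin.
  by rewrite mulr_ge0// /at_jumpr; case: ifP.
rewrite product; apply: lte_add_pinfty; first apply: lte_add_pinfty.
- under eq_integral do rewrite at_jump_EFin; exact: (bounded_int J1 J2).
- under eq_integral do rewrite at_jump_EFin muleC; exact: (bounded_int J2 J1).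
have := expectation_fin_num (common_jump_Lfun1 J1 J2 bphi bpsi).
rewrite unlock fin_numElt => /andP[_]; apply: le_lt_trans.
rewrite le_eqVlt; apply/orP; left; apply/eqP; apply: eq_integral => w _.
by rewrite /common_jump !at_jump_EFin; case: ifP.
Qed.

End nonneg_product.

Lemma time_integral_Lfun2 tau l phi : one_jump tau l -> bounded_predictable phi ->
  (forall p, 0 <= phi p) ->
  (fun w => \int[mu]_t (phi (t, w) * l (t, w))) \in Lfun P 2%:E.
Proof.
move=> J bphi phi0.
have mI : measurable_fun setT (fun w => \int[mu]_t (phi (t, w) * l (t, w))).
  apply: (measurable_fun_Rintegral (f := fun p => phi p * l p)).
  apply: measurable_funM; last exact: (oj_ml J).
  by case: bphi => mphi _; exact: (ptype_measurable_fun T0 hG).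
apply: Lfun2P => //; have := time_int_product_lty J J bphi bphi phi0 phi0.
rewrite (ge0_ae_eq_integral (f := fun w => (time_int l (EFin \o phi) w * time_int l (EFin \o phi) w)%E)
  (g := fun w => ((\int[mu]_t (phi (t, w) * l (t, w))) ^+ 2)%:E))//.
- by apply: emeasurable_funM; exact: (measurable_time_int J bphi phi0).
- by apply/measurable_EFinP; exact: measurable_funX.
- by move=> w _; rewrite mule_ge0// (time_int_ge0 J phi0).
- by move=> w _; rewrite lee_fin sqr_ge0.
apply: filterS (time_int_ae J bphi phi0) => w /= -> _.
by rewrite -EFinM expr2.
Qed.

Lemma nonneg_jump_int_Lfun2 tau l phi : one_jump tau l ->
  bounded_predictable phi -> (forall p, 0 <= phi p) ->
  jump_int tau l phi \in Lfun P 2%:E.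
Proof.
move=> J bphi phi0; apply: rpredB => [|h|h]; first by rewrite lee_fin ler1n.
  exact: at_jumpr_Lfun2 J bphi.
have La := time_integral_Lfun2 J bphi phi0; exact: La.
Qed.

(** All four products in the expansion are now integrable, so the product formula may be rearranged
    by subtraction. *)
Lemma nonneg_jump_int_product tau sig l m phi psi :
  one_jump tau l -> one_jump sig m ->
  bounded_predictable phi -> bounded_predictable psi ->
  (forall p, 0 <= phi p) -> (forall p, 0 <= psi p) ->
  ('E_P[jump_int tau l phi \* jump_int sig m psi] =
   'E_P[common_jump tau sig phi psi])%E.
Proof.
move=> J1 J2 bphi bpsi phi0 psi0.
set a := at_jumpr tau phi; set b := at_jumpr sig psi.
pose al w := \int[mu]_t (phi (t, w) * l (t, w)).
pose be w := \int[mu]_t (psi (t, w) * m (t, w)).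
have La : a \in Lfun P 2%:E := at_jumpr_Lfun2 J1 bphi.
have Lb : b \in Lfun P 2%:E := at_jumpr_Lfun2 J2 bpsi.
have Lal : al \in Lfun P 2%:E := time_integral_Lfun2 J1 bphi phi0.
have Lbe : be \in Lfun P 2%:E := time_integral_Lfun2 J2 bpsi psi0.
have -> : jump_int tau l phi \* jump_int sig m psi =
  (a \* b \+ al \* be) \- (a \* be \+ al \* b).
  by apply/funext => w /=; rewrite /jump_int -/(a w) -/(b w) -/(al w) -/(be w); ring.
have Lab := Lfun2_mul_Lfun1 La Lb; have Lalb := Lfun2_mul_Lfun1 Lal Lb.
have Labe := Lfun2_mul_Lfun1 La Lbe; have Lalbe := Lfun2_mul_Lfun1 Lal Lbe.
have L1D f g : f \in Lfun P 1%:E -> g \in Lfun P 1%:E -> f \+ g \in Lfun P 1%:E.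
  by move=> Lf Lg; apply: rpredD.
rewrite expectationB; [|exact: L1D|exact: L1D].
rewrite (expectationD Lab Lalbe) (expectationD Labe Lalb).
have mE f : bounded_predictable f -> @measurable_fun _ _ pt _ setT (EFin \o f).
  by case=> mf _; exact/measurable_EFinP.
have al_ae := time_int_ae J1 bphi phi0; have be_ae := time_int_ae J2 bpsi psi0.
have mal := measurable_time_int J1 bphi phi0.
have mbe := measurable_time_int J2 bpsi psi0.
have al0 := time_int_ge0 J1 phi0; have be0 := time_int_ge0 J2 psi0.
have a0 w : 0 <= a w by rewrite /a /at_jumpr; case: ifP.
have b0 w : 0 <= b w by rewrite /b /at_jumpr; case: ifP.
have mL f : f \in Lfun P 2%:E -> measurable_fun setT f.
  by move=> /sub_Lfun_mfun; rewrite inE.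
have mA := measurable_at_jump_val T0 hG J1 (mE _ bphi).
have mB := measurable_at_jump_val T0 hG J2 (mE _ bpsi).
have := one_jump_product T0 hG J1 J2 (mE _ bphi) (mE _ bpsi) phi0 psi0.
have -> : (\int[P]_w (at_jump T tau (EFin \o phi) w * at_jump T sig (EFin \o psi) w) =
    'E_P[a \* b])%E.
  by rewrite unlock; apply: eq_integral => w _; rewrite !at_jump_EFin.
have -> : (\int[P]_w (time_int l (EFin \o phi) w * time_int m (EFin \o psi) w) =
    'E_P[al \* be])%E.
  rewrite unlock; apply: ae_eq_integral => //.
  - exact: emeasurable_funM.
  - by apply/measurable_EFinP; apply: measurable_funM; exact: mL.
  - by apply: filterS2 al_ae be_ae => w -> -> _.
have -> : (\int[P]_w (at_jump T tau (EFin \o phi) w * time_int m (EFin \o psi) w) =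
    'E_P[a \* be])%E.
  rewrite unlock; apply: ae_eq_integral => //.
  - exact: emeasurable_funM.
  - by apply/measurable_EFinP; apply: measurable_funM; exact: mL.
  - by apply: filterS be_ae => w -> _; rewrite at_jump_EFin.
have -> : (\int[P]_w (time_int l (EFin \o phi) w * at_jump T sig (EFin \o psi) w) =
    'E_P[al \* b])%E.
  rewrite unlock; apply: ae_eq_integral => //.
  - exact: emeasurable_funM.
  - by apply/measurable_EFinP; apply: measurable_funM; exact: mL.
  - by apply: filterS al_ae => w -> _; rewrite at_jump_EFin.
have -> : (\int[P]_w (if tau w == sig w then at_jump T tau (EFin \o phi) w *
    at_jump T sig (EFin \o psi) w else 0) = 'E_P[common_jump tau sig phi psi])%E.
  rewrite unlock; apply: eq_integral => w _.
  by rewrite /common_jump !at_jump_EFin; case: ifP.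
move=> ->; rewrite [X in (X - _)%E]addeC addeK//.
by rewrite fin_numD !expectation_fin_num.
Qed.

Lemma expectation_ae (f g : Omega -> R) : measurable_fun setT f ->
  measurable_fun setT g -> {ae P, forall w, f w = g w} -> ('E_P[f] = 'E_P[g])%E.
Proof.
move=> mf mg fg; rewrite unlock; apply: ae_eq_integral => //.
- exact/measurable_EFinP.
- exact/measurable_EFinP.
- by apply: filterS fg => w /= -> _.
Qed.

Lemma bounded_predictable_norm phi : bounded_predictable phi ->
  bounded_predictable (fun p => `|phi p|).
Proof.
move=> [mphi [K pK]]; split; first exact: measurableT_comp.
by exists K => p; rewrite normr_id.
Qed.

Lemma bounded_predictable_pos phi : bounded_predictable phi ->
  bounded_predictable (phi^\+)%R.
Proof.
move=> [mphi [K pK]]; split; first exact: measurable_funrpos.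
exists K => p; rewrite ger0_norm ?funrpos_ge0// (le_trans _ (pK p))//.
by rewrite /funrpos ge_max ler_norm normr_ge0.
Qed.

Lemma bounded_predictable_neg phi : bounded_predictable phi ->
  bounded_predictable (phi^\-)%R.
Proof.
move=> [mphi [K pK]]; split; first exact: measurable_funrneg.
exists K => p; rewrite ger0_norm ?funrneg_ge0// (le_trans _ (pK p))//.
by rewrite /funrneg ge_max normr_ge0 -normrN ler_norm.
Qed.

Lemma predictable_prod_measurable tau l phi : one_jump tau l ->
  bounded_predictable phi -> measurable_fun setT (fun p => phi p * l p).
Proof.
move=> J [mphi _]; apply: measurable_funM; last exact: (oj_ml J).
exact: (ptype_measurable_fun T0 hG).
Qed.

Lemma time_int_integrable tau l phi : one_jump tau l ->
  bounded_predictable phi -> {ae P, forall w, mu.-integrable setT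
    (fun t => (phi (t, w) * l (t, w))%:E)}.
Proof.
move=> J bphi; have bn := bounded_predictable_norm bphi.
have n0 p : 0 <= `|phi p| by [].
have : P.-integrable setT (time_int l (EFin \o (fun p => `|phi p|))).
  apply/integrableP; split; first by have mt := measurable_time_int J bn n0; exact: mt.
  under eq_integral do rewrite gee0_abs ?(time_int_ge0 J n0)//.
  have lt := time_int_lty J bn n0; exact: lt.
move=> /integrable_ae => /(_ measurableT); apply: filterS => w /(_ I) fw.
apply/integrableP; split.
  have mE : measurable_fun setT
      (fun p : measurableTypeR R * Omega => (phi p * l p)%:E).
    by apply/measurable_EFinP; have m := predictable_prod_measurable J bphi; exact m.
  exact: (measurable_fun_pair1 w mE).
move: fw; rewrite fin_numElt => /andP[_]; apply: le_lt_trans.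
rewrite le_eqVlt; apply/orP; left; apply/eqP; apply: eq_integral => t _ /=.
by rewrite normrM -EFinM (ger0_norm (oj_l0 J _)).
Qed.

Lemma measurable_jump_int tau l phi : one_jump tau l ->
  bounded_predictable phi -> measurable_fun setT (jump_int tau l phi).
Proof.
move=> J bphi; apply: measurable_funB; first exact: measurable_at_jumpr J bphi.
have mI := measurable_fun_Rintegral (predictable_prod_measurable J bphi).
exact mI.
Qed.

Lemma at_jumprB tau phi psi w :
  at_jumpr tau (phi \- psi) w = at_jumpr tau phi w - at_jumpr tau psi w.
Proof. by rewrite /at_jumpr; case: ifP; rewrite ?subr0. Qed.

(** Only almost everywhere, because the time integrals of both parts must be finite for their
    difference to split. *)
Lemma jump_int_posneg tau l phi : one_jump tau l ->
  bounded_predictable phi -> {ae P, forall w, jump_int tau l phi w =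
    jump_int tau l (phi^\+)%R w - jump_int tau l (phi^\-)%R w}.
Proof.
move=> J bphi.
have ip := time_int_integrable J (bounded_predictable_pos bphi).
have ineg := time_int_integrable J (bounded_predictable_neg bphi).
apply: filterS2 ip ineg => w iw nw.
rewrite /jump_int -[in LHS](funrposBneg phi).
have -> : \int[mu]_t ((phi^\+ \- phi^\-)%R (t, w) * l (t, w)) =
    \int[mu]_t ((phi^\+)%R (t, w) * l (t, w)) - \int[mu]_t ((phi^\-)%R (t, w) * l (t, w)).
  rewrite -RintegralB//; apply: eq_Rintegral => t _; exact: mulrBl.
rewrite at_jumprB; ring.
Qed.

Lemma jump_int_Lfun2 tau l phi : one_jump tau l ->
  bounded_predictable phi -> jump_int tau l phi \in Lfun P 2%:E.
Proof.
move=> J bphi; have mJ := measurable_jump_int J bphi.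
have bp := bounded_predictable_pos bphi; have bn := bounded_predictable_neg bphi.
have Lp := nonneg_jump_int_Lfun2 J bp (funrpos_ge0 _).
have Ln := nonneg_jump_int_Lfun2 J bn (funrneg_ge0 _).
apply: (Lfun2_ae (g := jump_int tau l (phi^\+)%R \- jump_int tau l (phi^\-)%R)) => //.
  by apply: filterS (jump_int_posneg J bphi) => w E _.
by apply: rpredB => [|h|h]; [rewrite lee_fin ler1n|exact: Lp|exact: Ln].
Qed.

(** Both sides are bilinear in the integrands, which reduces the claim to the positive and negative
    parts. *)
Lemma jump_int_product tau sig l m phi psi :
  one_jump tau l -> one_jump sig m ->
  bounded_predictable phi -> bounded_predictable psi ->
  ('E_P[jump_int tau l phi \* jump_int sig m psi] =
   'E_P[common_jump tau sig phi psi])%E.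
Proof.
move=> J1 J2 bphi bpsi.
have bp := bounded_predictable_pos bphi; have bn := bounded_predictable_neg bphi.
have bp' := bounded_predictable_pos bpsi; have bn' := bounded_predictable_neg bpsi.
have p0 := @funrpos_ge0 _ _ phi; have n0 := @funrneg_ge0 _ _ phi.
have p0' := @funrpos_ge0 _ _ psi; have n0' := @funrneg_ge0 _ _ psi.
set A := jump_int tau l phi; set B := jump_int sig m psi.
pose Ap := jump_int tau l (phi^\+)%R; pose An := jump_int tau l (phi^\-)%R.
pose Bp := jump_int sig m (psi^\+)%R; pose Bn := jump_int sig m (psi^\-)%R.
have mJ := measurable_jump_int J1; have mJ' := measurable_jump_int J2.
have -> : ('E_P[A \* B] = 'E_P[((Ap \* Bp \+ An \* Bn) \- (Ap \* Bn \+ An \* Bp))%R])%E.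
  apply: expectation_ae.
  - by apply: measurable_funM; [exact: mJ|exact: mJ'].
  - by apply: measurable_funB; apply: measurable_funD; apply: measurable_funM;
      [exact: mJ|exact: mJ'|exact: mJ|exact: mJ'|exact: mJ|exact: mJ'|exact: mJ|exact: mJ'].
  - apply: filterS2 (jump_int_posneg J1 bphi) (jump_int_posneg J2 bpsi) => w /=.
    rewrite -/A -/B -/Ap -/An -/Bp -/Bn => -> ->; ring.
have -> : common_jump tau sig phi psi =
    (common_jump tau sig (phi^\+)%R (psi^\+)%R \+ common_jump tau sig (phi^\-)%R (psi^\-)%R) \-
    (common_jump tau sig (phi^\+)%R (psi^\-)%R \+ common_jump tau sig (phi^\-)%R (psi^\+)%R).
  apply/funext => w; rewrite -{1}(funrposBneg phi) -{1}(funrposBneg psi) /= /common_jump.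
  by rewrite !at_jumprB; case: ifP => _; ring.
have L1D f g : f \in Lfun P 1%:E -> g \in Lfun P 1%:E -> f \+ g \in Lfun P 1%:E.
  by move=> Lf Lg; apply: rpredD.
have LA1 := nonneg_jump_int_Lfun2 J1 bp p0; have LA2 := nonneg_jump_int_Lfun2 J1 bn n0.
have LB1 := nonneg_jump_int_Lfun2 J2 bp' p0'; have LB2 := nonneg_jump_int_Lfun2 J2 bn' n0'.
have L1 := Lfun2_mul_Lfun1 LA1 LB1; have L2 := Lfun2_mul_Lfun1 LA2 LB2.
have L3 := Lfun2_mul_Lfun1 LA1 LB2; have L4 := Lfun2_mul_Lfun1 LA2 LB1.
have C1 := common_jump_Lfun1 J1 J2 bp bp'; have C2 := common_jump_Lfun1 J1 J2 bn bn'.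
have C3 := common_jump_Lfun1 J1 J2 bp bn'; have C4 := common_jump_Lfun1 J1 J2 bn bp'.
have E1 := expectationB (L1D _ _ L1 L2) (L1D _ _ L3 L4).
have E2 := expectationB (L1D _ _ C1 C2) (L1D _ _ C3 C4).
rewrite E1 E2 (expectationD L1 L2) (expectationD L3 L4).
rewrite (expectationD C1 C2) (expectationD C3 C4).
by rewrite !nonneg_jump_int_product.
Qed.

End one_jump_integral.

(** * Square integrable compensated integrals *)

Section slots.
Context {R : realType} {d : measure_display} {Omega : measurableType d}.
Variables (P : probability Omega R) (T : R) (N : R -> Omega -> nat).
Variable (lam : R -> Omega -> R).
Hypothesis T0 : 0 < T.
Hypothesis cN : forall w, counting_path T (N^~ w).

Local Notation mu := (@lebesgue_measure R).
Local Notation tau := (jump_of T N).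

(* The intensity of the jump number [j.+1] taken alone. *)
Definition slot_intensity (j : nat) (p : R * Omega) : R :=
  if (0 <= p.1 <= T) && (tau j p.2 < p.1 <= tau j.+1 p.2) then lam p.1 p.2 else 0.

(** Extension by zero: values outside [[0, T]] are unspecified, whereas Fubini's theorem and
    sections are applied on the whole line. *)
Definition on_interval (phi : R -> Omega -> R) (p : R * Omega) : R :=
  if 0 <= p.1 <= T then phi p.1 p.2 else 0.

(** The intervals []tau_j, tau_(j+1)]] with [j < k] partition []0, tau_k]]; time 0 belongs to no
    slot. *)
Lemma sum_slot_intensity k p : \sum_(j < k) slot_intensity j p =
  if (0 < p.1 <= T) && (p.1 <= tau k p.2) then lam p.1 p.2 else 0.
Proof.
have t0 : tau 0 p.2 = 0 by exact: jump_time0.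
elim: k => [|k IH]; first rewrite big_ord0 t0.
  by case: ifP => // /andP[/andP[p0 _]]; rewrite leNgt p0.
have kk : tau k p.2 <= tau k.+1 p.2 by exact: jump_time_homo.
rewrite big_ord_recr/= IH /slot_intensity.
have [pk|kp] := leP p.1 (tau k p.2).
  by rewrite andbF addr0 (le_trans pk kk) !andbT.
rewrite andbF add0r/=; have p0 : 0 < p.1 := le_lt_trans (jump_of_ge0 N T0 _ _) kp.
by rewrite p0 ltW.
Qed.

(** Trades a path-dependent number [n] of summands for a fixed number [k]. *)
Lemma sum_jumps (g : nat -> R) n k : (forall j, (k <= j < n)%N -> g j = 0) ->
  \sum_(j < n) g j = \sum_(j < k) (if (j < n)%N then g j else 0).
Proof.
move=> g0; rewrite (big_ord_widen (maxn n k) g (leq_maxl _ _)).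
rewrite (big_ord_widen (maxn n k) (fun j => if (j < n)%N then g j else 0) (leq_maxr _ _)).
rewrite big_mkcond [RHS]big_mkcond; apply: eq_bigr => j _.
case: ltnP => jn; case: ltnP => // kj.
by rewrite g0// kj.
Qed.

Lemma measurable_on_interval phi : measurable_process T phi ->
  measurable_fun setT (on_interval phi).
Proof.
move=> mphi.
have mD : measurable (`[0, T] `*` setT : set (R * Omega)).
  by apply: measurableX.
have mr := (measurable_restrictT _ mD).1 mphi.
rewrite (_ : on_interval phi = (fun p => phi p.1 p.2) \_ (`[0, T] `*` setT))//.
apply/funext => -[t w]; rewrite patchE /on_interval/=.
case: ifPn => tT; first by rewrite mem_set//; split => //=; rewrite in_itv.
by rewrite memNset// => -[/= + _]; rewrite in_itv/= (negPf tT).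
Qed.

Lemma measurable_process_section (phi : R -> Omega -> R) w : measurable_process T phi ->
  measurable_fun (`]0, T] : set (measurableTypeR R)) (phi^~ w).
Proof.
move=> mphi; have m1 := measurable_on_interval mphi.
have m2 : measurable_fun setT (fun t => on_interval phi (t, w)).
  exact: (measurable_fun_pair1 w m1).
apply: (eq_measurable_fun (fun t => on_interval phi (t, w))).
  move=> t; rewrite inE/= in_itv/= => /andP[t0 tT].
  by rewrite /on_interval/= (ltW t0) tT.
by apply: measurable_funTS; exact: m2.
Qed.

Lemma Rintegral_on_interval phi psi w :
  \int[mu]_(t in `[0, T]) (phi t w * psi t w) =
  \int[mu]_t (on_interval phi (t, w) * on_interval psi (t, w)).
Proof.
rewrite Rintegral_mkcond; apply: eq_Rintegral => t _; rewrite patchE /on_interval/=.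
case: ifPn => [|] ; case: ifPn => // h1 h2; rewrite ?mul0r//; exfalso.
  by move: h2; rewrite inE/= in_itv/= (negPf h1).
by move: h2; rewrite notin_setE/= in_itv/= h1.
Qed.

Lemma compensated_integralE (phi : R -> Omega -> R) w : measurable_process T phi ->
  compensated_integral T N lam phi w =
  \sum_(j < N T w) phi (tau j.+1 w) w -
  \int[mu]_t (on_interval phi (t, w) * on_interval lam (t, w)).
Proof.
move=> mphi; rewrite /compensated_integral Rintegral_on_interval; congr (_ - _).
have ms := measurable_process_section w mphi.
by rewrite /Rintegral (integral_counting T0 (cN w) ms).
Qed.

End slots.

(** * Limits and finite sums of integrals *)

Section limits.
Context d (T : measurableType d) {R : realType} (P : {measure set T -> \bar R}).
Local Open Scope ereal_scope.

Lemma limn_einf_le (u : (\bar R)^nat) M : (forall n, u n <= M) -> limn_einf u <= M.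
Proof.
move=> uM; rewrite limn_einf_lim; apply: lime_le; first exact: is_cvg_einfs.
apply: nearW => n; apply: le_trans (uM n).
by apply: ereal_inf_lbound; exists n => /=.
Qed.

Lemma fatou_sqr (X_ : (T -> R)^nat) (X : T -> R) M :
  (forall k, measurable_fun setT (X_ k)) -> measurable_fun setT X ->
  {ae P, forall w, X_ k w @[k --> \oo] --> X w} ->
  (forall k, \int[P]_w (X_ k w ^+ 2)%:E <= M) ->
  \int[P]_w (X w ^+ 2)%:E <= M.
Proof.
move=> mX_ mX X_X XM.
have msq (Y : T -> R) : measurable_fun setT Y ->
    measurable_fun setT (fun w => (Y w ^+ 2)%:E).
  by move=> mY; apply/measurable_EFinP; exact: measurable_funX.
have sq0 (Y : T -> R) w : 0 <= (Y w ^+ 2)%:E by rewrite lee_fin sqr_ge0.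
apply: le_trans (limn_einf_le XM).
apply: le_trans; last first.
  exact: (@fatou _ _ _ P setT measurableT (fun k w => (X_ k w ^+ 2)%:E)
    (fun k => msq _ (mX_ k)) (fun k w _ => sq0 _ w)).
rewrite (ge0_ae_eq_integral (g := fun w => limn_einf (fun k => (X_ k w ^+ 2)%:E)))//.
- exact: msq.
- rewrite (_ : (fun w => _) =
      (fun w => - limn_esup (fun k => - (X_ k w ^+ 2)%:E))).
    apply: measurableT_comp => //; apply: measurable_fun_limn_esup => k.
    by apply: measurableT_comp => //; exact: msq.
  by apply/funext => w; rewrite -limn_einfN; congr limn_einf; apply/funext => k /=;
    rewrite -?EFinN ?opprK ?oppeK.
- by move=> w _; rewrite limn_einf_lim; apply: lime_ge; [exact: is_cvg_einfs|
    apply: nearW => n; apply: le_ereal_inf_tmp => _ [k _ <-]].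
- apply: filterS X_X => w Xw _; apply/esym.
  have : (X_ k w ^+ 2)%:E @[k --> \oo] --> (X w ^+ 2)%:E.
    apply: cvg_EFin; first exact: nearW.
    by rewrite expr2; under eq_fun do rewrite /= expr2; exact: cvgM.
  by move=> /cvg_limn_einf_sup[->].
Qed.

End limits.

Section finite_sums.
Context d (T : measurableType d) {R : realType} (mu : {measure set T -> \bar R}).

Lemma integral_sumEFin I (s : seq I) (f : I -> T -> R) :
  (forall i, mu.-integrable setT (EFin \o f i)) ->
  (\int[mu]_x (\sum_(i <- s) f i x)%:E = \sum_(i <- s) \int[mu]_x (f i x)%:E)%E.
Proof.
move=> fi; rewrite -(integral_sum measurableT (f := fun i => EFin \o f i))//.
by apply: eq_integral => x _; rewrite sumEFin.
Qed.

Lemma RintegralT_sum I (s : seq I) (f : I -> T -> R) :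
  (forall i, mu.-integrable setT (EFin \o f i)) ->
  \int[mu]_x (\sum_(i <- s) f i x) = \sum_(i <- s) \int[mu]_x f i x.
Proof.
move=> fi; rewrite /Rintegral integral_sumEFin//.
have fE i : (\int[mu]_x (f i x)%:E = (fine (\int[mu]_x (f i x)%:E))%:E)%E.
  by rewrite fineK//; exact: integrable_fin_num (fi i).
by under eq_bigr do rewrite fE; rewrite sumEFin.
Qed.

End finite_sums.

(** * Passage to the limit in an orthogonality relation *)

Section product_limit.
Context d (Omega : measurableType d) {R : realType} (P : probability Omega R).
Local Open Scope ereal_scope.

(* AM-GM: [2 |f g| <= c f^2 + g^2 / c] *)
Lemma expectation_mul_le (f g : Omega -> R) (c : R) : (0 < c)%R ->
  f \in Lfun P 2%:E -> g \in Lfun P 2%:E ->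
  2%:E * `|'E_P[(f \* g)%R]| <=
  c%:E * \int[P]_w (f w ^+ 2)%:E + c^-1%:E * \int[P]_w (g w ^+ 2)%:E.
Proof.
move=> c0 Lf Lg.
have mL h : h \in Lfun P 2%:E -> measurable_fun setT h.
  by move=> /sub_Lfun_mfun; rewrite inE.
have mf := mL _ Lf; have mg := mL _ Lg.
have msq (h : Omega -> R) : measurable_fun setT h ->
    measurable_fun setT (fun w => (h w ^+ 2)%:E).
  by move=> mh; apply/measurable_EFinP; exact: measurable_funX.
have mfg : measurable_fun setT (fun w => (f w * g w)%:E).
  by apply/measurable_EFinP; exact: measurable_funM.
have sq0 (h : Omega -> R) w : 0 <= (h w ^+ 2)%:E by rewrite lee_fin sqr_ge0.
have ci0 : (0 <= c^-1)%R by rewrite invr_ge0 ltW.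
rewrite -ge0_integralZl ?lee_fin ?(ltW c0)//; last exact: msq.
rewrite -ge0_integralZl ?lee_fin//; last exact: msq.
rewrite -ge0_integralD//; first last.
- by apply: emeasurable_funM => //; exact: msq.
- by move=> w _; rewrite mule_ge0.
- by apply: emeasurable_funM => //; exact: msq.
- by move=> w _; rewrite mule_ge0// lee_fin ltW.
apply: (@le_trans _ _ (2%:E * \int[P]_w `|(f w * g w)%:E|)).
  apply: lee_wpmul2l; first by rewrite lee_fin.
  by rewrite unlock; exact: le_abse_integral.
rewrite -ge0_integralZl ?lee_fin//; last exact: measurableT_comp.
apply: ge0_le_integral => //.
- by apply: emeasurable_funM => //; exact: measurableT_comp.
- apply: emeasurable_funD; apply: emeasurable_funM => //; exact: msq.
move=> w _; rewrite -!EFinM -EFinD lee_fin normrM.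
set a := `|f w|%R; set b := `|g w|%R.
have -> : (f w ^+ 2 = a ^+ 2)%R by rewrite real_normK// num_real.
have -> : (g w ^+ 2 = b ^+ 2)%R by rewrite real_normK// num_real.
have := sqr_ge0 (c * a - b); rewrite -(pmulr_rge0 _ (x := c^-1)) ?invr_gt0//.
rewrite (_ : c^-1 * _ = c * a ^+ 2 + c^-1 * b ^+ 2 - 2 * (a * b))%R ?subr_ge0//.
by field; rewrite gt_eqF.
Qed.

(** Based on [x y = (x - xk) y + (y - yk) xk + xk yk], whose last term has expectation 0. In the
    weighted AM-GM inequality the small factors get weight [c] and the bounded ones [1 / c]; for
    fixed [c] the former vanish as [k] grows, and then [c] is taken large. *)
Lemma expectation_product_limit0 (x y : Omega -> R) (xk yk : (Omega -> R)^nat)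
    (a b : (\bar R)^nat) (M : R) :
  x \in Lfun P 2%:E -> y \in Lfun P 2%:E ->
  (forall k, xk k \in Lfun P 2%:E) -> (forall k, yk k \in Lfun P 2%:E) ->
  (forall k, 'E_P[(xk k \* yk k)%R] = 0) ->
  \int[P]_w (y w ^+ 2)%:E <= M%:E ->
  (forall k, \int[P]_w (xk k w ^+ 2)%:E <= M%:E) ->
  (forall k, \int[P]_w ((x w - xk k w) ^+ 2)%:E <= a k) ->
  (forall k, \int[P]_w ((y w - yk k w) ^+ 2)%:E <= b k) ->
  a @ \oo --> 0 -> b @ \oo --> 0 ->
  'E_P[(x \* y)%R] = 0.
Proof.
move=> Lx Ly Lxk Lyk xy0 yM xkM xa yb a0 b0.
have L21 : 1 <= 2%:E :> \bar R by rewrite lee_fin ler1n.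
have M0 : (0 <= M)%R.
  by rewrite -lee_fin; apply: le_trans yM; apply: integral_ge0 => w _; rewrite lee_fin sqr_ge0.
have LB f g : f \in Lfun P 2%:E -> g \in Lfun P 2%:E -> (f \- g)%R \in Lfun P 2%:E.
  by move=> Lf Lg; apply: rpredB.
have key (c : R) : (0 < c)%R -> 2%:E * `|'E_P[(x \* y)%R]| <= (c^-1 * (2 * M))%:E.
  move=> c0; have step k : 2%:E * `|'E_P[(x \* y)%R]| <=
      c%:E * a k + c%:E * b k + (c^-1 * (2 * M))%:E.
    have Ldx := LB _ _ Lx (Lxk k); have Ldy := LB _ _ Ly (Lyk k).
    have E : 'E_P[(x \* y)%R] = 'E_P[((x \- xk k) \* y)%R] + 'E_P[((y \- yk k) \* xk k)%R].
      have -> : (x \* y)%R = (((x \- xk k) \* y \+ (y \- yk k) \* xk k) \+ xk k \* yk k)%R.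
        by apply/funext => w /=; ring.
      rewrite expectationD; [|apply: rpredD; exact: Lfun2_mul_Lfun1|exact: Lfun2_mul_Lfun1].
      rewrite expectationD; [|exact: Lfun2_mul_Lfun1|exact: Lfun2_mul_Lfun1].
      by rewrite xy0 adde0.
    rewrite E; apply: (@le_trans _ _ (2%:E *
      (`|'E_P[((x \- xk k) \* y)%R]| + `|'E_P[((y \- yk k) \* xk k)%R]|))).
      by apply: lee_wpmul2l; [rewrite lee_fin|exact: lee_abs_add].
    rewrite ge0_muleDr//.
    have A1 := expectation_mul_le c0 Ldx Ly.
    have A2 := expectation_mul_le c0 Ldy (Lxk k).
    apply: (le_trans (leeD A1 A2)).
    rewrite (_ : (c^-1 * (2 * M))%:E = c^-1%:E * M%:E + c^-1%:E * M%:E); last first.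
      by rewrite -!EFinM -EFinD; congr EFin; ring.
    have c1 : 0 <= c%:E by rewrite lee_fin ltW.
    have c2 : 0 <= c^-1%:E by rewrite lee_fin invr_ge0 ltW.
    rewrite addeACA; apply: leeD; apply: leeD; apply: lee_wpmul2l => //.
    - exact: xa.
    - exact: yb.
  have C : (c%:E * a k + c%:E * b k + (c^-1 * (2 * M))%:E) @[k --> \oo] -->
      c%:E * 0 + c%:E * 0 + (c^-1 * (2 * M))%:E.
    apply: cvgeD => //; last exact: cvg_cst.
    by apply: cvgeD; [rewrite !mule0|exact: cvgeZl|exact: cvgeZl].
  rewrite !mule0 !add0e in C.
  have : 2%:E * `|'E_P[(x \* y)%R]| <=
      limn (fun k => c%:E * a k + c%:E * b k + (c^-1 * (2 * M))%:E).
    by apply: lime_ge; [exact: cvgP C|exact: nearW].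
  by rewrite (cvg_lim _ C).
have fE : 'E_P[(x \* y)%R] \is a fin_num.
  by apply: expectation_fin_num; exact: Lfun2_mul_Lfun1.
rewrite -(fineK fE); congr EFin; apply/eqP; rewrite -normr_le0 leNgt; apply/negP.
set e := fine _ => e0.
(* With this weight the bound reads [2 |e| <= 2 |e| M / (M + 1)], which is absurd for [e] different
   from 0. *)
have := key ((M + 1) / `|e|)%R; rewrite -(fineK fE) -/e -EFinM lee_fin.
rewrite divr_gt0// ?ltr_wpDl// => /(_ isT).
apply/negP; rewrite -ltNge invf_div mulrAC ltr_pdivrMr ?ltr_wpDl//.
by nra.
Qed.

End product_limit.

(** * Counting processes as sums of single jumps *)

Section jump_process.
Context {R : realType} {d : measure_display} {Omega : measurableType d}.
Variables (P : probability Omega R) (T : R) (G : R -> set (set Omega)).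
Hypothesis T0 : 0 < T.
Hypothesis hG : filtration T G.

Local Notation mu := (@lebesgue_measure R).
Local Notation pt := (ptype T G).
Implicit Types phi psi : R -> Omega -> R.

(** The compensation property of [lam] enters only jump by jump, through [jp_jump]. The pathwise
    integrability [jp_int] is what makes integrals against [lam] finite for square integrable
    integrands. *)
Record jump_process (N : R -> Omega -> nat) (lam : R -> Omega -> R) : Prop :=
  JumpProcess {
  jp_path : forall w, counting_path T (N^~ w) ;
  jp_adapted : forall t k, 0 <= t <= T -> G t [set w | N t w = k] ;
  jp_mlam : measurable_process T lam ;
  jp_lam0 : forall t w, 0 <= t <= T -> 0 <= lam t w ;
  jp_int : {ae P, forall w,
    (\int[mu]_(t in `[0%R, T]) (lam t w)%:E < +oo)%E} ;
  jp_jump : forall j, one_jump P T G (jump_of T N j.+1) (slot_intensity T N lam j) }.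

Definition pintegrable (lam phi : R -> Omega -> R) w :=
  mu.-integrable setT
    (fun t => (on_interval T phi (t, w) * on_interval T lam (t, w))%:E).

Definition sqr_int (lam phi : R -> Omega -> R) : \bar R :=
  (\int[P]_w \int[mu]_t
     ((on_interval T phi (t, w)) ^+ 2 * on_interval T lam (t, w))%:E)%E.

Lemma predictable_process phi : predictable T G phi -> measurable_process T phi.
Proof.
move=> /(predictableP T0 hG) mphi.
exact: (ptype_measurable_fun T0 hG (measurable_dom T0 hG) mphi).
Qed.

Lemma predictableB (phi psi : R -> Omega -> R) : predictable T G phi -> predictable T G psi ->
  predictable T G (fun t w => phi t w - psi t w).
Proof.
move=> /(predictableP T0 hG) mphi /(predictableP T0 hG) mpsi.
apply/(predictableP T0 hG); exact: measurable_funB.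
Qed.

Section one_process.
Variables (N : R -> Omega -> nat) (lam : R -> Omega -> R).
Hypothesis JP : jump_process N lam.
Local Notation tau := (jump_of T N).
Local Notation integral_of := (compensated_integral T N lam).

Let cN := jp_path JP.

Let lam0 p : 0 <= on_interval T lam p.
Proof. by rewrite /on_interval; case: ifP => // pT; exact: jp_lam0 JP _ _ pT. Qed.

Let mlam : measurable_fun setT (on_interval T lam).
Proof. exact: measurable_on_interval (jp_mlam JP). Qed.

Lemma compensated_integralB phi psi : measurable_process T phi ->
  measurable_process T psi ->
  {ae P, forall w, pintegrable lam phi w} -> {ae P, forall w, pintegrable lam psi w} ->
  {ae P, forall w, integral_of (fun t w => phi t w - psi t w) w =
    integral_of phi w - integral_of psi w}.
Proof.
move=> mphi mpsi iphi ipsi; apply: filterS2 iphi ipsi => w iw jw.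
rewrite !(compensated_integralE _ T0 cN)//; last exact: measurable_funB.
have -> : \int[mu]_t (on_interval T (fun t w => phi t w - psi t w) (t, w) *
    on_interval T lam (t, w)) =
  \int[mu]_t (on_interval T phi (t, w) * on_interval T lam (t, w)) -
  \int[mu]_t (on_interval T psi (t, w) * on_interval T lam (t, w)).
  rewrite -RintegralB//; apply: eq_Rintegral => t _; rewrite /on_interval/=.
  by case: ifP => _; ring.
by rewrite sumrB; ring.
Qed.

Lemma measurable_at_jump_process j phi : measurable_process T phi ->
  measurable_fun setT (fun w => if tau j w <= T then phi (tau j w) w else 0).
Proof.
move=> mphi; have mt := measurable_jump_of T0 cN hG (jp_adapted JP) j.
have m1 := measurable_on_interval mphi.
rewrite (_ : (fun w => _) = on_interval T phi \o (fun w => (tau j w, w))).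
  by apply: measurableT_comp => //; exact: measurable_fun_pair.
apply/funext => w; rewrite /on_interval/= jump_of_ge0//.
Qed.

(** Stated for jointly measurable [phi], since it also serves the integrands of the theorem that are
    not predictable. The sum over a random number of jumps is the pointwise limit of sums with a
    fixed number of terms. *)
Lemma measurable_compensated_integral phi : measurable_process T phi ->
  measurable_fun setT (integral_of phi).
Proof.
move=> mphi.
have -> : integral_of phi = (fun w => \sum_(j < N T w) phi (tau j.+1 w) w) \-
    (fun w => \int[mu]_t (on_interval T phi (t, w) * on_interval T lam (t, w))).
  by apply/funext => w; rewrite (compensated_integralE _ T0 cN).
apply: measurable_funB; last first.
  apply: (measurable_fun_Rintegral (f := fun p => on_interval T phi p * on_interval T lam p)).
  apply: measurable_funM => //; exact: measurable_on_interval.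
apply: (@measurable_fun_cvg _ _ _ _ (fun k w => \sum_(j < k)
    (if tau j.+1 w <= T then phi (tau j.+1 w) w else 0))).
  move=> k; apply: measurable_sum => j; exact: measurable_at_jump_process.
move=> w _; apply: cvg_near_cst; near=> k.
have Nk : (N T w <= k)%N by near: k; exact: nbhs_infty_ge.
rewrite (@sum_jumps _ (fun j => phi (tau j.+1 w) w) (N T w) k); last first.
  by move=> j /andP[kj jN]; have := leq_trans Nk kj; rewrite leqNgt jN.
by apply: eq_bigr => j _; rewrite jump_of_leT.
Unshelve. all: end_near. Qed.

(* Boundedness and the restriction to at most [k] jumps make all terms of the
   product formula finite. *)
Definition truncation (k : nat) (phi : R -> Omega -> R) t w : R :=
  if (0 <= t <= T) && (`|phi t w| <= k%:R) && (t <= tau k w) then phi t w else 0.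

Lemma bounded_truncation k phi : predictable T G phi ->
  bounded_predictable T G (fun p => truncation k phi p.1 p.2).
Proof.
move=> /(predictableP T0 hG) mphi; split; last first.
  exists k%:R => p; rewrite /truncation; case: ifP => [/andP[/andP[]]//|_].
  by rewrite normr0.
pose S := ((`[0, T] `*` setT) `&` (fun p => phi p.1 p.2) @^-1` [set x | `|x| <= k%:R]) `&`
   [set p | 0 <= p.1 <= T /\ p.1 <= tau k p.2].
have mD := measurable_dom T0 hG.
have mS : measurable (S : set pt).
  have mU := measurable_upto_jump T0 cN hG (jp_adapted JP) k.
  apply: measurableI mU; apply: mphi => //.
  rewrite -[X in measurable X]setTI.
  exact: (measurable_fun_ler (f := fun x : R => `|x|) (g := cst k%:R) _ _ measurableT _).
have mr := (@measurable_restrictT _ _ pt _ S (fun p => phi p.1 p.2) mS).1.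
rewrite (_ : (fun p => _) = (fun p => phi p.1 p.2) \_ S); last first.
  apply/funext => -[t w]; rewrite patchE /truncation /=.
  case: ifPn => [/andP[/andP[tT pk] tt]|H].
    by rewrite mem_set//; split => //; split => //=; split => //=; rewrite in_itv.
  rewrite memNset// => -[[[/= tT _] pk] [_ tt]]; move: H.
  by rewrite in_itv/= in tT; rewrite tT pk tt.
by apply: mr; apply: (@measurable_funS _ _ pt) mphi => // p [[]].
Qed.

Lemma on_interval_truncation k phi :
  on_interval T (truncation k phi) = (fun p => truncation k phi p.1 p.2).
Proof.
by apply/funext => p; rewrite /on_interval /truncation; case: (0 <= p.1 <= T).
Qed.

Lemma predictable_truncation k phi : predictable T G phi ->
  predictable T G (truncation k phi).
Proof.
move=> /(bounded_truncation k)[mt _]; apply/(predictableP T0 hG).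
exact: (@measurable_funTS _ _ pt).
Qed.

Let slot_on k phi w t : t != 0 ->
  on_interval T (truncation k phi) (t, w) * on_interval T lam (t, w) =
  \sum_(j < k) truncation k phi t w * slot_intensity T N lam j (t, w).
Proof.
move=> t0; rewrite -mulr_sumr sum_slot_intensity// on_interval_truncation /=.
rewrite /truncation /on_interval/=.
case: (boolP (0 <= t <= T)) => [/andP[tge tT]|] /=; last by rewrite !mul0r.
rewrite lt_neqAle eq_sym t0 tge tT/=.
by case: (t <= tau k w); rewrite ?andbT ?andbF ?mul0r.
Qed.

(** The truncated integrand vanishes after [tau_k], so only the first [k] jumps and slots are
    seen. *)
Lemma compensated_integral_truncation k phi : predictable T G phi ->
  {ae P, forall w, integral_of (truncation k phi) w =
    \sum_(j < k) jump_int T (tau j.+1) (slot_intensity T N lam j)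
      (fun p => truncation k phi p.1 p.2) w}.
Proof.
move=> pphi; have bt := bounded_truncation k pphi.
have mt := predictable_process (predictable_truncation k pphi).
have : {ae P, forall w, forall j, mu.-integrable setT
    (fun t => (truncation k phi t w * slot_intensity T N lam j (t, w))%:E)}.
  apply: ae_foralln => j; have ti := time_int_integrable T0 hG (jp_jump JP j) bt.
  exact: ti.
apply: filterS => w iw; rewrite (compensated_integralE _ T0 cN)//.
rewrite /jump_int sumrB; congr (_ - _).
  rewrite (@sum_jumps _ (fun j => truncation k phi (tau j.+1 w) w) (N T w) k).
    by apply: eq_bigr => j _; rewrite /at_jumpr jump_of_leT.
  move=> j /andP[kj jN]; rewrite /truncation [X in _ && X](_ : _ = false) ?andbF//.
  (* For [j >= k], jump [j.+1] comes strictly after [tau_k], where the truncation is zero. *)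
  apply/negbTE; rewrite -ltNge; apply: jump_time_lt => //.
  by have := jump_of_leT T0 cN j.+1 w; rewrite jN.
transitivity (\int[mu]_t \sum_(j < k) truncation k phi t w * slot_intensity T N lam j (t, w)).
  have msec (f : R * Omega -> R) : measurable_fun setT f ->
      measurable_fun setT (fun t : measurableTypeR R => (f (t, w))%:E).
    move=> mf; apply/measurable_EFinP.
    have m1 := measurable_fun_pair1 w mf; exact m1.
  rewrite /Rintegral; congr fine; apply: ae_eq_integral => //.
  - apply: (msec (fun p => on_interval T (truncation k phi) p * on_interval T lam p)).
    by apply: measurable_funM => //; exact: measurable_on_interval.
  - under eq_fun do rewrite -sumEFin.
    apply: emeasurable_sum => j; exact: measurable_int (iw j).
  (* Time 0 lies in no slot and is discarded as a null set. *)
  - exists [set 0]; split => //; first exact: lebesgue_measure_set1.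
    move=> t /= H; apply: contrapT => /eqP t0; apply: H => _.
    by rewrite slot_on.
have RS := @RintegralT_sum _ _ _ mu _ (index_enum 'I_k)
  (fun (j : 'I_k) (t : measurableTypeR R) =>
    truncation k phi t w * slot_intensity T N lam j (t, w)) (fun j => iw j).
exact: RS.
Qed.

End one_process.

Lemma compensated_truncation_Lfun2 N lam k phi : jump_process N lam ->
  predictable T G phi ->
  compensated_integral T N lam (truncation N k phi) \in Lfun P 2%:E.
Proof.
move=> JP pphi; have bt := bounded_truncation JP k pphi.
have mt := predictable_process (predictable_truncation JP k pphi).
pose J (j : 'I_k) := jump_int T (jump_of T N j.+1) (slot_intensity T N lam j)
  (fun p => truncation N k phi p.1 p.2).
apply: (@Lfun2_ae _ _ _ P _ (\sum_(j < k) J j)).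
- have mI := measurable_compensated_integral JP mt; exact: mI.
- apply: filterS (compensated_integral_truncation JP k pphi) => w -> _.
  by rewrite fct_sumE.
apply: rpred_sum => [|h j _]; first by rewrite lee_fin ler1n.
have L := jump_int_Lfun2 T0 hG (jp_jump JP j) bt; exact: L.
Qed.

Lemma truncation_product N lam N' lam' k phi psi :
  jump_process N lam -> jump_process N' lam' ->
  predictable T G phi -> predictable T G psi ->
  ('E_P[compensated_integral T N lam (truncation N k phi) \*
        compensated_integral T N' lam' (truncation N' k psi)] =
   \sum_(i < k) \sum_(j < k) 'E_P[common_jump T (jump_of T N i.+1) (jump_of T N' j.+1)
     (fun p => truncation N k phi p.1 p.2) (fun p => truncation N' k psi p.1 p.2)])%E.
Proof.
move=> JP JP' pphi ppsi.
have bt := bounded_truncation JP k pphi; have bt' := bounded_truncation JP' k ppsi.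
have mt := predictable_process (predictable_truncation JP k pphi).
have mt' := predictable_process (predictable_truncation JP' k ppsi).
pose J (j : 'I_k) := jump_int T (jump_of T N j.+1) (slot_intensity T N lam j)
  (fun p => truncation N k phi p.1 p.2).
pose J' (j : 'I_k) := jump_int T (jump_of T N' j.+1) (slot_intensity T N' lam' j)
  (fun p => truncation N' k psi p.1 p.2).
have LJ j : J j \in Lfun P 2%:E.
  have L := jump_int_Lfun2 T0 hG (jp_jump JP j) bt; exact: L.
have LJ' j : J' j \in Lfun P 2%:E.
  have L := jump_int_Lfun2 T0 hG (jp_jump JP' j) bt'; exact: L.
pose S w := \sum_(p : 'I_k * 'I_k) J p.1 w * J' p.2 w.
have I1 p : P.-integrable setT (EFin \o (fun w => J p.1 w * J' p.2 w)).
  apply/Lfun1_integrable; have L := Lfun2_mul_Lfun1 (LJ p.1) (LJ' p.2); exact: L.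
transitivity ('E_P[S])%E.
  apply: expectation_ae.
  - apply: measurable_funM.
      have mI := measurable_compensated_integral JP mt; exact: mI.
    have mI := measurable_compensated_integral JP' mt'; exact: mI.
  - apply: measurable_sum => p; have := measurable_int _ (I1 p).
    by move=> /measurable_EFinP.
  - apply: filterS2 (compensated_integral_truncation JP k pphi)
      (compensated_integral_truncation JP' k ppsi) => w /= -> ->.
    by rewrite big_distrlr/= pair_bigA.
rewrite unlock (integral_sumEFin _ I1) pair_bigA/=; apply: eq_bigr => -[i j] _ /=.
have JJ := jump_int_product T0 hG (jp_jump JP i) (jp_jump JP' j) bt bt'.
by move: JJ; rewrite unlock.
Qed.

Section isometry.
Variables (N : R -> Omega -> nat) (lam : R -> Omega -> R).
Hypothesis JP : jump_process N lam.
Variable phi : R -> Omega -> R.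
Hypothesis pphi : predictable T G phi.
Hypothesis sphi : (sqr_int lam phi < +oo)%E.
Local Notation tau := (jump_of T N).
Local Notation integral_of := (compensated_integral T N lam).

Let sq p : R := on_interval T phi p ^+ 2 * on_interval T lam p.

Let sq0 p : 0 <= sq p.
Proof.
rewrite mulr_ge0 ?sqr_ge0// /on_interval; case: ifP => // pT.
exact: jp_lam0 JP _ _ pT.
Qed.

Let msq : measurable_fun setT sq.
Proof.
have mphi := measurable_on_interval (predictable_process pphi).
have mlam := measurable_on_interval (jp_mlam JP).
by apply: measurable_funM => //; exact: measurable_funX.
Qed.

Let mEsq : measurable_fun setT (fun p : measurableTypeR R * Omega => (sq p)%:E).
Proof. by apply/measurable_EFinP; exact msq. Qed.

Let msq_int : measurable_fun setT (fun w => \int[mu]_t (sq (t, w))%:E)%E.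
Proof.
have sqE0 (p : measurableTypeR R * Omega) : (0 <= (sq p)%:E)%E by rewrite lee_fin.
have m := @measurable_fun_fubini_tonelli_G _ _ _ _ _ mu _ mEsq sqE0.
exact m.
Qed.

(** In the double sum of common jumps the terms [i <> j] vanish, because jumps of one process occur
    at distinct times. A diagonal term is the expected jump of the squared integrand, hence its
    integral against slot [i], and the slots add up to at most [lam]. *)
Lemma truncation_sqr k :
  (\int[P]_w (integral_of (truncation N k phi) w ^+ 2)%:E <= sqr_int lam phi)%E.
Proof.
have cN := jp_path JP; have bt := bounded_truncation JP k pphi.
pose g p := truncation N k phi p.1 p.2.
pose g2 p := g p ^+ 2.
have g20 p : 0 <= g2 p by rewrite sqr_ge0.
have bg2 : bounded_predictable T G g2.
  have [mg [K gK]] := bt; split; first exact: measurable_funX.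
  exists (K ^+ 2) => p; rewrite ger0_norm// /g2 -real_normK ?num_real//.
  by rewrite lerXn2r// ?nnegrE ?(le_trans _ (gK p))// gK.
have mg2 : @measurable_fun _ _ pt _ setT (EFin \o g2).
  by apply/measurable_EFinP; case: bg2.
pose sl j := slot_intensity T N lam j.
have -> : (\int[P]_w (integral_of (truncation N k phi) w ^+ 2)%:E =
    \sum_(i < k) \int[P]_w time_int (sl i) (EFin \o g2) w)%E.
  have := truncation_product k JP JP pphi pphi; rewrite unlock => E.
  transitivity (\int[P]_w (compensated_integral T N lam (truncation N k phi) w *
      compensated_integral T N lam (truncation N k phi) w)%:E)%E.
    by apply: eq_integral => w _; rewrite expr2.
  rewrite E; apply: eq_bigr => i _; rewrite (bigD1 i)//= big1 => [|j ji].
    rewrite adde0.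
    have <- := oj_comp (jp_jump JP i) mg2 (fun p => g20 p).
    apply: eq_integral => w _; rewrite /common_jump eqxx /at_jumpr.
    by case: ifP; rewrite ?mul0r// /g2 expr2.
  rewrite integral0_eq// => w _; rewrite /common_jump; case: eqP => // ij.
  rewrite /at_jumpr ij; case: ifP => jT; rewrite ?mul0r//.
  have [lij|lji|eij] := ltngtP i j.
  - have /(jump_time_lt T0 (cN w)) : (i.+1 < j.+1)%N by [].
    by move=> /(_ jT); rewrite -/(tau _ _) -/(tau _ _) ij ltxx.
  - have /(jump_time_lt T0 (cN w)) : (j.+1 < i.+1)%N by [].
    by rewrite -/(tau _ _) -/(tau _ _) ij => /(_ jT); rewrite ltxx.
  - by move: ji; rewrite -val_eqE/= eij eqxx.
have sl0 j p : 0 <= sl j p := oj_l0 (jp_jump JP j) p.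
have mti j := measurable_time_int T0 hG (jp_jump JP j) bg2 g20.
have ti0 j := time_int_ge0 (jp_jump JP j) g20.
rewrite -(ge0_integral_sum P measurableT
  (f := fun (i : 'I_k) w => time_int (sl i) (EFin \o g2) w)); last 2 first.
- by move=> i; exact: mti.
- by move=> i w _; exact: ti0.
apply: ge0_le_integral => //.
- by move=> w _; apply: sume_ge0 => i _; exact: ti0.
- by apply: emeasurable_sum => i; exact: mti.
move=> w _; rewrite /time_int.
have mti' (i : 'I_k) : measurable_fun setT
    (fun t : measurableTypeR R => ((EFin \o g2) (t, w) * (sl i (t, w))%:E)%E).
  have m2 : measurable_fun setT (fun p : measurableTypeR R * Omega => (g2 p * sl i p)%:E).
    apply/measurable_EFinP; have m := predictable_prod_measurable T0 hG (jp_jump JP i) bg2.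
    exact m.
  have m1 := measurable_fun_pair1 w m2; exact m1.
rewrite -(ge0_integral_sum mu measurableT (f := fun (i : 'I_k) (t : measurableTypeR R) =>
  ((EFin \o g2) (t, w) * (sl i (t, w))%:E)%E))//; last first.
  by move=> i t _; rewrite mule_ge0// lee_fin.
apply: ge0_le_integral => //.
- by move=> t _; apply: sume_ge0 => i _; rewrite mule_ge0// lee_fin.
- exact: emeasurable_sum.
- have m1 := measurable_fun_pair1 w mEsq; exact m1.
move=> t _; rewrite [X in (X <= _)%E](_ : _ = (\sum_(i < k) g2 (t, w) * sl i (t, w))%:E); last first.
  by rewrite -sumEFin; apply: eq_bigr => i _; rewrite EFinM.
rewrite lee_fin -mulr_sumr sum_slot_intensity//= /g2 /g /truncation /on_interval/=.
have [/andP[tge tT]|] := boolP (0 <= t <= T); last by rewrite /= expr0n/= mul0r mulr0.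
have l0 : 0 <= lam t w by apply: (jp_lam0 JP); rewrite tge.
case: ifPn => /= _; last by rewrite expr0n/= mul0r mulr_ge0// sqr_ge0.
by case: ifP => // _; rewrite mulr0 mulr_ge0// sqr_ge0.
Qed.

Let on_lam0 p : 0 <= on_interval T lam p.
Proof. by rewrite /on_interval; case: ifP => // pT; exact: jp_lam0 JP _ _ pT. Qed.

(** From [|phi| lam <= lam + phi^2 lam], where both terms on the right are integrable along almost
    every path. *)
Lemma pintegrable_sqr_int : {ae P, forall w, pintegrable lam phi w}.
Proof.
have sqi : P.-integrable setT (fun w => \int[mu]_t (sq (t, w))%:E)%E.
  apply/integrableP; split => //.
  have i0 w : (0 <= \int[mu]_t (sq (t, w))%:E)%E.
    by apply: integral_ge0 => t _; rewrite lee_fin.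
  by under eq_integral do rewrite gee0_abs//.
have := integrable_ae measurableT sqi; apply: filterS2 (jp_int JP) => w lw /(_ I) sw.
have mf : measurable_fun setT (fun p => on_interval T phi p * on_interval T lam p).
  apply: measurable_funM; apply: measurable_on_interval; last exact: jp_mlam JP.
  exact: predictable_process.
have mlam : measurable_fun setT (on_interval T lam) := measurable_on_interval (jp_mlam JP).
have mEf : measurable_fun setT (fun t : measurableTypeR R =>
    (on_interval T phi (t, w) * on_interval T lam (t, w))%:E).
  by apply/measurable_EFinP; have m := measurable_fun_pair1 w mf; exact m.
have mEl : measurable_fun setT (fun t : measurableTypeR R => (on_interval T lam (t, w))%:E).
  by apply/measurable_EFinP; have m := measurable_fun_pair1 w mlam; exact m.
have mEs : measurable_fun setT (fun t : measurableTypeR R => (sq (t, w))%:E).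
  by have m := measurable_fun_pair1 w mEsq; exact m.
apply/integrableP; split => //.
apply: (@le_lt_trans _ _ (\int[mu]_t ((on_interval T lam (t, w))%:E + (sq (t, w))%:E))%E).
  apply: ge0_le_integral => //.
  - exact: measurableT_comp.
  - exact: emeasurable_funD.
  - move=> t _; rewrite -EFinD lee_fin normrM (ger0_norm (on_lam0 _)) /sq.
    rewrite -[X in _ <= X + _]mul1r -mulrDl; apply: ler_wpM2r => //.
    set x := on_interval T phi (t, w); rewrite -real_normK ?num_real//.
    by nra.
rewrite ge0_integralD//; last 2 first.
- by move=> t _; rewrite lee_fin.
- by move=> t _; rewrite lee_fin.
apply: lte_add_pinfty; last by move: sw; rewrite fin_numElt => /andP[].
rewrite (_ : \int[mu]_t _ = \int[mu]_(t in `[0%R, T]) (lam t w)%:E)%E//.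
rewrite [RHS]integral_mkcond; apply: eq_integral => t _; rewrite patchE /on_interval/=.
case: ifPn => tT; first by rewrite mem_set//= in_itv.
by rewrite memNset//= in_itv/=; exact/negP.
Qed.

(** Each of the two cut-offs is eventually inactive: [tau_k > T] as soon as [k] exceeds the number
    of jumps, and [k] eventually exceeds the value of [|phi|]. *)
Lemma truncation_near w t : exists K : nat, forall k, (K <= k)%N ->
  on_interval T (truncation N k phi) (t, w) = on_interval T phi (t, w).
Proof.
exists (maxn (N T w).+1 (Num.truncn `|phi t w|).+1) => k.
rewrite geq_max => /andP[Nk phik]; rewrite /on_interval/= /truncation.
case: ifPn => // /andP[t0 tT].
rewrite t0 tT/= (le_trans (ltW (truncnS_gt _)))/= ?ler_nat//.
rewrite (le_trans tT)//; apply/ltW; rewrite ltNge (jump_of_leT T0 (jp_path JP)).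
by rewrite -ltnNge.
Qed.

(** Along a path the finite sum over jumps is eventually constant, and the time integral converges
    by domination with [|phi| lam]. *)
Lemma truncation_cvg : {ae P, forall w,
  integral_of (truncation N k phi) w @[k --> \oo] --> integral_of phi w}.
Proof.
have cN := jp_path JP.
apply: filterS pintegrable_sqr_int => w iw.
have mt k := predictable_process (predictable_truncation JP k pphi).
have mphi := predictable_process pphi.
rewrite (compensated_integralE _ T0 cN)//.
under eq_fun do rewrite (compensated_integralE _ T0 cN)//.
have tr_le k t : `|on_interval T (truncation N k phi) (t, w)| <= `|on_interval T phi (t, w)|.
  rewrite on_interval_truncation /truncation /on_interval/=.
  by case: (0 <= t <= T) => //=; case: ifP => //; rewrite normr0.
apply: cvgB.
  have : \forall k \near \oo, forall j : 'I_(N T w),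
      truncation N k phi (tau j.+1 w) w = phi (tau j.+1 w) w.
    apply: filter_forall => j; have [K HK] := truncation_near w (tau j.+1 w).
    exists K => // k /= /HK; rewrite /on_interval/= jump_of_ge0//=.
    by rewrite (jump_of_leT T0 cN) ltn_ord.
  move=> nk; apply: cvg_near_cst; apply: filterS nk => k Hk.
  by apply: eq_bigr => j _.
rewrite /Rintegral; apply: fine_cvg.
have fI := integrable_fin_num measurableT iw; rewrite fineK; last exact: fI.
have msec psi : measurable_process T psi -> measurable_fun setT (fun t : measurableTypeR R =>
    (on_interval T psi (t, w) * on_interval T lam (t, w))%:E).
  move=> mpsi; apply/measurable_EFinP.
  have m : measurable_fun setT (fun p => on_interval T psi p * on_interval T lam p).
    by apply: measurable_funM; apply: measurable_on_interval => //; exact: jp_mlam JP.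
  have m1 := measurable_fun_pair1 w m; exact m1.
apply: (@dominated_cvg _ _ _ mu setT measurableT
  (fun k (t : measurableTypeR R) => (on_interval T (truncation N k phi) (t, w) * on_interval T lam (t, w))%:E)
  _ (fun t => `|(on_interval T phi (t, w) * on_interval T lam (t, w))%:E|)%E) => //.
- by move=> k; exact: msec.
- move=> t _; apply: cvg_near_cst; have [K HK] := truncation_near w t.
  by exists K => // k /= /HK ->.
- exact: integrable_abse.
- by move=> k t _; rewrite lee_fin !normrM ler_wpM2r.
Qed.

Lemma compensated_integral_sqr :
  (\int[P]_w (integral_of phi w ^+ 2)%:E <= sqr_int lam phi)%E.
Proof.
have mI psi (mpsi : measurable_process T psi) := measurable_compensated_integral JP mpsi.
apply: fatou_sqr truncation_cvg truncation_sqr.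
  by move=> k; apply: mI; exact: predictable_process (predictable_truncation JP k pphi).
by apply: mI; exact: predictable_process.
Qed.

Lemma compensated_integral_Lfun2 : integral_of phi \in Lfun P 2%:E.
Proof.
apply: Lfun2P; last exact: le_lt_trans compensated_integral_sqr sphi.
have m := measurable_compensated_integral JP (predictable_process pphi); exact: m.
Qed.

Lemma sqr_int_prod psi : predictable T G psi ->
  sqr_int lam psi = (\int[mu \x P]_p (on_interval T psi p ^+ 2 * on_interval T lam p)%:E)%E.
Proof.
move=> ppsi.
pose f (p : measurableTypeR R * Omega) := (on_interval T psi p ^+ 2 * on_interval T lam p)%:E.
have mf : measurable_fun setT f.
  apply/measurable_EFinP.
  have m : measurable_fun setT (fun p => on_interval T psi p ^+ 2 * on_interval T lam p).
    apply: measurable_funM; last exact: measurable_on_interval (jp_mlam JP).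
    by apply: measurable_funX; apply: measurable_on_interval; exact: predictable_process.
  exact m.
have f0 p : (0 <= f p)%E by rewrite lee_fin mulr_ge0// sqr_ge0.
have F1 := @fubini_tonelli1 _ _ _ _ _ mu P f mf f0.
have F2 := @fubini_tonelli _ _ _ _ _ mu P f mf f0.
by rewrite /sqr_int -/f -F2 -F1.
Qed.

Definition remainder k t w : R := phi t w - truncation N k phi t w.

Lemma predictable_remainder k : predictable T G (remainder k).
Proof.
by have pt := predictable_truncation JP k pphi; exact: predictableB.
Qed.

Let rem_sq k p := on_interval T (remainder k) p ^+ 2 * on_interval T lam p.

Let rem_sq0 k p : 0 <= rem_sq k p.
Proof. exact: mulr_ge0 (sqr_ge0 _) (on_lam0 _). Qed.

Let mrem_sq k : measurable_fun setT (fun p : measurableTypeR R * Omega => (rem_sq k p)%:E).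
Proof.
apply/measurable_EFinP.
have m : measurable_fun setT (rem_sq k).
  apply: measurable_funM; last exact: measurable_on_interval (jp_mlam JP).
  apply: measurable_funX; apply: measurable_on_interval.
  exact: predictable_process (predictable_remainder k).
exact m.
Qed.

Let rem_sq_le k p : rem_sq k p <= sq p.
Proof.
rewrite /rem_sq /sq; apply: ler_wpM2r => //.
rewrite /on_interval /remainder/= /truncation.
case: (0 <= p.1 <= T) => //=; case: ifP => _; first by rewrite subrr expr0n/= sqr_ge0.
by rewrite subr0.
Qed.

Lemma sqr_int_remainder_le k : (sqr_int lam (remainder k) <= sqr_int lam phi)%E.
Proof.
rewrite !sqr_int_prod//; last exact: predictable_remainder.
apply: ge0_le_integral => //.
- by move=> p _; rewrite lee_fin; exact: rem_sq0.
- exact: mrem_sq.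
- by move=> p _; rewrite lee_fin; exact: rem_sq_le.
Qed.

(** The truncation equals [phi] or 0, so the squared remainder is dominated by [phi^2] and is
    eventually zero at each point; dominated convergence is applied on the product space. *)
Lemma sqr_int_remainder : sqr_int lam (remainder k) @[k --> \oo] --> 0%E.
Proof.
rewrite (_ : (fun k => _) = (fun k => \int[mu \x P]_p (rem_sq k p)%:E)%E); last first.
  by apply/funext => k; rewrite -sqr_int_prod//; exact: predictable_remainder.
have -> : 0%E = (\int[mu \x P]_p (cst 0%E p))%E by rewrite integral0.
apply: (@dominated_cvg _ _ _ (mu \x P)%E setT measurableT
  (fun k p => (rem_sq k p)%:E) _ (fun p => (sq p)%:E)) => //.
- move=> -[t w] _; apply: cvg_near_cst; have [K HK] := truncation_near w t.
  exists K => // k /= /HK; rewrite /rem_sq /on_interval/= /remainder.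
  by case: ifP => _ E; rewrite ?E ?subrr expr0n/= mul0r.
- apply/integrableP; split => //.
  under eq_integral do rewrite gee0_abs ?lee_fin//.
  by have := sphi; rewrite sqr_int_prod.
- by move=> k p _; rewrite lee_fin ger0_norm.
Qed.

End isometry.

(** By linearity the difference is the integral of the remainder, to which the second moment bound
    applies. *)
Lemma compensated_integral_remainder N lam phi k : jump_process N lam ->
  predictable T G phi -> (sqr_int lam phi < +oo)%E ->
  (\int[P]_w ((compensated_integral T N lam phi w -
    compensated_integral T N lam (truncation N k phi) w) ^+ 2)%:E <=
   sqr_int lam (remainder N phi k))%E.
Proof.
move=> JP pphi sphi.
have prem := predictable_remainder JP pphi k.
have srem := le_lt_trans (sqr_int_remainder_le JP pphi k) sphi.
have bd := compensated_integral_sqr JP prem srem.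
have pt := predictable_truncation JP k pphi.
have m1 := measurable_compensated_integral JP (predictable_process pphi).
have m2 := measurable_compensated_integral JP (predictable_process pt).
have m3 := measurable_compensated_integral JP (predictable_process prem).
apply: le_trans bd.
rewrite (ge0_ae_eq_integral (f := fun w => ((compensated_integral T N lam phi w -
    compensated_integral T N lam (truncation N k phi) w) ^+ 2)%:E)
  (g := fun w => (compensated_integral T N lam (remainder N phi k) w ^+ 2)%:E))//.
- by apply/measurable_EFinP; apply: measurable_funX; exact: measurable_funB.
- by apply/measurable_EFinP; exact: measurable_funX.
- by move=> w _; rewrite lee_fin sqr_ge0.
- by move=> w _; rewrite lee_fin sqr_ge0.
have iphi := pintegrable_sqr_int JP pphi sphi.
have itr : {ae P, forall w, pintegrable lam (truncation N k phi) w}.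
  apply: filterS2 (pintegrable_sqr_int JP prem srem) iphi => w iw jw.
  have := integrableB measurableT jw iw; apply: eq_integrable => // t _ /=.
  rewrite -EFinB -mulrBl; congr (_ * _)%:E; rewrite /on_interval/= /remainder.
  by case: ifP => _; rewrite ?subr0// subKr.
have B := compensated_integralB JP (predictable_process pphi) (predictable_process pt) iphi itr.
by apply: filterS B => w /= <- _.
Qed.

(** For the truncations the expectation is a finite sum of common jumps, almost surely zero by
    hypothesis. The second moment bounds carry the orthogonality over to the limit. *)
Lemma compensated_integral_orthogonal N lam N' lam' phi psi :
  jump_process N lam -> jump_process N' lam' ->
  {ae P, forall w, forall i j, jump_of T N i.+1 w <= T ->
    jump_of T N i.+1 w <> jump_of T N' j.+1 w} ->
  predictable T G phi -> predictable T G psi ->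
  (sqr_int lam phi < +oo)%E -> (sqr_int lam' psi < +oo)%E ->
  ('E_P[compensated_integral T N lam phi \* compensated_integral T N' lam' psi] = 0)%E.
Proof.
move=> JP JP' ncj pphi ppsi sphi spsi.
pose x := compensated_integral T N lam phi.
pose y := compensated_integral T N' lam' psi.
pose xk k := compensated_integral T N lam (truncation N k phi).
pose yk k := compensated_integral T N' lam' (truncation N' k psi).
have Lx : x \in Lfun P 2%:E := compensated_integral_Lfun2 JP pphi sphi.
have Ly : y \in Lfun P 2%:E := compensated_integral_Lfun2 JP' ppsi spsi.
have Lxk k : xk k \in Lfun P 2%:E := compensated_truncation_Lfun2 k JP pphi.
have Lyk k : yk k \in Lfun P 2%:E := compensated_truncation_Lfun2 k JP' ppsi.
have orth k : ('E_P[xk k \* yk k] = 0)%E.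
  rewrite (truncation_product k JP JP' pphi ppsi) big1// => i _; rewrite big1// => j _.
  have -> : 0%E = ('E_P[cst 0%R])%E by rewrite expectation_cst.
  apply: expectation_ae => //.
    have C := common_jump_Lfun1 T0 hG (jp_jump JP i) (jp_jump JP' j)
      (bounded_truncation JP k pphi) (bounded_truncation JP' k ppsi).
    by have := sub_Lfun_mfun C; rewrite inE.
  apply: filterS ncj => w /(_ i j) ncw; rewrite /common_jump/=; case: eqP => // E.
  by rewrite /at_jumpr; case: ifP => [/ncw/(_ E)//|]; rewrite mul0r.
have fV : sqr_int lam phi \is a fin_num.
  rewrite ge0_fin_numE//; apply: le_trans (compensated_integral_sqr JP pphi sphi).
  by apply: integral_ge0 => w _; rewrite lee_fin sqr_ge0.
have fV' : sqr_int lam' psi \is a fin_num.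
  rewrite ge0_fin_numE//; apply: le_trans (compensated_integral_sqr JP' ppsi spsi).
  by apply: integral_ge0 => w _; rewrite lee_fin sqr_ge0.
pose M := Num.max (fine (sqr_int lam phi)) (fine (sqr_int lam' psi)).
apply: (@expectation_product_limit0 _ _ _ P x y xk yk
  (fun k => sqr_int lam (remainder N phi k)) (fun k => sqr_int lam' (remainder N' psi k)) M) => //.
- apply: le_trans (compensated_integral_sqr JP' ppsi spsi) _.
  by rewrite -(fineK fV') lee_fin le_max lexx orbT.
- move=> k; apply: le_trans (truncation_sqr JP pphi k) _.
  by rewrite -(fineK fV) lee_fin le_max lexx.
- by move=> k; exact: compensated_integral_remainder.
- by move=> k; exact: compensated_integral_remainder.
- exact: sqr_int_remainder.
- exact: sqr_int_remainder.
Qed.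

End jump_process.

(** * Equality of measures on a sub-sigma-algebra *)

Section density.
Context d (T : measurableType d) {R : realType} (mu : {measure set T -> \bar R}).
Variable f : T -> \bar R.
Hypotheses (mf : measurable_fun setT f) (f0 : forall x, (0 <= f x)%E).
Local Open Scope ereal_scope.

(** Densities turn an identity between weighted integrals over the sets of a sub-sigma-algebra into
    an equality of two measures there, the form in which [ge0_eq_integral_sub] extends it to
    functions. *)
Definition density_fun (A : set T) := \int[mu]_(x in A) f x.

Let density0 : density_fun set0 = 0.
Proof. by rewrite /density_fun integral_set0. Qed.

Let density_ge0 A : 0 <= density_fun A.
Proof. exact: integral_ge0. Qed.

Let density_sigma_additive : semi_sigma_additive density_fun.
Proof. exact: semi_sigma_additive_nng_induced. Qed.

Definition density : {measure set T -> \bar R} :=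
  HB.pack_for {measure set T -> \bar R} density_fun
    (isMeasure.Build _ _ _ density_fun density0 density_ge0 density_sigma_additive).

Lemma densityE A : density A = \int[mu]_(x in A) f x.
Proof. by []. Qed.

Import HBNNSimple.

Let integral_density_nnsfun (g : {nnsfun T >-> R}) :
  \int[density]_x (g x)%:E = \int[mu]_x ((g x)%:E * f x).
Proof.
rewrite integralT_nnsfun sintegralE fsbig_finite//=.
have gE x : (g x)%:E * f x =
    \sum_(r \in range g) (r%:E * (\1_(g @^-1` [set r]) x)%:E * f x).
  rewrite fimfunE -fsumEFin// fsbig_finite//= ge0_sume_distrl.
    by rewrite fsbig_finite//=; apply: eq_bigr => r _; rewrite EFinM.
  by move=> r _; rewrite EFinM nnfun_muleindic_ge0.
under eq_integral do rewrite gE.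
rewrite ge0_integral_fsum//; last 2 first.
- move=> r; apply: emeasurable_funM => //; apply: emeasurable_funM => //.
  by apply/measurable_EFinP; exact: measurable_indic.
- by move=> r x _; rewrite mule_ge0// nnfun_muleindic_ge0.
rewrite fsbig_finite//=; apply: eq_big_seq => r.
rewrite in_fset_set// inE => -[x _ <-].
under eq_integral do rewrite -muleA.
rewrite ge0_integralZl//; last 3 first.
- by apply: emeasurable_funM => //; apply/measurable_EFinP; exact: measurable_indic.
- by move=> y _; rewrite mule_ge0// lee_fin.
- by rewrite lee_fin.
congr (_ * _); rewrite -[LHS]/(density_fun (g @^-1` [set g x])) /density_fun.
rewrite integral_mkcond; apply: eq_integral => y _.
by rewrite patchE indicE; case: ifP => _; rewrite ?mul1e ?mul0e.
Qed.

Lemma integral_density (h : T -> \bar R) : (forall x, f x \is a fin_num) ->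
  measurable_fun setT h -> (forall x, 0 <= h x) -> \int[density]_x h x = \int[mu]_x (h x * f x).
Proof.
move=> ffin mh h0; pose h_ := nnsfun_approx measurableT mh.
have mh_ n : measurable_fun setT (fun x => (h_ n x)%:E).
  by apply/measurable_EFinP.
have h_0 n x : 0 <= (h_ n x)%:E by rewrite lee_fin.
have ndh x : {homo (fun n => (h_ n x)%:E) : a b / (a <= b)%N >-> a <= b}.
  by move=> a b ab; rewrite lee_fin; exact/lefP/nd_nnsfun_approx.
have ch x : (h_ n x)%:E @[n --> \oo] --> h x.
  by apply: (cvg_nnsfun_approx measurableT mh) => // y _; exact: h0.
transitivity (limn (fun n => \int[density]_x (h_ n x)%:E)).
  rewrite -monotone_convergence//.
  by apply: eq_integral => x _; apply/esym/cvg_lim => //; exact: ch.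
under eq_fun do rewrite integral_density_nnsfun.
rewrite -monotone_convergence//.
- by apply: eq_integral => x _; apply/cvg_lim => //; exact: cvgeZr.
- by move=> n; exact: emeasurable_funM.
- by move=> n x _; exact: mule_ge0.
- by move=> x _ a b ab; apply: lee_wpmul2r => //; exact: ndh.
Qed.

End density.

(* Both integrals are integrals of the identity against the image measures on
   the extended line, which only see sets of [G]. *)
Lemma ge0_eq_integral_sub d (T : measurableType d) {R : realType}
    (m1 m2 : {measure set T -> \bar R}) (G : set (set T)) (h : T -> \bar R) :
  measurable_fun setT h -> (forall x, (0 <= h x)%E) ->
  (forall B, measurable B -> G (h @^-1` B)) ->
  (forall A, G A -> m1 A = m2 A) ->
  (\int[m1]_x h x = \int[m2]_x h x)%E.
Proof.
move=> mh h0 Gh m12.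
have push (m : {measure set T -> \bar R}) :
    (\int[m]_x h x = \int[pushforward m h]_y `|y|)%E.
  rewrite (ge0_integral_pushforward mh)//.
  by apply: eq_integral => x _ /=; rewrite gee0_abs.
rewrite !push; apply: eq_measure_integral => A mA _.
by rewrite /pushforward/=; exact/m12/Gh.
Qed.

(** * Conditional probabilities and conditional independence *)

Section conditional.
Context {R : realType} {d : measure_display} {Omega : measurableType d}.
Variables (P : probability Omega R) (G : set (set Omega)).
Hypotheses (sG : sigma_algebra setT G) (Gm : G `<=` measurable).

Let GT := g_sigma_algebraType G.

Let GTE : @measurable _ GT = G.
Proof. exact: measurable_g_measurableTypeE. Qed.

Lemma sub_measurable_fun d' (S : measurableType d') (f : Omega -> S) :
  @measurable_fun _ _ GT S setT f -> measurable_fun setT f.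
Proof.
by move=> mf _ B mB; rewrite setTI; apply: Gm; rewrite -GTE -[X in measurable X]setTI; exact: mf.
Qed.

Lemma preimage_sub_measurable d' (S : measurableType d') (f : Omega -> S) :
  (forall B : set S, measurable B -> G (f @^-1` B)) <->
  @measurable_fun _ _ GT S setT f.
Proof.
split=> [Gf _ B mB|mf B mB]; first by rewrite setTI GTE; exact: Gf.
by rewrite -GTE -[X in measurable X]setTI; exact: mf.
Qed.

(** The test set [E = [f2 < f1]] belongs to [G], and on it the positive function [f1 - f2] has
    integral at most 0. *)
Lemma sub_ae_le (f1 f2 : Omega -> R) :
  @measurable_fun _ _ GT _ setT f1 -> @measurable_fun _ _ GT _ setT f2 ->
  P.-integrable setT (EFin \o f1) -> P.-integrable setT (EFin \o f2) ->
  (forall E, G E -> (\int[P]_(w in E) (f1 w)%:E <= \int[P]_(w in E) (f2 w)%:E)%E) ->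
  {ae P, forall w, f1 w <= f2 w}.
Proof.
move=> m1 m2 i1 i2 le12; pose E := [set w | f2 w < f1 w].
have GE : G E.
  rewrite -GTE -[X in measurable X]setTI.
  exact: (@measurable_fun_ltr _ GT _ _ _ _ m2 m1 measurableT [set true]).
have mE : measurable E := Gm GE.
have iE (f : Omega -> R) : P.-integrable setT (EFin \o f) -> P.-integrable E (EFin \o f).
  by move=> fi; apply: integrableS fi.
have idiff : P.-integrable E (fun w => (f1 w - f2 w)%:E).
  have := integrableB mE (iE _ i1) (iE _ i2).
  by apply: eq_integrable => // w _; rewrite /= EFinB.
have : (\int[P]_(w in E) (f1 w - f2 w)%:E <= 0)%E.
  rewrite (_ : \int[P]_(w in E) _ =
    \int[P]_(w in E) (f1 w)%:E - \int[P]_(w in E) (f2 w)%:E)%E.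
    by rewrite sube_le0; exact: le12.
  have /= <- := integralB mE (iE _ i1) (iE _ i2).
  by apply: eq_integral => w _; rewrite /= EFinB.
move=> le0; have eq0 : (\int[P]_(w in E) `|(f1 w - f2 w)%:E| = 0)%E.
  apply/eqP; rewrite eq_le integral_ge0// andbT; apply: le_trans le0.
  rewrite le_eqVlt; apply/orP; left; apply/eqP; apply: eq_integral => w.
  by rewrite inE /E/= => lt; rewrite ger0_norm// subr_ge0 ltW.
have mdiff := measurable_int _ idiff.
have := (ae_eq_integral_abs P mE mdiff).1 eq0.
apply: filterS => w /= H; rewrite leNgt; apply/negP => lt.
have /eqP := H lt; rewrite eqe subr_eq0 => /eqP E12.
by move: lt; rewrite E12 ltxx.
Qed.

Lemma sub_ae_eq (f1 f2 : Omega -> R) :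
  @measurable_fun _ _ GT _ setT f1 -> @measurable_fun _ _ GT _ setT f2 ->
  P.-integrable setT (EFin \o f1) -> P.-integrable setT (EFin \o f2) ->
  (forall E, G E -> (\int[P]_(w in E) (f1 w)%:E = \int[P]_(w in E) (f2 w)%:E)%E) ->
  {ae P, forall w, f1 w = f2 w}.
Proof.
move=> m1 m2 i1 i2 e12.
have l12 : {ae P, forall w, f1 w <= f2 w} by apply: sub_ae_le => // E /e12 ->.
have l21 : {ae P, forall w, f2 w <= f1 w} by apply: sub_ae_le => // E /e12 ->.
by apply: filterS2 l12 l21 => w a b; apply/eqP; rewrite eq_le a b.
Qed.

Lemma cond_prob_ge0 A f : cond_prob P G A f -> {ae P, forall w, 0 <= f w}.
Proof.
move=> [/preimage_sub_measurable mf fi fA].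
apply: sub_ae_le => //.
- exact: integrable0.
- move=> E GE; rewrite fA//= integral0_eq//.
Qed.

(** The defining identity of [f] equates on [G] the measures with densities [max 0 f] and [\1_A],
    hence also their integrals of [h]. The positive part is taken because [f] is nonnegative only
    almost everywhere, whereas a density must be so everywhere. *)
Lemma cond_prob_pos A f : measurable A -> cond_prob P G A f ->
  forall h : Omega -> R, @measurable_fun _ _ GT _ setT h -> (forall w, 0 <= h w) ->
  (\int[P]_w (h w * Num.max 0 (f w))%:E = \int[P]_(w in A) (h w)%:E)%E.
Proof.
move=> mA cA h mh h0; have pos := cond_prob_ge0 cA.
case: cA => /preimage_sub_measurable mf fi fA.
have mfp : @measurable_fun _ _ GT _ setT (fun w => Num.max 0 (f w)).
  by apply: measurable_maxr.
have mEfp : measurable_fun setT (fun w => (Num.max 0 (f w))%:E).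
  by apply/measurable_EFinP; exact: sub_measurable_fun.
have mEh : measurable_fun setT (fun w => (h w)%:E).
  by apply/measurable_EFinP; exact: sub_measurable_fun.
have fp0 w : (0 <= (Num.max 0 (f w))%:E)%E by rewrite lee_fin le_max lexx.
have mI : measurable_fun setT (fun w => (\1_A w)%:E : \bar R).
  by apply/measurable_EFinP; exact: measurable_indic.
have I0 w : (0 <= (\1_A w)%:E :> \bar R)%E by rewrite lee_fin.
pose m1 := density P mEfp fp0; pose m2 := density P mI I0.
have hfin w : (h w)%:E \is a fin_num by [].
have : (\int[m1]_w (h w)%:E = \int[m2]_w (h w)%:E)%E.
  apply: (ge0_eq_integral_sub (G := G)) => //.
  - have mEh' : @measurable_fun _ _ GT _ setT (EFin \o h) by exact/measurable_EFinP.
    by have H := (preimage_sub_measurable (EFin \o h)).2 mEh'; exact: H.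
  - move=> E GE; have mE := Gm GE.
    transitivity (\int[P]_(w in E) (f w)%:E)%E.
      apply: ae_eq_integral => //.
      + exact: measurable_funTS.
      + by apply/measurable_funTS/measurable_EFinP/sub_measurable_fun.
      + by apply: filterS pos => w fw _; rewrite max_r.
    transitivity (\int[P]_(w in E) (\1_A w)%:E)%E => //.
    by rewrite fA// integral_indic.
have Eh0 w : (0 <= (h w)%:E)%E by rewrite lee_fin.
rewrite /m1 /m2 !integral_density// => H.
transitivity (\int[P]_w ((h w)%:E * (Num.max 0 (f w))%:E))%E; first exact: eq_integral.
rewrite H [RHS]integral_mkcond; apply: eq_integral => w _.
by rewrite patchE indicE; case: ifP => _; rewrite ?mule1 ?mule0.
Qed.

(* [g] is a version of P(D | G). *)
Lemma cond_indep_version (H1 H2 : set (set Omega)) (D : set Omega) :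
  sigma_algebra setT H1 -> H1 `<=` measurable -> H2 `<=` measurable ->
  cond_indep P G H1 H2 -> H2 D ->
  exists g : Omega -> R, [/\ @measurable_fun _ _ GT _ setT g,
    forall w, 0 <= g w, P.-integrable setT (EFin \o g) &
    forall A E, H1 A -> G E ->
      P (A `&` D `&` E) = (\int[P]_(w in A `&` E) (g w)%:E)%E].
Proof.
move=> sH1 H1m H2m ci H2D; have mD := H2m _ H2D.
have H1T : H1 setT by case: sH1 => h0 hC _; rewrite -(setD0 setT); exact: hC.
(* Using the sure event on the side of [H1] fixes a version for [D] before any [A] is chosen. *)
have [_ [fD [_ cD _]]] := ci _ _ H1T H2D.
have posD := cond_prob_ge0 cD.
have [/preimage_sub_measurable mD' iD eD] := cD.
pose g w := Num.max 0 (fD w).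
have mg : @measurable_fun _ _ GT _ setT g by exact: measurable_maxr.
have g0 w : 0 <= g w by rewrite /g le_max lexx.
have gfD : {ae P, forall w, g w = fD w}.
  by apply: filterS posD => w fw; rewrite /g max_r.
have mEg : measurable_fun setT (EFin \o g).
  by apply/measurable_EFinP; exact: sub_measurable_fun.
have ig : P.-integrable setT (EFin \o g).
  apply: le_integrable iD => // w _; rewrite /= lee_fin ger0_norm//.
  by rewrite /g ge_max normr_ge0 ler_norm.
exists g; split => // A E H1A GE.
have mA := H1m _ H1A; have mE := Gm GE.
(* The version [fD'] given by [cond_indep] may depend on [A]; it agrees almost surely with the fixed
   [fD]. *)
have [fA [fD' [cA cD' cAD]]] := ci _ _ H1A H2D.
have [/preimage_sub_measurable mfA _ _] := cA.
have [/preimage_sub_measurable mD'' iD' eD'] := cD'.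
have [/preimage_sub_measurable mAD iAD eAD] := cAD.
have posA := cond_prob_ge0 cA.
have fDD : {ae P, forall w, fD' w = fD w}.
  by apply: sub_ae_eq => // F GF; rewrite eD// eD'.
rewrite -eAD//.
pose h w := g w * \1_E w.
have mh : @measurable_fun _ _ GT _ setT h.
  apply: measurable_funM => //; apply: measurable_indic.
  by rewrite GTE.
have h0 w : 0 <= h w by rewrite mulr_ge0.
have := cond_prob_pos mA cA mh h0.
move=> H; transitivity (\int[P]_w (h w * Num.max 0 (fA w))%:E)%E; last first.
  rewrite H integral_mkcond [RHS]integral_mkcond; apply: eq_integral => w _.
  rewrite !patchE in_setI /h indicE.
  by case: (w \in A); case: (w \in E) => //=; rewrite ?mulr1 ?mulr0.
transitivity (\int[P]_(w in E) (g w * Num.max 0 (fA w))%:E)%E; last first.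
  rewrite integral_mkcond; apply: eq_integral => w _.
  by rewrite patchE /h indicE; case: (w \in E); rewrite ?mulr1// mulr0 mul0r.
have mmax : measurable_fun setT (fun w => g w * Num.max 0 (fA w)).
  by apply: sub_measurable_fun; apply: measurable_funM => //; exact: measurable_maxr.
apply: ae_eq_integral => //.
- apply/measurable_funTS/measurable_EFinP/sub_measurable_fun.
  exact: measurable_funM.
- exact/measurable_funTS/measurable_EFinP.
apply: filterS3 posA fDD gfD => w /= A0 -> -> _.
by rewrite mulrC max_r.
Qed.

End conditional.

Lemma predictable_section {R : realType} {d : measure_display}
    {Omega : measurableType d} (T : R) (F : R -> set (set Omega)) d'
    (S : measurableType d') (Y : R -> Omega -> S) (r : R) :
  0 < T -> filtration T F -> predictable T F Y -> 0 <= r <= T ->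
  @measurable_fun _ _ (g_sigma_algebraType (F r)) S setT (Y r).
Proof.
move=> T0 hF /(predictableP T0 hF) mY rT.
apply: (@measurable_comp _ _ _ (g_sigma_algebraType (F r)) (ptype T F) S
  (`[0, T] `*` setT) (fun p => Y p.1 p.2) setT (pair r)) => //.
- exact: measurable_dom.
- by move=> _ [w _ <-]; split => //=; rewrite in_itv.
- have mp := measurable_ptype_section hF rT; exact: mp.
Qed.

Lemma predictable_sub {R : realType} {d : measure_display}
    {Omega : measurableType d} (T : R) (F G : R -> set (set Omega)) d'
    (S : measurableType d') (Y : R -> Omega -> S) :
  (forall t, 0 <= t <= T -> F t `<=` G t) -> 0 < T -> predictable T F Y -> predictable T G Y.
Proof.
move=> FG T0 pY B mB; have := pY B mB; apply: smallest_sub.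
  exact: smallest_sigma_algebra.
move=> C rC; apply: sub_sigma_algebra.
case: rC => [[A FA ->]|[s [t [A [s0 st tT FA ->]]]]].
  by left; exists A => //; apply: FG FA; rewrite lexx ltW.
right; exists s, t, A; split => //; apply: FG FA.
by rewrite s0 ltW// (lt_le_trans st).
Qed.

(** * The enlarged filtration *)

Section enlarged_filtration.
Context {R : realType} {q : nat} {dir : bool} {d : measure_display}
  {Omega : measurableType d}.
Variables (P : probability Omega R) (T : R) (lambda : R -> q.-tuple R -> R).
Context {n : nat}.
Variable net : network R q dir Omega n.
Hypothesis T0 : 0 < T.
Hypothesis hnet : structured_network P T lambda net.
Variables (m delta : R) (J : {set link dir n}).
Hypothesis delta0 : 0 < delta.

Local Notation L := (link dir n).
Local Notation F := (net_F net).
Local Notation mark := (nat * q.-tuple R * bool)%type.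

Let hF : filtration T F. Proof. by case: hnet. Qed.

Lemma mark_adapted (u : L) r : 0 <= r <= T ->
  @measurable_fun _ _ (g_sigma_algebraType (F r)) mark setT (net_mark net u r).
Proof.
move=> rT; have [_ [_ aN _] [pX pC] _ _] := hnet.
apply: measurable_fun_pair; last exact: predictable_section (pC u) rT.
apply: measurable_fun_pair; last exact: predictable_section (pX u) rT.
move=> _ B _; rewrite setTI.
rewrite [X in measurable X](_ : _ = \bigcup_(k in B) [set w | net_N net u r w = k]).
  apply: bigcup_measurable => k _; rewrite (measurable_adaptedE hF rT).
  exact: aN.
by apply/seteqP; split => [w Bw|w [k Bk /= ->]]; first exists (net_N net u r w).
Qed.

Let sub_measurable r : 0 <= r <= T -> F r `<=` measurable.
Proof. by case: hF => _ + _; exact. Qed.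

Let sub_sigma r : 0 <= r <= T -> sigma_algebra setT (F r).
Proof. by case: hF => + _ _; exact. Qed.

Lemma measurable_mark (u : L) r : 0 <= r <= T ->
  measurable_fun setT (net_mark net u r).
Proof.
move=> rT; have ma := mark_adapted u rT.
exact: sub_measurable_fun (sub_sigma rT) (sub_measurable rT) _ _ _ ma.
Qed.

Lemma measurable_net_dist s (u : L) : 0 <= s <= T ->
  measurable_fun setT (net_dist net J s u).
Proof.
move=> sT; have [_ _ _ _ [_ _ _ pd]] := hnet.
have md v : measurable_fun setT (fun w => net_d net s w u v).
  have ma := predictable_section T0 hF (pd u v) sT.
  exact: sub_measurable_fun (sub_sigma sT) (sub_measurable sT) _ _ _ ma.
have H (l : seq L) : measurable_fun setT
    (fun w => \big[mine/+oo%E]_(v <- l | v \in J) net_d net s w u v).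
  elim: l => [|v l IH].
    by under eq_fun do rewrite big_nil; exact: measurable_cst.
  under eq_fun do rewrite big_cons; case: (v \in J) => //.
  exact: measurable_mine.
exact: H.
Qed.

Lemma measurable_masked_mark (u : L) s r : 0 <= s <= T -> 0 <= r <= T ->
  measurable_fun setT (masked_mark net m J u s r).
Proof.
move=> sT rT; apply: measurable_fun_ifT => //; last exact: measurable_mark.
have md := measurable_net_dist u sT.
exact: (measurable_fun_lee (f := cst m%:E)).
Qed.

Lemma sigma_marks_sub a b : 0 <= a -> sigma_marks T net J a b `<=` measurable.
Proof.
move=> a0; apply: smallest_sub; first exact: sigma_algebra_measurable.
move=> _ [[u r] [B [[/= _ ar rb rT] mB ->]]].
by rewrite -[X in measurable X]setTI; apply: measurable_mark => //; rewrite (le_trans a0).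
Qed.

Lemma sigma_masked_sub a : a <= T -> sigma_masked T net m delta J a `<=` measurable.
Proof.
move=> aT; apply: smallest_sub; first exact: sigma_algebra_measurable.
move=> _ [[u [s r]] [B [[/= s0 sa r0 rT rs] mB ->]]].
rewrite -[X in measurable X]setTI; apply: measurable_masked_mark => //.
  by rewrite s0 (le_trans sa).
by rewrite r0.
Qed.

Definition lag (t : R) : R := Num.max 0 (t - 4 * delta).

Lemma lag_ge0 t : 0 <= lag t. Proof. by rewrite /lag le_max lexx. Qed.

Lemma lag_le t : 0 <= t -> lag t <= t.
Proof.
by move=> t0; rewrite /lag ge_max t0/= lerBlDr lerDl mulr_ge0// ltW.
Qed.

Lemma lag_homo s t : s <= t -> lag s <= lag t.
Proof. by move=> st; rewrite /lag le_max2// lerB. Qed.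

Lemma lagT t : 0 <= t <= T -> 0 <= lag t <= T.
Proof. by move=> /andP[t0 tT]; rewrite lag_ge0 (le_trans (lag_le t0)). Qed.

(* The marks of [J] are seen up to time [t], everything else with the delay
   [4 delta], and the masked marks as in [short_sighted]. *)
Definition enlarged_gen t : set (set Omega) :=
  [set E | exists A B D, [/\ F (lag t) A, sigma_marks T net J (lag t) t B,
    sigma_masked T net m delta J (lag t) D & E = A `&` B `&` D]].

Definition enlarged t : set (set Omega) := <<s enlarged_gen t >>.

Lemma sigma_genT {I : Type} d' (S : measurableType d') (D : set I)
    (Y : I -> Omega -> S) : sigma_gen D Y setT.
Proof.
have [h0 hC _] := smallest_sigma_algebra setT
  [set A | exists i B, [/\ D i, measurable B & A = Y i @^-1` B]].
by rewrite -(setD0 setT); exact: hC.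
Qed.

Lemma sigma_genI {I : Type} d' (S : measurableType d') (D : set I)
    (Y : I -> Omega -> S) A B : sigma_gen D Y A -> sigma_gen D Y B ->
  sigma_gen D Y (A `&` B).
Proof.
exact: (@measurableI _ (g_sigma_algebraType
  [set A | exists i B, [/\ D i, measurable B & A = Y i @^-1` B]])).
Qed.

Lemma enlarged_genI t : 0 <= t <= T -> setI_closed (enlarged_gen t).
Proof.
move=> tT _ _ [A [B [D [FA MB MD ->]]]] [A' [B' [D' [FA' MB' MD' ->]]]].
exists (A `&` A'), (B `&` B'), (D `&` D'); split.
- exact: (filtrationI hF (lagT tT) FA FA').
- exact: sigma_genI.
- exact: sigma_genI.
- by rewrite setIACA (setIACA A).
Qed.

Lemma enlarged_F t A : 0 <= t <= T -> F (lag t) A -> enlarged t A.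
Proof.
move=> tT FA; apply: sub_sigma_algebra; exists A, setT, setT; split => //.
- exact: sigma_genT.
- exact: sigma_genT.
- by rewrite !setIT.
Qed.

Lemma enlarged_marks t B : 0 <= t <= T -> sigma_marks T net J (lag t) t B ->
  enlarged t B.
Proof.
move=> tT MB; apply: sub_sigma_algebra; exists setT, B, setT; split => //.
- exact: (filtrationT hF (lagT tT)).
- exact: sigma_genT.
- by rewrite setTI setIT.
Qed.

Lemma enlarged_masked t D : 0 <= t <= T -> sigma_masked T net m delta J (lag t) D ->
  enlarged t D.
Proof.
move=> tT MD; apply: sub_sigma_algebra; exists setT, setT, D; split => //.
- exact: (filtrationT hF (lagT tT)).
- exact: sigma_genT.
- by rewrite !setTI.
Qed.

(** A mark before [lag t] is contained in [F (lag t)]; a later one is among the marks of [J] that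
    are added explicitly. *)
Lemma enlarged_mark (u : L) r t B : u \in J -> 0 <= r <= t -> t <= T ->
  measurable B -> enlarged t (net_mark net u r @^-1` B).
Proof.
move=> uJ /andP[r0 rt] tT mB.
have t0T : 0 <= t <= T by rewrite (le_trans r0).
have rT : 0 <= r <= T by rewrite r0 (le_trans rt).
have [lr|rl] := leP (lag t) r.
  apply: enlarged_marks => //; apply: sub_sigma_algebra.
  by exists (u, r), B; split => //; split => //=; exact: le_trans tT.
apply: enlarged_F => //.
have [_ _ /(_ r (lag t)) Fm] := hF; apply: Fm => //; first exact: ltW.
  by case/andP: (lagT t0T).
rewrite -(measurable_adaptedE hF rT) -[X in measurable X]setTI.
exact: mark_adapted.
Qed.

(** Monotonicity is not immediate for the marks of [J]: as [t] grows, the window [[lag t, t]] also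
    loses its initial piece, which [enlarged_mark] recovers from [F (lag t)]. *)
Lemma enlarged_filtration : filtration T enlarged.
Proof.
split.
- by move=> t _; exact: smallest_sigma_algebra.
- move=> t tT; apply: smallest_sub; first exact: sigma_algebra_measurable.
  move=> _ [A [B [D [FA MB MD ->]]]].
  have lT := lagT tT; case/andP: (lT) => l0 l1.
  apply: measurableI; first apply: measurableI.
  + exact: sub_measurable lT _ FA.
  + exact: sigma_marks_sub MB.
  + exact: sigma_masked_sub MD.
move=> s t s0 st tT.
have tT' : 0 <= t <= T by rewrite (le_trans s0).
have sT : 0 <= s <= T by rewrite s0 (le_trans st).
have sa : sigma_algebra setT (enlarged t) by exact: smallest_sigma_algebra.
apply: smallest_sub => // _ [A [B [D [FA MB MD ->]]]].
apply: (@measurableI _ (g_sigma_algebraType (enlarged_gen t))).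
  apply: (@measurableI _ (g_sigma_algebraType (enlarged_gen t))).
    apply: enlarged_F => //; have [_ _ /(_ (lag s) (lag t)) Fm] := hF.
    apply: Fm FA; [exact: lag_ge0|exact: lag_homo|by case/andP: (lagT tT')].
  have : sigma_marks T net J (lag s) s `<=` enlarged t.
    apply: smallest_sub => // _ [[u r] [C [[/= uJ sr rs rT] mC ->]]].
    apply: enlarged_mark => //.
    by rewrite (le_trans (lag_ge0 s))//= (le_trans rs).
  exact.
apply: enlarged_masked => //.
have : sigma_masked T net m delta J (lag s) `<=` sigma_masked T net m delta J (lag t).
  apply: smallest_sub; first exact: smallest_sigma_algebra.
  move=> _ [[u [s' r]] [C [[/= s'0 s'a r0 rT rs] mC ->]]].
  apply: sub_sigma_algebra; exists (u, (s', r)), C; split => //; split => //=.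
  exact: le_trans (lag_homo st).
exact.
Qed.

(** The covariate [X] of [u] is a component of its mark, and the delay in [lag] is that of
    [short_sighted], so the masked marks are the same. *)
Lemma short_sighted_enlarged (u : L) t : u \in J -> 0 <= t <= T ->
  short_sighted T net m delta [set u]%SET J t `<=` enlarged t.
Proof.
move=> uJ tT; apply: smallest_sub; first exact: smallest_sigma_algebra.
move=> A [].
  move: A; apply: smallest_sub; first exact: smallest_sigma_algebra.
  move=> _ [[v r] [B [[/= + r0 rt] mB ->]]]; rewrite inE => /eqP ->.
  rewrite (_ : _ @^-1` B = net_mark net u r @^-1` ([set: nat] `*` B `*` [set: bool])).
    apply: enlarged_mark => //; first by rewrite r0.
      by case/andP: tT.
    by apply: measurableX => //; exact: measurableX.
  by apply/seteqP; split => w //= [[]].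
exact: enlarged_masked.
Qed.

End enlarged_filtration.

(** * Single jumps under the original intensity *)

Section slot_sets.
Context {R : realType} {d : measure_display} {Omega : measurableType d}.
Variables (T : R) (N : R -> Omega -> nat) (lam : R -> Omega -> R).
Hypothesis T0 : 0 < T.
Hypothesis cN : forall w, counting_path T (N^~ w).
Local Notation mu := (@lebesgue_measure R).
Local Notation tau := (jump_of T N).

Definition slot_set (j : nat) : set (R * Omega) :=
  [set p | 0 <= p.1 <= T /\ p.1 <= tau j.+1 p.2] `&`
  [set p | p.1 <= T /\ tau j p.2 < p.1].

Lemma slot_intensityE j : slot_intensity T N lam j = (fun p => lam p.1 p.2) \_ (slot_set j).
Proof.
apply/funext => p; rewrite patchE /slot_intensity; case: ifPn.
  by move=> /andP[/[dup] p1T /andP[_ pT] /andP[a b]]; rewrite mem_set.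
move=> H; rewrite memNset// => -[[/= p1T a] [_ b]]; move: H.
by rewrite p1T a b.
Qed.

Lemma slot_jump i j w : (i < N T w)%N -> slot_set j (tau i.+1 w, w) <-> i = j.
Proof.
move=> iN; have iT : tau i.+1 w <= T by rewrite jump_of_leT.
have i0 : 0 <= tau i.+1 w := jump_of_ge0 N T0 _ _.
split=> [[[/= _ ij] [_ ji]]|<-].
  apply/eqP; rewrite eqn_leq; apply/andP; split; rewrite leqNgt; apply/negP => lt.
    have /(jump_time_lt T0 (cN w)) : (j.+1 < i.+1)%N by [].
    by move=> /(_ iT); rewrite ltNge -/(tau _ _) -/(tau _ _) ij.
  have /(jump_time_homo T0 (cN w)) : (i.+1 <= j)%N by [].
  by rewrite leNgt -/(tau _ _) -/(tau _ _) ji.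
split; split => //=; first by rewrite i0.
by apply: jump_time_lt.
Qed.

Variable F : R -> set (set Omega).
Hypothesis hF : filtration T F.
Hypothesis aN : forall t k, 0 <= t <= T -> F t [set w | N t w = k].

Lemma measurable_slot_set j : measurable (slot_set j : set (ptype T F)).
Proof.
have m1 := measurable_upto_jump T0 cN hF aN j.+1.
have m2 := measurable_after_jump T0 cN hF aN j.
exact: measurableI m1 m2.
Qed.

Lemma measurable_slot_intensity j : measurable_process T lam ->
  measurable_fun setT (slot_intensity T N lam j).
Proof.
move=> mlam; rewrite slot_intensityE.
have mS : measurable (slot_set j) := ptype_measurable T0 hF (measurable_slot_set j).
apply: (measurable_restrictT _ mS).1.
apply: (measurable_funS (E := `[0, T] `*` setT)) mlam.
  by apply: measurableX.
by move=> p [[/= pT _] _]; split => //=; rewrite in_itv.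
Qed.

Variable P : probability Omega R.
Hypothesis iN : intensity P T F N lam.

Let plam : predictable T F lam. Proof. by case: iN. Qed.
Let lam0 t w : 0 <= t <= T -> 0 <= lam t w. Proof. by case: iN => _ + _ _; exact. Qed.

Lemma slot_intensity_ge0 j p : 0 <= slot_intensity T N lam j p.
Proof. by rewrite /slot_intensity; case: ifP => // /andP[pT _]; exact: lam0. Qed.

(** The integrand is [Y] on []s, t]] restricted to slot [j]. It is [F]-predictable because [Y] is
    known at [s], and the slot selects exactly jump [j.+1] from the integral against the counting
    process. *)
Lemma intensity_slot s t j (Y : Omega -> R) : 0 <= s -> t <= T ->
  @measurable_fun _ _ (g_sigma_algebraType (F s)) _ setT Y -> (forall w, 0 <= Y w) ->
  (\int[P]_w (if (s < tau j.+1 w <= t)%R then (Y w)%:E else 0) =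
   \int[P]_w ((Y w)%:E * \int[mu]_(r in `]s, t]) (slot_intensity T N lam j (r, w))%:E))%E.
Proof.
move=> s0 tT mY Y0.
have [ts|st] := leP t s.
  rewrite integral0_eq; last first.
    by move=> w _; case: ifP => // /andP[/lt_le_trans h /h]; rewrite ltNge ts.
  rewrite integral0_eq// => w _.
  by rewrite set_itv_ge ?bnd_simp -?leNgt// integral_set0 mule0.
have sT : 0 <= s <= T by rewrite s0 ltW// (lt_le_trans st).
pose S := (`]s, t] `*` setT) `&` slot_set j.
pose H r w := ((fun p : R * Omega => Y p.2) \_ S) (r, w).
have mS : measurable (S : set (ptype T F)).
  apply: measurableI (measurable_slot_set j); apply: measurable_rect => //.
  exact: (filtrationT hF sT).
have mYS : @measurable_fun _ _ (ptype T F) _ S (fun p => Y p.2).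
  have mA := measurable_adapted_ptype hF sT mY.
  apply: (@measurable_funS _ _ (ptype T F)) mA.
    apply: measurable_rect => //; exact: (filtrationT hF sT).
  move=> p [[/= + _] _]; rewrite in_itv/= => /andP[sp pt]; split => //=.
  by rewrite in_itv/= sp (le_trans pt).
have pH : predictable T F H.
  apply/(predictableP T0 hF).
  have mr := (@measurable_restrictT _ _ (ptype T F) _ S (fun p => Y p.2) mS).1 mYS.
  apply: (@eq_measurable_fun _ _ (ptype T F) _ _ ((fun p => Y p.2) \_ S)).
    by move=> [r w] _.
  exact: (@measurable_funTS _ _ (ptype T F)).
have H0 r w : 0 <= H r w by rewrite /H patchE; case: ifP.
have HE r w : H r w = if (s < r <= t) && ((r, w) \in slot_set j) then Y w else 0.
  rewrite /H patchE in_setI; congr (if _ && _ then _ else _).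
  by apply/idP/idP => [/set_mem[/=]|]; rewrite ?in_itv//= => h; apply/mem_set; split => //=; rewrite in_itv.
have [_ _ _ /(_ H pH (fun r w _ => H0 r w)) I] := iN.
transitivity (\int[P]_w \int[counting_stieltjes T (N^~ w)]_(r in `]0%R, T]) (H r w)%:E)%E.
  apply: eq_integral => w _.
  have ms := measurable_process_section w (predictable_process T0 hF pH).
  rewrite (ge0_integral_counting T0 (cN w)); last 2 first.
  - exact/measurable_EFinP.
  - by move=> r _; rewrite lee_fin.
  have [jN|Nj] := ltnP j (N T w); last first.
    rewrite big1 => [|i _].
      by case: ifP => // /andP[_ /le_trans/(_ tT)]; rewrite jump_of_leT// ltnNge Nj.
    rewrite HE; case: ifP => // /andP[_ /set_mem/slot_jump] /(_ (ltn_ord i)) E.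
    by have := ltn_ord i; rewrite E ltnNge Nj.
  rewrite (bigD1 (Ordinal jN))//= big1 => [|i /negP ij].
    rewrite adde0 HE (mem_set ((slot_jump _ jN).2 erefl)) andbT.
    by case: ifP.
  rewrite HE; case: ifP => // /andP[_ /set_mem/slot_jump] /(_ (ltn_ord i)) E.
  by case: ij; apply/eqP/val_inj.
rewrite I; apply: eq_integral => w _.
have msl := measurable_slot_intensity j (predictable_process T0 hF plam).
rewrite -ge0_integralZl//; last 3 first.
- apply: measurable_funTS; apply/measurable_EFinP.
  have m1 := measurable_fun_pair1 w msl; exact m1.
- by move=> r _; rewrite lee_fin slot_intensity_ge0.
- by rewrite lee_fin.
rewrite [LHS]integral_mkcond [RHS]integral_mkcond; apply: eq_integral => r _.
rewrite !patchE HE slot_intensityE patchE.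
rewrite !mem_setE !in_itv/=; case: (boolP (s < r <= t)) => [/andP[sr rt]|_] /=.
  rewrite (le_trans s0 (ltW sr)) (le_trans rt tT)/= -EFinM.
  by case: ifP => _; rewrite ?mul0r ?mulr0.
by rewrite mul0r; case: ifP.
Qed.

End slot_sets.

(** * The intensity with respect to the enlarged filtration *)

Section rectangles.
Context {R : realType} {q : nat} {dir : bool} {d : measure_display}
  {Omega : measurableType d}.
Variables (P : probability Omega R) (T : R) (lambda : R -> q.-tuple R -> R).
Context {n : nat}.
Variable net : network R q dir Omega n.
Hypothesis T0 : 0 < T.
Hypothesis hlambda : link_function T lambda.
Hypothesis hnet : structured_network P T lambda net.
Variables (m delta : R) (J : {set link dir n}).
Hypothesis hdep : momentary_dependence P T net m delta.
Variable u : link dir n.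
Hypothesis uJ : u \in J.

Local Notation F := (net_F net).
Local Notation N := (net_N net u).
Local Notation lam := (net_intensity lambda net u).
Local Notation tau := (jump_of T N).
Local Notation mu := (@lebesgue_measure R).
Local Notation mark := (nat * q.-tuple R * bool)%type.
Local Notation slot j := (slot_intensity T N lam j).
Local Notation G := (enlarged T net m delta J).
Local Notation gen := (enlarged_gen T net m delta J).
Local Notation lag := (lag delta).

Let delta0 : 0 < delta. Proof. by case: hdep. Qed.

Let hF : filtration T F. Proof. by case: hnet. Qed.

Let hG : filtration T G. Proof. exact: (enlarged_filtration T0 hnet m J delta0). Qed.

Let cN w : counting_path T (N^~ w).
Proof. by case: hnet => _ [+ _ _] _ _ _; exact. Qed.

Let aN t k : 0 <= t <= T -> F t [set w | N t w = k].
Proof. by case: hnet => _ [_ + _] _ _ _; exact. Qed.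

Let iN : intensity P T F N lam.
Proof. by case: hnet. Qed.

Lemma net_intensity_process : measurable_process T lam.
Proof. by case: iN => plam _ _ _; exact: predictable_process plam. Qed.

Lemma net_intensity_ge0 t w : 0 <= t <= T -> 0 <= lam t w.
Proof. by case: iN => _ + _ _; exact. Qed.

Let mslot j : measurable_fun setT (slot j).
Proof.
have ms := measurable_slot_intensity T0 cN hF aN j net_intensity_process; exact: ms.
Qed.

Let slot0 j p : 0 <= slot j p.
Proof. by have s0 := slot_intensity_ge0 iN j p; exact: s0. Qed.

(* [H] is any sigma-algebra containing the marks of [u] on [s, r]. *)
Lemma slot_adapted (H : set (set Omega)) j s r : 0 <= s <= r -> r <= T ->
  sigma_algebra setT H ->
  (forall t B, s <= t <= r -> measurable B -> H (net_mark net u t @^-1` B)) ->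
  (0 < r -> s < r) ->
  @measurable_fun _ _ (g_sigma_algebraType H) _ setT (fun w => slot j (r, w)).
Proof.
move=> /andP[s0 sr] rT sH Hmark rs.
have HE : @measurable _ (g_sigma_algebraType H) = H.
  exact: measurable_g_measurableTypeE.
have mmark t : s <= t <= r ->
    @measurable_fun _ _ (g_sigma_algebraType H) mark setT (net_mark net u t).
  by move=> str _ B mB; rewrite setTI HE; exact: Hmark.
have Hle i t : s <= t <= r -> H [set w | tau i w <= t].
  move=> /[dup] str /andP[st tr].
  rewrite (_ : [set w | _] = net_mark net u t @^-1` ([set k | (i <= k)%N] `*` setT `*` setT)).
    apply: Hmark => //; apply: measurableX => //; exact: measurableX.
  apply/seteqP; split => w /=; rewrite jump_of_le ?(le_trans s0 st) ?(le_trans tr rT)//.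
  by case=> [[]].
have Hlt i : H [set w | tau i w < r].
  have [r0|] := ltP 0 r; last first.
    move=> r0; rewrite (_ : [set w | _] = set0); first by case: sH.
    apply/seteqP; split => // w /=.
    by rewrite ltNge (le_trans r0)// jump_of_ge0.
  rewrite -HE (_ : [set w | _] = [set w | tau i w <= s] `|`
     \bigcup_(x : rat) (if s <= (ratr x : R) < r then [set w | tau i w <= ratr x] else set0)).
    apply: measurableU; first by rewrite HE; apply: Hle; rewrite lexx.
    apply: bigcupT_measurable_rat => x; case: ifPn => // /andP[sx xr].
    by rewrite HE; apply: Hle; rewrite sx ltW.
  apply/seteqP; split => w /=.
    move=> tr; have [ts|st] := leP (tau i w) s; [by left|right].
    have [x] := rat_in_itvoo tr; rewrite in_itv/= => /andP[tx xr]; exists x => //.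
    have -> : s <= (ratr x : R) < r by rewrite xr (ltW (lt_trans st tx)).
    exact: ltW.
  move=> [ts|[x _]]; first exact: le_lt_trans (rs r0).
  by case: ifPn => // /andP[_ xr] /= /le_lt_trans; exact.
pose f (v : mark) : R := v.2%:R * lambda r v.1.2.
have mf : measurable_fun setT f.
  apply: measurable_funM.
    have mb : measurable_fun setT (fun b : bool => b%:R : R) by [].
    exact: (measurableT_comp mb measurable_snd).
  have ml : measurable_fun setT (lambda r).
    have rT0 : 0 <= r <= T by rewrite (le_trans s0).
    apply: (@measurable_comp _ _ _ _ _ _ (`[0, T] `*` setT) (fun p => lambda p.1 p.2) setT (pair r)).
    - by apply: measurableX.
    - by move=> _ [x _ <-]; split => //=; rewrite in_itv.
    - exact: hlambda.2.
    - exact: pair1_measurable.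
  apply: (measurableT_comp ml); exact: measurableT_comp.
have mlt i : @measurable_fun _ _ (g_sigma_algebraType H) _ setT (fun w => tau i w < r).
  apply: (@measurable_fun_bool _ (g_sigma_algebraType H) _ _ true).
  by rewrite setTI HE; exact: Hlt.
have r0 : 0 <= r := le_trans s0 sr.
rewrite (_ : (fun w => _) = fun w => if (tau j w < r) && ~~ (tau j.+1 w < r)
    then f (net_mark net u r w) else 0); last first.
  apply/funext => w; rewrite /slot_intensity/= r0 rT/= -leNgt.
  by case: ifP.
apply: measurable_fun_ifT => //.
  by apply: measurable_and => //; exact: measurable_neg.
have mm := mmark r; rewrite sr lexx in mm.
exact: (measurableT_comp mf (mm isT)).
Qed.

Local Notation slot_int j s t w := (\int[mu]_(r in `]s, t]) (slot j (r, w))%:E)%E.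

Lemma slot_int_fubini j s t (Z : Omega -> R) : measurable_fun setT Z -> (forall w, 0 <= Z w) ->
  (\int[P]_w ((Z w)%:E * slot_int j s t w) =
   \int[mu]_(r in `]s, t]) \int[P]_w (Z w * slot j (r, w))%:E)%E.
Proof.
move=> mZ Z0.
pose f (p : Omega * measurableTypeR R) :=
  ((Z p.1 * slot j (p.2, p.1)) * \1_(`]s, t]) p.2)%:E.
have f0 p : (0 <= f p)%E by rewrite lee_fin mulr_ge0// mulr_ge0.
have mf : measurable_fun setT f.
  apply/measurable_EFinP; apply: measurable_funM.
    apply: measurable_funM.
      exact: (measurableT_comp mZ measurable_fst).
    have sw : measurable_fun setT (fun p : Omega * measurableTypeR R => (p.2, p.1)).
      exact: measurable_fun_pair.
    exact: (measurableT_comp (mslot j) sw).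
  have mi : measurable_fun setT (\1_(`]s, t]) : measurableTypeR R -> R).
    exact: measurable_indic.
  exact: (measurableT_comp mi measurable_snd).
have fE w r : f (w, r) = ((fun r => (Z w * slot j (r, w))%:E) \_ `]s, t]) r.
  by rewrite /f/= patchE indicE; case: ifP => _; rewrite ?mulr1 ?mulr0.
transitivity (\int[P]_w \int[mu]_r f (w, r))%E.
  apply: eq_integral => w _; rewrite -ge0_integralZl//; last 3 first.
  - apply: measurable_funTS; apply/measurable_EFinP.
    have m1 := measurable_fun_pair1 w (mslot j); exact m1.
  - by move=> r _; rewrite lee_fin.
  - by rewrite lee_fin.
  by rewrite integral_mkcond; apply: eq_integral => r _; rewrite fE.
rewrite (fubini_tonelli f mf f0) [RHS]integral_mkcond; apply: eq_integral => r _.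
rewrite patchE; case: ifPn => rst; first by apply: eq_integral => w _; rewrite fE patchE rst.
by rewrite integral0_eq// => w _; rewrite fE patchE (negPf rst).
Qed.

Let marks_sub s t a b : lag s <= a -> b <= t ->
  sigma_marks T net J a b `<=` sigma_marks T net J (lag s) t.
Proof.
move=> sa bt; apply: smallest_sub; first exact: smallest_sigma_algebra.
move=> _ [[v r] [B [[/= vJ ar rb rT] mB ->]]]; apply: sub_sigma_algebra.
exists (v, r), B; split => //; split => //=.
  exact: le_trans ar.
exact: le_trans bt.
Qed.

Let marks_F s : 0 <= s <= T -> sigma_marks T net J (lag s) s `<=` F s.
Proof.
move=> sT; apply: smallest_sub; first by case: hF => + _ _; exact.
move=> _ [[v r] [B [[/= vJ sr rs rT] mB ->]]].
have r0 : 0 <= r := le_trans (lag_ge0 delta s) sr.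
have rT' : 0 <= r <= T by rewrite r0.
have [_ _ /(_ r s)] := hF; apply => //; first by case/andP: sT.
rewrite -(measurable_adaptedE hF rT') -[X in measurable X]setTI.
by have ma := mark_adapted T0 hnet v rT'; exact: ma.
Qed.

(* For [E = A & B & D], everything but [D] is determined by [F (lag s)] and the
   marks of [J] on [lag s, lag s + 6 delta], so that [1_D] may be replaced by
   P(D | F (lag s)); what remains of [E] is then known at time [s], and the
   defining property of the [F]-intensity applies. *)
Lemma rectangle_gen j s t E : 0 <= s -> s < t -> t <= T -> t <= s + 2 * delta ->
  gen s E ->
  P (E `&` [set w | s < tau j.+1 w <= t]) = (\int[P]_(w in E) slot_int j s t w)%E.
Proof.
move=> s0 st tT ts [A [B [D [FA MB MD ->]]]].
have sT : 0 <= s <= T by rewrite s0 ltW// (lt_le_trans st).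
have lT := lagT delta0 sT; have ls := lag_le delta0 s0.
(* The budget [6 = 4 + 2]: at most [4 delta] from [lag s] to [s] and at most [2 delta] from [s] to
   [t]. *)
have t6 : t <= lag s + 6 * delta.
  apply: le_trans ts _; have : s - 4 * delta <= lag s by rewrite /lag le_max lexx orbT.
  by lra.
set K := [set w | _].
have [_ /(_ _ J lT) ci] := hdep.
set H1 := sigma_marks T net J (lag s) (lag s + 6 * delta) in ci.
have sH1 : sigma_algebra setT H1 by exact: smallest_sigma_algebra.
have H1m : H1 `<=` measurable by apply: (sigma_marks_sub T0 hnet); exact: lag_ge0.
have H2m : sigma_masked T net m delta J (lag s) `<=` measurable.
  by apply: (sigma_masked_sub T0 hnet); case/andP: lT.
have sF : sigma_algebra setT (F (lag s)) by case: hF => + _ _; exact.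
have Fm r : 0 <= r <= T -> F r `<=` measurable by case: hF => _ + _; exact.
have [g [mg g0 ig gE]] := cond_indep_version sF (Fm _ lT) sH1 H1m H2m ci MD.
have H1B : H1 B by apply: marks_sub MB => //; apply: (le_trans (ltW st)).
have H1mark x C : lag s <= x <= t -> measurable C -> H1 (net_mark net u x @^-1` C).
  move=> /andP[sx xt] mC; apply: sub_sigma_algebra; exists (u, x), C; split => //.
  by split => //=; [exact: le_trans t6|exact: le_trans tT].
have H1le x : lag s <= x <= t -> H1 [set w | tau j.+1 w <= x].
  move=> /[dup] sxt /andP[sx xt].
  rewrite (_ : [set w | _] = net_mark net u x @^-1` ([set k | (j.+1 <= k)%N] `*` setT `*` setT)).
    apply: H1mark => //; apply: measurableX => //; exact: measurableX.
  apply/seteqP; split => w /=; rewrite jump_of_le ?(le_trans (lag_ge0 delta s) sx) ?(le_trans xt tT)//.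
  by case=> [[]].
have H1E : @measurable _ (g_sigma_algebraType H1) = H1.
  exact: measurable_g_measurableTypeE.
have H1K : H1 K.
  rewrite -H1E (_ : K = [set w | tau j.+1 w <= t] `\` [set w | tau j.+1 w <= s]).
    apply: measurableD; rewrite H1E; apply: H1le; first by rewrite lexx (le_trans ls (ltW st)).
    by rewrite ls ltW.
  apply/seteqP; split => w /=; first by move=> /andP[a b]; split => //; apply/negP; rewrite -ltNge.
  by move=> [a /negP]; rewrite -ltNge => b; rewrite /K/= b a.
have mA : measurable A := Fm _ lT _ FA.
have mB : measurable B := H1m _ H1B.
have mD : measurable D := H2m _ MD.
have mK : measurable K := H1m _ H1K.
have lsF : F (lag s) `<=` F s.
  by case: hF => _ _; apply; [exact: lag_ge0|exact: ls|case/andP: sT].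
pose Y w := g w * \1_(A `&` B) w.
have Y0 w : 0 <= Y w by rewrite mulr_ge0.
have mY : @measurable_fun _ _ (g_sigma_algebraType (F s)) _ setT Y.
  apply: measurable_funM.
    move=> _ C mC; rewrite setTI (measurable_adaptedE hF sT); apply: lsF.
    rewrite -(measurable_adaptedE hF lT) -[X in measurable X]setTI; exact: mg.
  apply: measurable_indic; rewrite (measurable_adaptedE hF sT).
  by apply: (filtrationI hF sT); [exact: lsF|exact: marks_F].
have mY' : measurable_fun setT Y.
  have sFs : sigma_algebra setT (F s) by case: hF => + _ _; exact.
  exact: sub_measurable_fun sFs (Fm _ sT) _ _ _ mY.
have mg' : measurable_fun setT g := sub_measurable_fun sF (Fm _ lT) mg.
(* The marks of [u] up to [t] decide [K], so [B] and [K] together form an event of [H1], and [1_D]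
   is exchanged for [g] in the presence of [A]. *)
transitivity (\int[P]_w (if (s < tau j.+1 w <= t)%R then (Y w)%:E else 0))%E.
  rewrite (_ : _ `&` K = (B `&` K) `&` D `&` A); last first.
    by apply/seteqP; split => w [[[]]] => [Aw Bw Dw Kw|Bw Kw Dw Aw]; do ! split.
  rewrite gE//; last by rewrite -H1E; apply: measurableI; rewrite H1E.
  rewrite integral_mkcond; apply: eq_integral => w _.
  rewrite patchE /Y indicE !in_setI.
  rewrite (_ : (w \in K) = (s < tau j.+1 w <= t)); last by apply/idP/idP => [/set_mem|/mem_set].
  case: (w \in B); case: (s < _ <= _); case: (w \in A) => //=; rewrite ?mulr1 ?mulr0//.
rewrite (intensity_slot T0 cN hF aN iN)//.
rewrite slot_int_fubini//.
have mE : measurable (A `&` B `&` D) by do 2 apply: measurableI => //.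
transitivity (\int[P]_w ((\1_(A `&` B `&` D) w)%:E * slot_int j s t w))%E; last first.
  rewrite [RHS]integral_mkcond; apply: eq_integral => w _; rewrite patchE indicE.
  by case: ifP => _; rewrite ?mul1e ?mul0e.
have mI : measurable_fun setT (\1_(A `&` B `&` D) : Omega -> R) by exact: measurable_indic.
have I0 w : 0 <= \1_(A `&` B `&` D) w :> R by [].
rewrite (slot_int_fubini j s t mI I0); apply: eq_integral => r.
rewrite mem_setE in_itv/= => /andP[sr rt].
have rT : r <= T := le_trans rt tT.
(* For fixed [r] the exchange is now undone. The slot at time [r] depends only on marks of [u]
   within the window, so [h] is [H1]-measurable, and the identity for [g], known on sets of [H1],
   extends to it through two measures with densities. *)
pose h w := (slot j (r, w) * \1_B w)%:E.
have mslr : @measurable_fun _ _ (g_sigma_algebraType H1) _ setT (fun w => slot j (r, w)).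
  apply: (@slot_adapted H1 j s r) => //; first by rewrite s0 ltW.
  move=> x C /andP[sx xr] mC; apply: H1mark => //.
  by rewrite (le_trans ls sx) (le_trans xr).
have mh1 : @measurable_fun _ _ (g_sigma_algebraType H1) _ setT h.
  apply/measurable_EFinP; apply: measurable_funM => //.
  by apply: measurable_indic; rewrite H1E.
have mh : measurable_fun setT h := sub_measurable_fun sH1 H1m mh1.
have h0 w : (0 <= h w)%E by rewrite lee_fin mulr_ge0.
have mAD : measurable_fun setT (fun w => (\1_(A `&` D) w)%:E : \bar R).
  by apply/measurable_EFinP; apply: measurable_indic; exact: measurableI.
have AD0 w : (0 <= (\1_(A `&` D) w)%:E :> \bar R)%E by rewrite lee_fin.
have mgA : measurable_fun setT (fun w => (g w * \1_A w)%:E).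
  by apply/measurable_EFinP; apply: measurable_funM => //; exact: measurable_indic.
have gA0 w : (0 <= (g w * \1_A w)%:E)%E by rewrite lee_fin mulr_ge0.
have HEQ : (\int[density P mAD AD0]_w h w = \int[density P mgA gA0]_w h w)%E.
  apply: (ge0_eq_integral_sub (G := H1)) => //.
    by have H := (preimage_sub_measurable sH1 h).2 mh1; exact: H.
  move=> X H1X; have mX := H1m _ H1X.
  transitivity (\int[P]_(w in X) (\1_(A `&` D) w)%:E)%E => //.
  rewrite integral_indic//; last exact: measurableI.
  transitivity (\int[P]_(w in X) (g w * \1_A w)%:E)%E => //.
  rewrite (_ : A `&` D `&` X = X `&` D `&` A); last by rewrite setIC setIA setIAC.
  apply: (etrans (gE _ _ H1X FA)).
  rewrite [LHS]integral_mkcond [RHS]integral_mkcond; apply: eq_integral => w _.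
  by rewrite !patchE in_setI indicE; case: (w \in X); case: (w \in A); rewrite /= ?mulr1 ?mulr0.
rewrite !integral_density// in HEQ.
transitivity (\int[P]_w (h w * (g w * \1_A w)%:E))%E.
  apply: eq_integral => w _; rewrite -EFinM; congr EFin.
  rewrite /Y !indicE in_setI; case: (w \in A); case: (w \in B) => /=; ring.
rewrite -HEQ; apply: eq_integral => w _; rewrite -EFinM; congr EFin.
by rewrite !indicE !in_setI; case: (w \in A); case: (w \in B); case: (w \in D) => /=; ring.
Qed.

Let slot_int_ge0 j s t w : (0 <= slot_int j s t w)%E.
Proof. by apply: integral_ge0 => r _; rewrite lee_fin. Qed.

Let measurable_slot_int j s t : measurable_fun setT (fun w => slot_int j s t w).
Proof.
pose f (p : Omega * measurableTypeR R) :=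
  ((slot j (p.2, p.1)) * \1_(`]s, t]) p.2)%:E.
have f0 p : (0 <= f p)%E by rewrite lee_fin mulr_ge0.
have mf : measurable_fun setT f.
  apply/measurable_EFinP; apply: measurable_funM.
    have sw : measurable_fun setT (fun p : Omega * measurableTypeR R => (p.2, p.1)).
      exact: measurable_fun_pair.
    exact: (measurableT_comp (mslot j) sw).
  have mi : measurable_fun setT (\1_(`]s, t]) : measurableTypeR R -> R).
    exact: measurable_indic.
  exact: (measurableT_comp mi measurable_snd).
have H := @measurable_fun_fubini_tonelli_F _ _ _ _ _ mu f mf f0.
rewrite (_ : (fun w => _) = fubini_F mu f); first exact: H.
apply/funext => w; rewrite /fubini_F [LHS]integral_mkcond; apply: eq_integral => r _.
by rewrite patchE /f/= indicE; case: ifP => _; rewrite ?mulr1 ?mulr0.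
Qed.

Let measurable_jump j : measurable_fun setT (tau j).
Proof. by have mt := measurable_jump_of T0 cN hF aN j; exact: mt. Qed.

Let measurable_jump_in j s t : measurable [set w | s < tau j w <= t].
Proof.
rewrite (_ : [set w | _] = tau j @^-1` `]s, t]%classic); last first.
  by apply/seteqP; split => w; rewrite /= in_itv.
by rewrite -[X in measurable X]setTI; exact: measurable_jump.
Qed.

(** Both sides are measures in [E], finite since [P] is a probability; they agree on the generating
    rectangles, which are stable under intersection. *)
Lemma rectangle_short j s t E : 0 <= s -> s < t -> t <= T -> t <= s + 2 * delta ->
  G s E ->
  P (E `&` [set w | s < tau j.+1 w <= t]) = (\int[P]_(w in E) slot_int j s t w)%E.
Proof.
move=> s0 st tT ts GE.
have sT : 0 <= s <= T by rewrite s0 ltW// (lt_le_trans st).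
set K := [set w | _].
have mK : measurable K by exact: measurable_jump_in.
have mE A : G s A -> measurable A by case: hG => _ + _; apply.
have mi : measurable_fun setT (fun w => (\1_K w)%:E : \bar R).
  by apply/measurable_EFinP; exact: measurable_indic.
have i0 w : (0 <= (\1_K w)%:E :> \bar R)%E by rewrite lee_fin.
have genG A : gen s A -> G s A by exact: sub_sigma_algebra.
have m1E A : measurable A -> density P mi i0 A = P (A `&` K).
  by move=> mA; rewrite densityE integral_indic// setIC.
rewrite -m1E; last exact: mE.
transitivity (density P (measurable_slot_int j s t) (slot_int_ge0 j s t) E) => //.
have genT : gen s setT.
  exists setT, setT, setT; split; rewrite ?setIT//.
  - exact: (filtrationT hF (lagT delta0 sT)).
  - exact: sigma_genT.
  - exact: sigma_genT.
apply: (@g_sigma_algebra_measure_unique _ _ _ (gen s) _ (fun=> setT)) => //.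
- by move=> A gA; exact: mE _ (genG _ gA).
- by rewrite bigcup_const.
- by have gI A B := @enlarged_genI _ _ _ _ _ _ _ _ _ _ hnet m _ J delta0 _ sT A B; exact: gI.
- move=> A gA; rewrite (m1E _ (mE _ (genG _ gA))).
  by have h := rectangle_gen j s0 st tT ts gA; exact: h.
- move=> _; rewrite m1E//; apply: le_lt_trans (probability_le1 P _) (ltry _).
  exact: measurableI.
Qed.

Lemma rectangle j s t E : 0 <= s -> s < t -> t <= T -> G s E ->
  P (E `&` [set w | s < tau j.+1 w <= t]) = (\int[P]_(w in E) slot_int j s t w)%E.
Proof.
have d20 : 0 < 2 * delta by rewrite mulr_gt0.
(* The number of pieces of length [2 delta]. The induction moves [s] forward, which is possible
   because [E] also belongs to [G] at the later time. *)
have : t <= s + 2 * delta * (Num.truncn ((t - s) / (2 * delta))).+1%:R.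
  by rewrite -lerBlDl mulrC -ler_pdivrMr// ltW// truncnS_gt.
move: (Num.truncn _).+1 => k; elim: k s t E => [|k IH] s t E.
  by rewrite mulr0 addr0 => ts _ st; rewrite ltNge ts in st.
move=> tk s0 st tT GE.
have [ts|ts] := leP t (s + 2 * delta); first exact: rectangle_short.
pose r := s + 2 * delta; rewrite -/r in ts.
have sr : s < r by rewrite ltrDl.
have r0 : 0 <= r := ltW (le_lt_trans s0 sr).
have sT : 0 <= s <= T by rewrite s0 ltW// (lt_le_trans st).
have mE : measurable E by have [_ + _] := hG; apply; [exact: sT|].
have GrE : G r E.
  by have [_ _ Gh] := hG; apply: (Gh s) GE => //; [exact: ltW|exact: le_trans (ltW ts) tT].
rewrite (_ : E `&` _ = (E `&` [set w | s < tau j.+1 w <= r]) `|`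
                       (E `&` [set w | r < tau j.+1 w <= t])); last first.
  rewrite -setIUr; congr (_ `&` _); apply/seteqP; split => w /=.
    by move=> /andP[sj jt]; have [jr|rj] := leP (tau j.+1 w) r; [left|right]; rewrite ?sj.
  move=> [/andP[a b]|/andP[a b]]; first by rewrite a (le_trans b (ltW ts)).
  by rewrite (lt_trans sr a).
rewrite measureU; first last.
- apply/seteqP; split => // w /= [[_ /andP[_ a]] [_ /andP[b _]]].
  by move: b; rewrite ltNge a.
- by apply: measurableI => //; exact: measurable_jump_in.
- by apply: measurableI => //; exact: measurable_jump_in.
have tk' : t <= r + 2 * delta * k%:R by move: tk; rewrite /r -natr1; nra.
have rT : r <= T := le_trans (ltW ts) tT.
have eL := rectangle_short j s0 sr rT (lexx _) GE.
have eR := IH _ _ _ tk' r0 ts tT GrE.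
apply: (etrans (congr2 (fun x y => x + y)%E eL eR)).
have mS a b : measurable_fun E (fun w => slot_int j a b w).
  by have mS := measurable_slot_int j a b; exact: (@measurable_funS _ _ _ _ setT).
have S0 a b w : E w -> (0 <= slot_int j a b w)%E by move=> _; exact: slot_int_ge0.
have eD := ge0_integralD P mE (S0 s r) (mS s r) (S0 r t) (mS r t).
apply: (etrans (esym eD)).
apply: eq_integral => w _.
rewrite (@itv_bndbnd_setU _ _ (BRight s) (BRight r) (BRight t)) ?bnd_simp ?ltW//.
have ms : measurable_fun setT (fun r : measurableTypeR R => (slot j (r, w))%:E).
  by apply/measurable_EFinP; have m1 := measurable_fun_pair1 w (mslot j); exact m1.
rewrite ge0_integral_setU//.
- exact: (@measurable_funS _ _ _ _ setT _ _ measurableT _ ms).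
- by move=> x _; rewrite lee_fin.
- apply/disj_setPS => x [] /=; rewrite !in_itv/= => /andP[_ a] /andP[b _].
  by move: b; rewrite ltNge a.
Qed.

Let slot_out j r w : ~ (0 < r <= T) -> slot j (r, w) = 0.
Proof.
rewrite /slot_intensity/= => nr; case: ifP => // /andP[/andP[_ rT] /andP[jr _]].
by case: nr; rewrite rT (le_lt_trans _ jr)// jump_of_ge0.
Qed.

(** Both sides are integrals of [H] on [R * Omega]: against the law of the point [(tau, w)] on the
    event that the jump occurs, and against the measure with density the slot with respect to
    [mu \x P]. The lemma [rectangle] equates the two on predictable rectangles, hence on the
    sigma-algebra for which [H] is measurable. *)
Lemma enlarged_compensator j (H : R * Omega -> \bar R) :
  @measurable_fun _ _ (ptype T G) _ setT H -> (forall p, (0 <= H p)%E) ->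
  (\int[P]_w (if (tau j.+1 w <= T)%R then H (tau j.+1 w, w) else 0) =
   \int[P]_w \int[mu]_t (H (t, w) * (slot j (t, w))%:E))%E.
Proof.
move=> mH H0.
pose RO := (measurableTypeR R * Omega)%type.
have mH' : measurable_fun (setT : set RO) H by have h := ptype_measurable_fun T0 hG measurableT mH; exact: h.
pose K := [set w | tau j.+1 w <= T].
have mK : measurable K.
  rewrite (_ : K = [set w | -1 < tau j.+1 w <= T]); first exact: measurable_jump_in.
  apply/seteqP; split => w /=; rewrite /K/=; last by case/andP.
  by move=> ->; rewrite andbT (lt_le_trans _ (jump_of_ge0 N T0 _ _)).
have mi : measurable_fun setT (fun w => (\1_K w)%:E : \bar R).
  by apply/measurable_EFinP; exact: measurable_indic.
have i0 w : (0 <= (\1_K w)%:E :> \bar R)%E by rewrite lee_fin.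
pose g w : RO := (tau j.+1 w, w).
have mg : measurable_fun setT g by apply: measurable_fun_pair => //; exact: measurable_jump.
have ml : measurable_fun (setT : set RO) (fun p => (slot j p)%:E).
  by apply/measurable_EFinP; exact: mslot.
have l0 (p : RO) : (0 <= (slot j p)%:E)%E by rewrite lee_fin.
pose m0 := density P mi i0.
pose m2 := density (mu \x P)%E ml l0.
have Hg0 w : (0 <= H (g w))%E by [].
have mHg : measurable_fun setT (H \o g) by exact: measurableT_comp.
transitivity (\int[pushforward m0 g]_p H p)%E.
  rewrite (ge0_integral_pushforward mg)//= preimage_setT.
  rewrite integral_density//; apply: eq_integral => w _ /=.
  rewrite indicE (_ : (w \in K) = (tau j.+1 w <= T)); last by apply/idP/idP => [/set_mem|/mem_set].
  by case: ifP => _; rewrite ?mule1 ?mule0.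
transitivity (\int[m2]_p H p)%E; last first.
  rewrite integral_density//.
  have mHl : measurable_fun (setT : set RO) (fun p => (H p * (slot j p)%:E)%E).
    exact: emeasurable_funM.
  have Hl0 (p : RO) : (0 <= H p * (slot j p)%:E)%E by rewrite mule_ge0.
  have fub := @fubini_tonelli2 _ _ _ _ _ mu P _ mHl Hl0; exact: fub.
have m2E (A : set RO) : measurable A -> m2 A =
    (\int[P]_w \int[mu]_r ((fun p => (slot j p)%:E) \_ A) (r, w))%E.
  move=> mA; rewrite [LHS]integral_mkcond.
  have mf : measurable_fun setT ((fun p : RO => (slot j p)%:E) \_ A).
    by apply/(measurable_restrictT _ mA); exact: measurable_funTS.
  have f0 p : (0 <= ((fun p : RO => (slot j p)%:E) \_ A) p)%E.
    by apply: erestrict_ge0 => x _; rewrite lee_fin.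
  have fub := @fubini_tonelli2 _ _ _ _ _ mu P _ mf f0; exact: fub.
(* The whole space is added to exhaust [R * Omega]. Its two masses agree because both measures are
   carried by []0, T] * Omega]. *)
pose rect := predictable_rectangle T G `|` [set setT].
have mG A : predictable_rectangle T G A -> measurable (A : set RO).
  by move=> rA; apply: (ptype_measurable T0 hG); exact: sub_sigma_algebra.
have dom : `]0, T] `*` setT = setT `&` [set p : RO | 0 < p.1 <= T].
  by apply/seteqP; split => p; rewrite /= in_itv/=; [case|case].
have m1E (A : set RO) : measurable A -> m0 (g @^-1` A) = P (K `&` g @^-1` A).
  move=> mA; have mgA : measurable (g @^-1` A) by rewrite -[X in measurable X]setTI; exact: mg.
  by rewrite [LHS](integral_indic _ mgA mK).
have rdom : predictable_rectangle T G (`]0, T] `*` setT).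
  by right; exists 0, T, setT; split => //; apply: (filtrationT hG); rewrite lexx ltW.
have eq_rect A : predictable_rectangle T G A -> m0 (g @^-1` A) = m2 A.
  move=> rA; rewrite (m1E _ (mG _ rA)) (m2E _ (mG _ rA)).
  case: rA => [[B GB ->]|[s [t [B [s0 st tT GB ->]]]]].
    rewrite (_ : _ `&` _ = set0) ?measure0.
      apply/esym/integral0_eq => w _; apply: integral0_eq => r _.
      rewrite patchE; case: ifP => // /set_mem [/= -> _].
      by rewrite slot_out// ltxx.
    by apply/seteqP; split => // w [_ [/= t0 _]]; have := jump_of_gt0 T0 cN j w; rewrite t0 ltxx.
  rewrite (_ : _ `&` _ = B `&` [set w | s < tau j.+1 w <= t]); last first.
    apply/seteqP; split => [w [_ [/= + Bw]]|w [Bw /= st']]; rewrite ?in_itv//.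
    split; first by case/andP: st' => _ /le_trans; apply.
    by split => //=; rewrite in_itv.
  apply: (etrans (rectangle j s0 st tT GB)).
  rewrite [LHS]integral_mkcond; apply: eq_integral => w _.
  rewrite patchE; case: ifPn => Bw.
    rewrite [LHS]integral_mkcond; apply: eq_integral => r _.
    by rewrite !patchE in_setX/= Bw andbT.
  by apply/esym/integral0_eq => r _; rewrite patchE in_setX/= (negPf Bw) andbF.
have eq_T : m0 (g @^-1` setT) = m2 setT.
  transitivity (m0 (g @^-1` (`]0, T] `*` setT))).
    rewrite !m1E//; last exact: mG.
    congr (P _); apply/seteqP; split => w [Kw _]; split => //; split => //=.
    by rewrite in_itv/= Kw andbT; exact: jump_of_gt0 T0 cN j w.
  rewrite eq_rect// (m2E _ (mG _ rdom)) (m2E _ measurableT).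
  apply: eq_integral => w _; apply: eq_integral => r _.
  rewrite !patchE in_setT in_setX/= in_setT andbT; case: ifPn => // /negP nr.
  by rewrite slot_out// => r0T; apply: nr; rewrite mem_setE in_itv.
have mrect A : rect A -> measurable (A : set RO) by case=> [/mG//|->]; exact: measurableT.
pose m1 : {measure set RO -> \bar R} :=
  measure_function_pushforward__canonical__measure_function_Measure m0 mg.
have h0 (p : RO) : (0 <= H p)%E by [].
have gen_eq := @ge0_eq_integral_sub _ _ _ m1 m2 <<s rect >> H mH' h0.
apply: gen_eq.
- move=> B mB; have := mH measurableT B mB; rewrite setTI; apply: smallest_sub.
    exact: smallest_sigma_algebra.
  by move=> A rA; apply: sub_sigma_algebra; left.
- have uniq12 := @g_sigma_algebra_measure_unique _ _ (measurableTypeR R * Omega)%type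
    rect mrect (fun=> setT) _ _ m1 m2.
  apply: uniq12 => //.
  + by move=> _; right.
  + by rewrite bigcup_const.
  + move=> A B [rA|->] [rB|->]; rewrite ?setTI ?setIT; [left|left|left|right] => //.
    exact: predictable_rectangleI.
  + by move=> A [rA|->]; [exact: eq_rect|exact: eq_T].
  + move=> _; have -> : m1 setT = m0 (g @^-1` setT) by []; rewrite m1E//.
    apply: le_lt_trans (probability_le1 P _) (ltry _).
    by apply: measurableI => //; rewrite preimage_setT.
Qed.

Let aG t k : 0 <= t <= T -> G t [set w | N t w = k].
Proof.
move=> tT; rewrite (_ : [set w | _] = net_mark net u t @^-1` ([set k] `*` setT `*` setT)).
  apply: (enlarged_mark T0 hnet) => //; [by case/andP: tT => -> /=|by case/andP: tT|].
  by apply: measurableX => //; exact: measurableX.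
by apply/seteqP; split => w //= [[]].
Qed.

(** Predictability of the intensity is given for [F], which [G] contains only with a delay. The
    field [oj_lad] asks for less, measurability of the slot at each fixed time, and this follows
    from the marks of [u] up to that time. *)
Lemma enlarged_one_jump j : one_jump P T G (tau j.+1) (slot j).
Proof.
split.
- exact: measurable_jump.
- have h := measurable_after_jump T0 cN hG aG j.+1; exact: h.
- have h := @measurable_at_jump _ _ _ _ _ T0 cN _ hG aG j; exact: h.
- exact: mslot.
- exact: slot0.
- by move=> p np; rewrite /slot_intensity; case: ifP => // /andP[].
- move=> r /[dup] rT /andP[r0 rT'].
  have h := @slot_adapted (G r) j 0 r.
  apply: h => //; first by rewrite lexx.
    by have [+ _ _] := hG; exact.
  by move=> t B tr mB; exact: (enlarged_mark T0 hnet).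
- by move=> H mH H0; exact: enlarged_compensator.
Qed.

Lemma enlarged_jump_process : jump_process P T G N lam.
Proof.
split.
- exact: cN.
- exact: aG.
- have h := net_intensity_process; exact: h.
- by move=> t w tT; exact: net_intensity_ge0.
- by case: iN.
- exact: enlarged_one_jump.
Qed.

End rectangles.

(** * The inequality *)

Section expectation_sum_sqr.
Context {R : realType} {d : measure_display} {Omega : measurableType d}.
Variable P : probability Omega R.

(** The splitting of [a u] may depend on the partner [v]: in the product [a u * a v] the factors are
    split as [b u v + e u v] and [b v u + e v u], both with the integrands that leave out this
    pair. *)
Lemma expectation_sum_sqr_le (I : finType) (a : I -> Omega -> R)
    (b e : I -> I -> Omega -> R) (D : I -> \bar R) :
  (forall u, measurable_fun setT (a u)) ->
  (forall u v, {ae P, forall w, a u w = b u v w + e u v w}) ->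
  (forall u v, b u v \in Lfun P 2%:E) ->
  (forall u v, measurable_fun setT (e u v)) ->
  (forall u v, u <> v -> 'E_P[fun w => (b u v w * b v u w)%R] = 0)%E ->
  (forall u, 'E_P[fun w => (b u u w * b u u w)%R] <= D u)%E ->
  (forall u v, P.-integrable setT (fun w => (b u v w * e v u w)%:E)) ->
  (forall u v, P.-integrable setT (fun w => (e u v w * e v u w)%:E)) ->
  ('E_P[fun w => ((\sum_u a u w) ^+ 2)%R] <=
   \sum_u D u +
   2%:E * \sum_u \sum_v 'E_P[fun w => (b u v w * e v u w)%R] +
   \sum_u \sum_v 'E_P[fun w => (e u v w * e v u w)%R])%E.
Proof.
move=> ma abe Lb me bb0 bbD ibe iee.
pose X1 p w := b p.1 p.2 w * b p.2 p.1 w.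
pose X2 p w := b p.1 p.2 w * e p.2 p.1 w.
pose X3 p w := b p.2 p.1 w * e p.1 p.2 w.
pose X4 p w := e p.1 p.2 w * e p.2 p.1 w.
have L1 p : X1 p \in Lfun P 1%:E by have h := Lfun2_mul_Lfun1 (Lb p.1 p.2) (Lb p.2 p.1); exact: h.
have L2 p : X2 p \in Lfun P 1%:E by apply/Lfun1_integrable; exact: ibe.
have L3 p : X3 p \in Lfun P 1%:E by apply/Lfun1_integrable; exact: ibe.
have L4 p : X4 p \in Lfun P 1%:E by apply/Lfun1_integrable; exact: iee.
pose X p := X1 p \+ X2 p \+ X3 p \+ X4 p.
have L12 p : X1 p \+ X2 p \in Lfun P 1%:E by exact: rpredD.
have L123 p : X1 p \+ X2 p \+ X3 p \in Lfun P 1%:E by exact: rpredD.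
have LX p : X p \in Lfun P 1%:E by exact: rpredD.
have iX p : P.-integrable setT (EFin \o X p) by apply/Lfun1_integrable.
have EX p : ('E_P[X p] = 'E_P[X1 p] + 'E_P[X2 p] + 'E_P[X3 p] + 'E_P[X4 p])%E.
  by rewrite !expectationD.
have mX p : measurable_fun setT (X p) by have /integrableP[/measurable_EFinP] := iX p.
have E1 : ('E_P[fun w => ((\sum_u a u w) ^+ 2)%R] = \sum_p 'E_P[X p])%E.
  rewrite (@expectation_ae _ _ _ _ _ (fun w => \sum_p X p w)); last 3 first.
  - by apply: measurable_funX; exact: measurable_sum.
  - exact: measurable_sum.
  - have : {ae P, forall w, forall p : I * I, a p.1 w = b p.1 p.2 w + e p.1 p.2 w}.
      by apply: filter_forall => p; exact: abe.
    apply: filterS => w ae; rewrite expr2 big_distrlr/= pair_bigA/=.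
    apply: eq_bigr => p _; rewrite (ae p) (ae (p.2, p.1))/= /X/X1/X2/X3/X4/=; ring.
  by rewrite unlock (integral_sumEFin _ iX).
rewrite E1 (eq_bigr _ (fun p _ => EX p)) !big_split/=.
(* The two cross terms differ by exchanging the links, whence the factor 2. *)
have S2 : (\sum_p 'E_P[X3 p] = \sum_p 'E_P[X2 p])%E.
  transitivity (\sum_u \sum_v 'E_P[X3 (u, v)])%E.
    by rewrite pair_bigA; apply: eq_bigr => -[].
  by rewrite exchange_big pair_bigA; apply: eq_bigr => -[].
have S1 : (\sum_p 'E_P[X1 p] = \sum_u \sum_v 'E_P[X1 (u, v)])%E.
  by rewrite pair_bigA; apply: eq_bigr => -[].
rewrite S2 !pair_bigA/= -(addeA (\sum_p 'E_P[X1 p])%E) -mule2n -mule_natl.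
apply: leeD => //; apply: leeD => //.
rewrite S1; apply: lee_sum => u _.
rewrite (bigD1 u)//= big1 ?adde0; first exact: bbD.
by move=> v vu; apply: bb0 => /= uv; rewrite uv eqxx in vu.
Qed.

End expectation_sum_sqr.

(** If the path were constant just before the jump time, an earlier time would already have the same
    value, and the jump would have occurred by then. *)
Lemma jumps_at_jump_time {R : realType} (T : R) (f : R -> nat) j : 0 < T ->
  counting_path T f -> jump_time T f j.+1 <= T -> jumps_at f (jump_time T f j.+1).
Proof.
move=> T0 cf jT near_eq; set t := jump_time _ _ _ in jT near_eq.
have t0 : 0 < t by rewrite -[ltLHS](jump_time0 T0 cf) jump_time_lt.
have tT : 0 <= t <= T by rewrite jT ltW.
have [s [/= s0 [st sf]]] : exists s, 0 < s /\ s < t /\ f s = f t.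
  near t^'- => s; exists s; split; [|split].
  - near: s; exact: nbhs_left_gt.
  - near: s; exact: nbhs_left_lt.
  - by near: s.
have sT : 0 <= s <= T by rewrite (ltW s0) (le_trans (ltW st)).
have : t <= s by rewrite (jump_time_le T0 cf _ sT) sf -(jump_time_le T0 cf _ tT) lexx.
by rewrite leNgt st.
Unshelve. all: end_near. Qed.

Lemma sqr_int_expectation {R : realType} {d : measure_display}
    {Omega : measurableType d} (P : probability Omega R) (T : R)
    (lam phi : R -> Omega -> R) :
  measurable_process T lam -> measurable_process T phi ->
  (forall t w, 0 <= t <= T -> 0 <= lam t w) ->
  sqr_int P T lam phi =
  (\int[@lebesgue_measure R]_(t in `[0%R, T])
     'E_P[fun w => (phi t w ^+ 2 * lam t w)%R])%E.
Proof.
move=> mlam mphi lam0; set mu := @lebesgue_measure R.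
have m1 := measurable_on_interval mlam; have m2 := measurable_on_interval mphi.
pose f (p : measurableTypeR R * Omega) :=
  ((on_interval T phi p) ^+ 2 * on_interval T lam p)%:E.
have f0 p : (0 <= f p)%E.
  rewrite lee_fin mulr_ge0 ?sqr_ge0// /on_interval; case: ifP => //; exact: lam0.
have mf : measurable_fun setT f.
  apply/measurable_EFinP; apply: measurable_funM => //; exact: measurable_funX.
have fub := @fubini_tonelli _ _ _ _ _ mu P f mf f0.
rewrite [LHS](_ : _ = (\int[P]_y \int[mu]_x f (x, y))%E)// -fub.
rewrite [RHS]integral_mkcond; apply: eq_integral => t _.
rewrite patchE mem_setE in_itv/= unlock; case: ifPn => tT; last first.
  by apply: integral0_eq => w _; rewrite /f /on_interval/= (negPf tT) mulr0.
by apply: eq_integral => w _; rewrite /f /on_interval/= tT.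
Qed.

Theorem proposition2p9 (R : realType) (d : measure_display)
  (Omega : measurableType d) (P : probability Omega R) (T : R) (T_gt0 : 0 < T)
  (q : nat) (dir : bool) (lambda : R -> q.-tuple R -> R)
  (hlambda : link_function T lambda)
  (net : forall n, network R q dir Omega n)
  (hnet : forall n, structured_network P T lambda (net n))
  (* momentary-m-dependence, with its witnesses delta n *)
  (m : R) (m_ge0 : 0 <= m) (delta : nat -> R)
  (hdep : forall n, momentary_dependence P T (net n) m (delta n))
  (phi : forall n, link dir n -> R -> Omega -> R)
  (hphi : forall n u, measurable_process T (phi n u))
  (phit : forall n, {set link dir n} -> link dir n -> R -> Omega -> R)
  (hphit : forall n (J : {set link dir n}) u, u \in J -> (#|J| <= 2)%N ->
     predictable T (short_sighted T (net n) m (delta n) [set u]%SET J)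
       (phit n J u))
  (* the integrals and expectations below exist, the Ito integrands phit being
     square integrable *)
  (hphi_int : forall n u, {ae P, forall w,
     (@lebesgue_measure R).-integrable `[0, T]
       (fun t => (phi n u t w * net_intensity lambda (net n) u t w)%:E)})
  (hphit_L2 : forall n (J : {set link dir n}) u, u \in J -> (#|J| <= 2)%N ->
     (\int[@lebesgue_measure R]_(t in `[0%R, T])
        'E_P[fun w => ((phit n J u t w) ^+ 2 * (net_C (net n) u t w)%:R
                       * net_intensity lambda (net n) u t w)%R] < +oo)%E)
  (hexp1 : forall n u v, P.-integrable setT (fun w =>
     (net_integral T lambda (net n) u (phit n [set u; v]%SET u) w *
      net_integral T lambda (net n) v
        (fun r w' => phi n v r w' - phit n [set u; v]%SET v r w') w)%:E))
  (hexp2 : forall n u v, P.-integrable setT (fun w =>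
     (net_integral T lambda (net n) u
        (fun t w' => phi n u t w' - phit n [set u; v]%SET u t w') w *
      net_integral T lambda (net n) v
        (fun r w' => phi n v r w' - phit n [set u; v]%SET v r w') w)%:E)) :
  forall n : nat,
  ('E_P[fun w =>
      ((\sum_(u : link dir n) net_integral T lambda (net n) u (phi n u) w)
         ^+ 2)%R]
   <= \sum_(u : link dir n)
        \int[@lebesgue_measure R]_(t in `[0%R, T])
          'E_P[fun w => ((phit n [set u]%SET u t w) ^+ 2
                         * (net_C (net n) u t w)%:R
                         * net_intensity lambda (net n) u t w)%R]
    + 2%:E * \sum_(u : link dir n) \sum_(v : link dir n)
        'E_P[fun w =>
           (net_integral T lambda (net n) u (phit n [set u; v]%SET u) w *
            net_integral T lambda (net n) v
              (fun r w' => phi n v r w' - phit n [set u; v]%SET v r w')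
              w)%R]
    + \sum_(u : link dir n) \sum_(v : link dir n)
        'E_P[fun w =>
           (net_integral T lambda (net n) u
              (fun t w' => phi n u t w' - phit n [set u; v]%SET u t w') w *
            net_integral T lambda (net n) v
              (fun r w' => phi n v r w' - phit n [set u; v]%SET v r w')
              w)%R])%E.
Proof.
move=> n; set N := net n.
have hN := hnet n; have hd := hdep n.
have delta0 : 0 < delta n by case: hd.
pose lam u := net_intensity lambda N u.
pose G J := enlarged T N m (delta n) J.
have hG J : filtration T (G J) := enlarged_filtration T_gt0 hN m J delta0.
have JP (J : {set link dir n}) u : u \in J -> jump_process P T (G J) (net_N N u) (lam u).
  by move=> uJ; exact: (enlarged_jump_process T_gt0 hlambda hN hd uJ).
have pphit (J : {set link dir n}) u : u \in J -> (#|J| <= 2)%N -> predictable T (G J) (phit n J u).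
  move=> uJ J2; have h := hphit n J u uJ J2.
  have sub t : 0 <= t <= T -> short_sighted T N m (delta n) [set u]%SET J t `<=` G J t.
    move=> tT; exact: (short_sighted_enlarged T_gt0 hN delta0 uJ tT).
  have h' := predictable_sub sub T_gt0 h; exact: h'.
have mlam u : measurable_process T (lam u) by have h := net_intensity_process T_gt0 hN u; exact: h.
have lam0 u t w : 0 <= t <= T -> 0 <= lam u t w by exact: (net_intensity_ge0 hN).
have mphit (J : {set link dir n}) u : u \in J -> (#|J| <= 2)%N -> measurable_process T (phit n J u).
  by move=> uJ J2; have h := predictable_process T_gt0 (hG J) (pphit _ _ uJ J2); exact: h.
have sqrE (J : {set link dir n}) u : u \in J -> (#|J| <= 2)%N -> sqr_int P T (lam u) (phit n J u) =
    (\int[@lebesgue_measure R]_(t in `[0%R, T])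
        'E_P[fun w => ((phit n J u t w) ^+ 2 * (net_C (net n) u t w)%:R
                       * net_intensity lambda (net n) u t w)%R])%E.
  (* The intensity already contains the factor [C]; since [C] is 0 or 1, the second copy of it
     changes nothing. *)
  move=> uJ J2; rewrite (sqr_int_expectation P (mlam u) (mphit J u uJ J2) (lam0 u)).
  apply: eq_integral => t _; congr ('E_P[_])%E; apply/funext => w.
  by rewrite /lam /net_intensity; case: (net_C _ _ _ _); rewrite ?mulr1// !mul0r !mulr0.
have sphit (J : {set link dir n}) u : u \in J -> (#|J| <= 2)%N -> (sqr_int P T (lam u) (phit n J u) < +oo)%E.
  by move=> uJ J2; rewrite sqrE//; exact: hphit_L2.
have card2 (u v : link dir n) : (#|[set u; v]%SET| <= 2)%N.
  by rewrite cards2; case: (u != v).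
have pphi u : {ae P, forall w, pintegrable T (lam u) (phi n u) w}.
  have := hphi_int n u; apply: filterS => w iw.
  have mI : measurable (`[0, T]%classic : set (measurableTypeR R)) by exact: measurable_itv.
  have := (integrable_mkcond _ mI).1 iw.
  rewrite (_ : _ \_ _ = (fun t => (on_interval T (phi n u) (t, w) *
    on_interval T (lam u) (t, w))%:E))//.
  apply/funext => t; rewrite patchE mem_setE in_itv/= /on_interval/=.
  by case: ifP => //; rewrite mulr0.
have uJ (u v : link dir n) : u \in [set u; v]%SET by rewrite !inE eqxx.
have vJ (u v : link dir n) : v \in [set u; v]%SET by rewrite !inE eqxx orbT.
pose b u v := net_integral T lambda N u (phit n [set u; v]%SET u).
(* The pair is unordered, so exchanging [u] and [v] leaves the left-out set, and with it the
   filtration, unchanged. *)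
pose e u v := net_integral T lambda N u
  (fun t w => phi n u t w - phit n [set u; v]%SET u t w).
have eE u v : net_integral T lambda N v
    (fun r w => phi n v r w - phit n [set u; v]%SET v r w) = e v u.
  by rewrite /e finset.setUC.
have main := @expectation_sum_sqr_le _ _ _ P _
  (fun u => net_integral T lambda N u (phi n u)) b e
  (fun u => sqr_int P T (lam u) (phit n [set u]%SET u)).
under eq_bigr => u _.
  rewrite -sqrE ?cards1 ?set11//; over.
under [X in (_ <= _ + _ * X + _)%E]eq_bigr => u _.
  under eq_bigr => v _ do rewrite eE; over.
under [X in (_ <= _ + _ + X)%E]eq_bigr => u _.
  under eq_bigr => v _ do rewrite eE; over.
apply: main.
- move=> u; have h := measurable_compensated_integral T_gt0 (hG [set u]%SET)
    (JP _ u (set11 u)) (hphi n u).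
  exact: h.
- move=> u v.
  have pt := pintegrable_sqr_int T_gt0 (hG _) (JP _ _ (uJ u v))
    (pphit _ _ (uJ u v) (card2 u v)) (sphit _ _ (uJ u v) (card2 u v)).
  have h := compensated_integralB T_gt0 (JP _ _ (uJ u v)) (hphi n u)
    (mphit _ _ (uJ u v) (card2 u v)) (pphi u) pt.
  by apply: filterS h => w h; rewrite /b /e /net_integral h addrC subrK.
- move=> u v; have h := compensated_integral_Lfun2 T_gt0 (hG _) (JP _ _ (uJ u v))
    (pphit _ _ (uJ u v) (card2 u v)) (sphit _ _ (uJ u v) (card2 u v)).
  exact: h.
- move=> u v.
  have mB : measurable_process T (fun t w => phi n u t w - phit n [set u; v]%SET u t w).
    by have h := measurable_funB (hphi n u) (mphit _ _ (uJ u v) (card2 u v)); exact: h.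
  have h := measurable_compensated_integral T_gt0 (hG _) (JP _ _ (uJ u v)) mB; exact: h.
- move=> u v uv.
  have ncj : {ae P, forall w i j, jump_of T (net_N N u) i.+1 w <= T ->
      jump_of T (net_N N u) i.+1 w <> jump_of T (net_N N v) j.+1 w}.
    (* A coincidence of two jump times up to [T] would be a simultaneous jump of distinct links,
       which the last clause of [counting_process] excludes. *)
    have [_ [cN _ nc] _ _ _] := hN; apply: filterS nc => w nc i j iT ij.
    have t0 := jump_of_gt0 T_gt0 (cN u) i w.
    have := nc u v uv (jump_of T (net_N N u) i.+1 w); rewrite t0 iT => /(_ isT); apply; split.
      exact: (jumps_at_jump_time T_gt0 (cN u w)).
    by rewrite ij; apply: (jumps_at_jump_time T_gt0 (cN v w)); rewrite -[leLHS]ij.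
  have h := compensated_integral_orthogonal T_gt0 (hG _) (JP _ _ (uJ u v)) (JP _ _ (vJ u v)) ncj
    (pphit _ _ (uJ u v) (card2 u v)) (pphit _ _ (vJ u v) (card2 u v))
    (sphit _ _ (uJ u v) (card2 u v)) (sphit _ _ (vJ u v) (card2 u v)).
  by rewrite /b [X in phit n X v](finset.setUC [set v]%SET); exact: h.
(* On the diagonal the left-out pair collapses to one link, and the bound is the leave-one-out term
   of the statement. *)
- move=> u; rewrite -[X in sqr_int _ _ _ (phit n X u)]finset.setUid.
  have bd := compensated_integral_sqr T_gt0 (hG _) (JP _ _ (uJ u u))
    (pphit _ _ (uJ u u) (card2 u u)) (sphit _ _ (uJ u u) (card2 u u)).
  rewrite unlock; apply: le_trans bd.
  by rewrite le_eqVlt; apply/orP; left; apply/eqP; apply: eq_integral => w _; rewrite expr2.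
- by move=> u v; have := hexp1 n u v; rewrite eE.
- by move=> u v; have := hexp2 n u v; rewrite eE.
Qed.
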